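(* Assume $V$ is $C^2$ with $\nabla^2V\succeq\alpha I$ for some $\alpha>0$. Let $\pi^\star(\mathrm{d}z)=\mathrm{p}^\star(\mathrm{d}z_1)\,\mathrm{q}^\star(\mathrm{d}z_{-1}\mid z_1)$ be a minimizer of $\mathrm{KL}(\cdot\|\pi)$ over $\mathcal{C}_{\rm star}$, with $\mathrm{q}^\star(\cdot\mid z_1)=\bigotimes_{i=2}^d\mathrm{q}^\star_i(\cdot\mid z_1)$, and suppose $\pi^\star$ has a differentiable Lebesgue density. Then $$\mathrm{p}^\star(z_1)\propto\exp\Big(-\int_0^{z_1}\int\partial_1V(s,z_{-1})\,\mathrm{q}^\star(\mathrm{d}z_{-1}\mid s)\,\mathrm{d}s\Big),$$ and for every $i\in\{2,\dots,d\}$, $$\mathrm{q}^\star_i(z_i\mid z_1)\propto\exp\Big(-\int V(z_1,z_i,z_{-\{1,i\}})\prod_{j\ge2,\,j\ne i}\mathrm{q}^\star_j(\mathrm{d}z_j\mid z_1)\Big).$$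
   Context: Let $d\ge 2$ and $\pi(z)\propto\exp(-V(z))$ on $\mathbb{R}^d$, where $V$ satisfies the growth condition: for every $c_2>0$ there is $c_1>0$ with $|V(z)|\le c_1e^{c_2\|z\|^2}$ for all $z$. Write $z=(z_1,z_{-1})$, $z_{-1}=(z_2,\dots,z_d)$, and $z_{-\{1,i\}}$ for $z$ with coordinates $1$ and $i$ removed; $\partial_1 V$ is the partial derivative in the first coordinate. $\mathcal{C}_{\rm star}$ is the set of probability measures $\mu$ on $\mathbb{R}^d$ of the form $\mu(\mathrm{d}z)=\mu_1(\mathrm{d}z_1)\prod_{j=2}^d\mu_j(\mathrm{d}z_j\mid z_1)$. Proportionality is in the free variable ($z_1$, resp. $z_i$ for fixed $z_1$). *)

(* Defs.v *)
From HB Require Import structures.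
From mathcomp Require Import all_boot all_order all_algebra.
From mathcomp Require Import all_classical all_reals all_analysis.
Set Implicit Arguments. Unset Strict Implicit. Unset Printing Implicit Defensive.
Import Order.TTheory GRing.Theory Num.Theory.
Import numFieldNormedType.Exports.
Local Open Scope classical_set_scope.
Local Open Scope ring_scope.

Section Defs.
Variables (R : realType) (d : nat).

Definition evec (i : 'I_d) : 'rV[R]_d := delta_mx 0 i.

Definition setc (z : 'rV[R]_d) (k : 'I_d) (t : R) : 'rV[R]_d :=
  \row_j (if j == k then t else z 0 j).

Definition sqnorm (z : 'rV[R]_d) : R := \sum_i z 0 i ^+ 2.

Definition partial (i : 'I_d) (f : 'rV[R]_d -> R) : 'rV[R]_d -> R :=
  fun z => 'D_(evec i) f z.

Definition C2 (f : 'rV[R]_d -> R) : Prop :=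
  continuous f /\
  (forall i z, derivable f z (evec i)) /\
  (forall i, continuous (partial i f)) /\
  (forall i j z, derivable (partial i f) z (evec j)) /\
  (forall i j, continuous (partial j (partial i f))).

Definition hess (f : 'rV[R]_d -> R) (z : 'rV[R]_d) (i j : 'I_d) : R :=
  partial j (partial i f) z.

Definition hess_ge (f : 'rV[R]_d -> R) (alpha : R) : Prop :=
  forall (z v : 'rV[R]_d),
    alpha * sqnorm v <= \sum_i \sum_j v 0 i * v 0 j * hess f z i j.

(* Growth condition of the standing assumptions *)
Definition growth (V : 'rV[R]_d -> R) : Prop :=
  forall c2 : R, 0 < c2 -> exists c1 : R, 0 < c1 /\
    forall z, `|V z| <= c1 * expR (c2 * sqnorm z).

(* Iterated Lebesgue integral over the coordinates listed in S (each once),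
   the other coordinates being those of the base point z. *)
Definition int_over (S : seq 'I_d) (F : 'rV[R]_d -> \bar R) : 'rV[R]_d -> \bar R :=
  foldr (fun k G => fun z => (\int[@lebesgue_measure R]_(t in setT) G (setc z k t))%E)
        F S.

Definition intRd (F : 'rV[R]_d -> \bar R) : \bar R :=
  int_over (enum 'I_d) F 0.

Definition oint (a b : R) (g : R -> \bar R) : \bar R :=
  if a <= b then (\int[@lebesgue_measure R]_(s in `[a, b]) g s)%E
  else (- \int[@lebesgue_measure R]_(s in `[b, a]) g s)%E.

Definition pi_dens (V : 'rV[R]_d -> R) (z : 'rV[R]_d) : R :=
  expR (- V z) / fine (intRd (fun z => (expR (- V z))%:E)).

(* KL(mu || pi) for mu with Lebesgue density f (a probability density):
   KL = int pi * phi(f/pi), phi(t) = t ln t - t + 1 (nonnegative integrand,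
   equal to int f ln(f/pi) since both are probability densities). *)
Definition KL (f : 'rV[R]_d -> R) (V : 'rV[R]_d -> R) : \bar R :=
  intRd (fun z => (f z * ln (f z / pi_dens V z) - f z + pi_dens V z)%:E).

Variable i1 : 'I_d.

Definition others : seq 'I_d := [seq j <- enum 'I_d | j != i1].

Definition star_dens (p : R -> R) (q : 'I_d -> R -> R -> R) (z : 'rV[R]_d) : R :=
  p (z 0 i1) * \prod_(j | j != i1) q j (z 0 i1) (z 0 j).

(* (p, q) describes an element of C_star (absolutely continuous case):
   p is a probability density on R, and for every z_1 and j <> 1,
   q j z_1 is a probability density on R, jointly measurable in (z_1, z_j). *)
Definition is_star (p : R -> R) (q : 'I_d -> R -> R -> R) : Prop :=
  measurable_fun setT p /\ (forall x, 0 <= p x) /\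
  (\int[@lebesgue_measure R]_(x in setT) (p x)%:E = 1)%E /\
  forall j, j != i1 ->
    measurable_fun setT (fun xy : R * R => q j xy.1 xy.2) /\
    (forall x y, 0 <= q j x y) /\
    (forall x, \int[@lebesgue_measure R]_(y in setT) (q j x y)%:E = 1)%E.

Definition cond_dV1 (V : 'rV[R]_d -> R) (q : 'I_d -> R -> R -> R) (s : R) : \bar R :=
  int_over others
    (fun z => (partial i1 V z * \prod_(j | j != i1) q j (z 0 i1) (z 0 j))%:E)
    (setc 0 i1 s).

Definition cond_V (V : 'rV[R]_d -> R) (q : 'I_d -> R -> R -> R) (i : 'I_d)
  (z1 zi : R) : \bar R :=
  int_over [seq j <- enum 'I_d | (j != i1) && (j != i)]
    (fun z => (V z * \prod_(j | (j != i1) && (j != i)) q j (z 0 i1) (z 0 j))%:E)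
    (setc (setc 0 i1 z1) i zi).

End Defs.

(* Submission.v *)
Require Import Defs.
From HB Require Import structures.
From mathcomp Require Import all_boot all_order all_algebra.
From mathcomp Require Import all_classical all_reals all_analysis.
From mathcomp Require Import measurable_realfun ring lra.
Import Order.TTheory GRing.Theory Num.Theory.
Import numFieldNormedType.Exports.
Local Open Scope classical_set_scope.
Local Open Scope ring_scope.

(* Integrating out z_2, ..., z_d gives KL = \int p ln (p / E), where
   E(s) = exp (- KL (q(. | s) || pi(s, .))) with pi(s, .) not normalised; at a
   minimizer p = E / \int E and E is, almost everywhere, the largest value attainable
   by a product kernel.

   Maximality against the update of a single factor q_i gives the Gibbs fixed-point
   equation, which is the conditional formula; the quadratic growth of V then yields
   Gaussian moments of q(. | s), locally uniformly in s, so that all integrals converge.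

   Maximality against the translated kernel q(. | s - k) gives, for F = - ln E,
   F(s + k) - F(s) <= \int (V(s + k, y) - V(s, y)) q(dy | s) for almost every s and both
   signs of k. Integrating over an interval, dividing by k and letting k -> 0 yields
   F(t) - F(s) = \int_s^t \int d_1 V dq at Lebesgue points. *)

(** * Measurability and iterated integrals on row vectors *)

(** No regularity of [q] in its first argument is known, so E cannot be differentiated directly, and
    minimality can be tested only against competitors that are themselves measurable kernels.
    Translating the kernel compares E at two points all the same: entropy is unchanged and only the
    energy varies, as smoothly as V does, so a pair of inequalities takes the place of a derivative.

    Entropies may be infinite a priori. The nonnegative integrand of [KL] makes every iterated
    integral meaningful by Tonelli's theorem, infinite entropy is recorded as E = 0, and a relative
    entropy is split into entropy and energy only once the Gaussian moments have made the energy
    integrable.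

    The uniform law on the unit cube is the comparison kernel that makes the minimum finite and
    bounds E below, locally uniformly, by an explicit function. Convexity acts twice: the quadratic
    lower bound on V gives the Gaussian tails, and the monotonicity of d_1 V bounds it by values of
    V, to which the growth condition applies. *)

(* The product sigma-algebra; it comes with its own display because the library
   gives no measurable structure to matrices. *)
Definition rowvec_display (R : realType) (d : nat) : measure_display.
Proof. exact. Qed.

Section rowvec_measurable.
Variables (R : realType) (d : nat).
Let coors : 'I_d -> 'rV[R]_d -> measurableTypeR R := fun i z => z 0 i.

Let rowvec_set0 : g_sigma_preimage coors set0.
Proof. exact: sigma_algebra0. Qed.
Let rowvec_setC A : g_sigma_preimage coors A -> g_sigma_preimage coors (~` A).
Proof. exact: sigma_algebraC. Qed.
Let rowvec_bigcup (F : _^nat) : (forall i, g_sigma_preimage coors (F i)) ->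
  g_sigma_preimage coors (\bigcup_i (F i)).
Proof. exact: sigma_algebra_bigcup. Qed.

HB.instance Definition _ := @isMeasurable.Build (rowvec_display R d)
  'rV[R]_d (g_sigma_preimage coors) rowvec_set0 rowvec_setC rowvec_bigcup.

Lemma measurable_coord (i : 'I_d) : measurable_fun setT (fun z : 'rV[R]_d => z 0 i).
Proof.
move=> _ Y mY; rewrite setTI; apply: sub_sigma_algebra => /=.
rewrite -bigcup_seq/=; exists i => /=; first by rewrite mem_index_enum.
by exists Y => //; rewrite setTI.
Qed.

Lemma measurable_rowvecP d1 (T1 : measurableType d1) (f : T1 -> 'rV[R]_d) :
  (forall i, measurable_fun setT (fun x => f x 0 i)) -> measurable_fun setT f.
Proof.
move=> mf.
suff prefS : g_sigma_preimage (fun i => coors i \o f) `<=` measurable.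
  move=> _ A mA; rewrite setTI; apply: prefS.
  by rewrite g_sigma_preimage_comp; exists A => //; rewrite setTI.
apply: smallest_sub; first exact: sigma_algebra_measurable.
rewrite -bigcup_seq; apply: bigcup_sub => i _ A [B mB <-].
exact: mf.
Qed.

End rowvec_measurable.

Section setc_lemmas.
Context {R : realType} {d : nat}.
Implicit Types (z : 'rV[R]_d) (k l : 'I_d) (t u : R).

Lemma setcE z k t j : setc z k t 0 j = if j == k then t else z 0 j.
Proof. by rewrite mxE. Qed.

Lemma setcC z k l t u : k != l -> setc (setc z k t) l u = setc (setc z l u) k t.
Proof.
move=> kl; apply/rowP => j; rewrite !setcE.
by case: (j =P l) => [->|//]; case: (l =P k) => [lk|//]; rewrite lk eqxx in kl.
Qed.

Lemma setcK z k t u : setc (setc z k t) k u = setc z k u.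
Proof. by apply/rowP => j; rewrite !setcE; case: (j == k). Qed.

Lemma setc_id z k : setc z k (z 0 k) = z.
Proof. by apply/rowP => j; rewrite setcE; case: eqP => [->|]. Qed.

Lemma measurable_setc {d1} {T : measurableType d1} (f : T -> 'rV[R]_d) (g : T -> R) k :
  measurable_fun setT f -> measurable_fun setT g ->
  measurable_fun setT (fun x => setc (f x) k (g x)).
Proof.
move=> mf mg; apply: measurable_rowvecP => i.
under eq_fun do rewrite setcE.
case: eqP => // _.
by apply: (measurableT_comp (measurable_coord R d i) mf).
Qed.

End setc_lemmas.

Section int_over_lemmas.
Context {R : realType} {d : nat}.
Local Notation T := 'rV[R]_d.
Local Notation lam := (@lebesgue_measure R).
Local Open Scope ereal_scope.
Implicit Types (F G : T -> \bar R) (S : seq 'I_d) (z : T).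

Lemma int_over_cons k S F z :
  int_over (k :: S) F z = \int[lam]_t int_over S F (setc z k t).
Proof. by []. Qed.

Lemma eq_int_over S F G z : F =1 G -> int_over S F z = int_over S G z.
Proof. by move=> /funext ->. Qed.

Lemma int_over_ge0 S F : (forall z, 0 <= F z) -> forall z, 0 <= int_over S F z.
Proof.
move=> F0; elim: S => //= k S IH z.
by apply: integral_ge0 => t _; exact: IH.
Qed.

Lemma measurable_int1_ge0 k F : measurable_fun setT F -> (forall z, 0 <= F z) ->
  measurable_fun setT (fun z => \int[lam]_t F (setc z k t)).
Proof.
move=> mF F0.
apply: (measurable_fun_fubini_tonelli_F (m2 := lam)
  (fun zt : T * measurableTypeR R => F (setc zt.1 k zt.2))) => //.
by apply: (measurableT_comp mF); exact: measurable_setc.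
Qed.

Lemma measurable_int_over S F : measurable_fun setT F ->
  measurable_fun setT (int_over S F).
Proof.
move=> mF; elim: S => //= k S IH.
have -> : (fun z => \int[lam]_t int_over S F (setc z k t)) =
    (fun z => \int[lam]_t (int_over S F)^\+ (setc z k t) -
              \int[lam]_t (int_over S F)^\- (setc z k t)).
  apply/funext => z; rewrite integralE; congr (_ - _); apply: eq_integral => t _.
  - by rewrite !funeposE.
  - by rewrite !funenegE.
apply: emeasurable_funB.
- by apply: measurable_int1_ge0 => //; exact: measurable_funepos.
- by apply: measurable_int1_ge0 => //; exact: measurable_funeneg.
Qed.

Lemma measurable_int_over_setc S F z k : measurable_fun setT F ->
  measurable_fun setT (fun t : R => int_over S F (setc z k t)).
Proof.
move=> mF; apply: (measurableT_comp (measurable_int_over S _ mF)).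
exact: measurable_setc.
Qed.

Lemma int_over_setc S k F : k \notin S -> forall z t,
  int_over S F (setc z k t) = int_over S (fun z => F (setc z k t)) z.
Proof.
elim: S => //= l S IH; rewrite inE negb_or => /andP[kl kS] z t.
apply: eq_integral => u _.
by rewrite setcC// IH.
Qed.

Lemma int_overD S F G : measurable_fun setT F -> measurable_fun setT G ->
  (forall z, 0 <= F z) -> (forall z, 0 <= G z) ->
  int_over S (fun z => F z + G z) = (fun z => int_over S F z + int_over S G z).
Proof.
move=> mF mG F0 G0; elim: S => //= k S ->; apply/funext => z.
rewrite ge0_integralD//.
- by move=> t _; exact: int_over_ge0.
- exact: measurable_int_over_setc.
- by move=> t _; exact: int_over_ge0.
- exact: measurable_int_over_setc.
Qed.

Lemma int_overZl S F (c : T -> R) : measurable_fun setT F ->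
  (forall z, 0 <= F z) -> (forall z, 0 <= c z)%R ->
  (forall z k t, k \in S -> c (setc z k t) = c z) ->
  forall z, int_over S (fun z => (c z)%:E * F z) z = (c z)%:E * int_over S F z.
Proof.
move=> mF F0 c0; elim: S => //= k S IH cS z.
have cS' z' k' t' : k' \in S -> c (setc z' k' t') = c z'.
  by move=> kS; rewrite cS// inE kS orbT.
under eq_integral do rewrite IH// cS ?mem_head//.
rewrite ge0_integralZl//.
- exact: measurable_int_over_setc.
- by move=> t _; exact: int_over_ge0.
- by rewrite lee_fin.
Qed.

Lemma le_int_over S F G : measurable_fun setT F -> measurable_fun setT G ->
  (forall z, 0 <= F z) -> (forall z, F z <= G z) ->
  forall z, int_over S F z <= int_over S G z.
Proof.
move=> mF mG F0 FG; elim: S => //= k S IH z.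
apply: ge0_le_integral => //.
- by move=> t _; exact: int_over_ge0.
- exact: measurable_int_over_setc.
- exact: measurable_int_over_setc.
Qed.

Lemma int_over_nneseries S (F : nat -> T -> \bar R) :
  (forall n, measurable_fun setT (F n)) -> (forall n z, 0 <= F n z) ->
  int_over S (fun z => \sum_(n <oo) F n z) = (fun z => \sum_(n <oo) int_over S (F n) z).
Proof.
move=> mF F0; elim: S => //= k S ->; apply/funext => z.
rewrite integral_nneseries//.
- by move=> n; exact: measurable_int_over_setc.
- by move=> n t _; exact: int_over_ge0.
Qed.

Lemma int_over_gt0 S F : measurable_fun setT F -> (forall z, 0 < F z) ->
  forall z, 0 < int_over S F z.
Proof.
move=> mF F0; elim: S => //= k S IH z.
have G0 t : 0 <= int_over S F (setc z k t) by exact: ltW.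
rewrite lt_neqAle integral_ge0// andbT eq_sym; apply/eqP => I0.
have : \int[lam]_t `|int_over S F (setc z k t)| = 0.
  by rewrite -[RHS]I0; apply: eq_integral => t _; rewrite gee0_abs.
move/(ae_eq_integral_abs lam measurableT (measurable_int_over_setc S F z k mF)).
move=> [N [mN N0 sN]].
have : lam setT <= lam N.
  apply: le_measure; rewrite ?inE// => t _; apply: sN => /=.
  by move/(_ I) => H; have := IH (setc z k t); rewrite H ltxx.
rewrite N0.
have -> : lam [set: R] = +oo by rewrite -set_itvNyy lebesgue_measure_itv.
by [].
Qed.

End int_over_lemmas.

Section coord_measure.
Context {R : realType} {d : nat}.
Local Notation T := 'rV[R]_d.
Local Notation lam := (@lebesgue_measure R).
Local Open Scope ereal_scope.
Implicit Types (F G : T -> \bar R) (z : T).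
Variables (S : seq 'I_d) (z : T).

(** Lebesgue measure on the slice through [z] along the coordinates in [S] (each listed once), seen
    as a measure on the whole space. Densities thus remain functions of the full row vector, and
    iterated integrals become integrals against a measure, open to dominated convergence. *)
Definition coord_measure (A : set T) : \bar R :=
  int_over S (fun x => (\1_A x)%:E) z.

Let coord_measure0 : coord_measure set0 = 0.
Proof.
rewrite /coord_measure; under eq_int_over do rewrite indic0.
elim: S z => //= k S' IH z'.
by apply: integral0_eq => t _; rewrite IH.
Qed.

Let coord_measure_ge0 A : 0 <= coord_measure A.
Proof. by apply: int_over_ge0 => x; rewrite lee_fin. Qed.

Let coord_measure_semi_sigma_additive : semi_sigma_additive coord_measure.
Proof.
move=> A mA tA mUA.
rewrite /coord_measure.
have -> : (fun x => (\1_(\bigcup_n A n) x)%:E) =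
          (fun x => \sum_(n <oo) (\1_(A n) x)%:E) :> (T -> \bar R).
  apply/funext => x.
  transitivity (dirac x (\bigcup_n A n) : \bar R) => //; rewrite measure_semi_bigcup//.
rewrite int_over_nneseries.
- by apply: is_cvg_nneseries => n _ _; apply: int_over_ge0 => x; rewrite lee_fin.
- by move=> n; exact/measurable_EFinP.
- by move=> n x; rewrite lee_fin.
Qed.

HB.instance Definition _ := isMeasure.Build _ T R coord_measure
  coord_measure0 coord_measure_ge0 coord_measure_semi_sigma_additive.

End coord_measure.
Arguments coord_measure {R d} S z.

Section coord_measure_integral.
Context {R : realType} {d : nat}.
Local Notation T := 'rV[R]_d.
Local Notation lam := (@lebesgue_measure R).
Local Open Scope ereal_scope.
Implicit Types (F G : T -> \bar R) (S : seq 'I_d) (z : T).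
Import HBNNSimple.

Lemma cvg_int_over S (f : nat -> T -> \bar R) F :
  (forall n, measurable_fun setT (f n)) -> (forall n z, 0 <= f n z) ->
  (forall z, nondecreasing_seq (f ^~ z)) ->
  (forall z, f ^~ z @ \oo --> F z) ->
  forall z, (fun n => int_over S (f n) z) @ \oo --> int_over S F z.
Proof.
move=> mf f0 ndf fF; elim: S => //= k S IH z.
have -> : \int[lam]_t int_over S F (setc z k t) =
    \int[lam]_t limn (fun n => int_over S (f n) (setc z k t)).
  by apply: eq_integral => t _; apply/esym/cvg_lim => //; exact: IH.
apply: (@cvg_monotone_convergence _ _ _ lam setT measurableT
  (fun n t => int_over S (f n) (setc z k t))).
- by move=> n; exact: measurable_int_over_setc.
- by move=> n t _; exact: int_over_ge0.
- by move=> t _ a b ab; apply: le_int_over => // x; exact: ndf.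
Qed.

Lemma int_over_nnsfun S (f : {nnsfun T >-> R}) z :
  int_over S (fun x => (f x)%:E) z = \int[coord_measure S z]_x (f x)%:E.
Proof.
rewrite integralT_nnsfun sintegralE.
transitivity (\sum_(x \in range f) int_over S (fun y => x%:E * (\1_(f @^-1` [set x]) y)%:E) z).
  rewrite fsbig_finite//=.
  have E y : (f y)%:E = \sum_(x <- finmap.enum_fset (fset_set (range f))) x%:E * (\1_(f @^-1` [set x]) y)%:E.
    by rewrite fimfunE -fsumEFin// fsbig_finite//=.
  rewrite (eq_int_over _ _ _ _ E).
  have : forall x, x \in (finmap.enum_fset (fset_set (range f))) -> (0 <= x)%R.
    by move=> x; rewrite in_fset_set// inE => -[y _ <-].
  elim: (finmap.enum_fset (fset_set (range f))) => [_|r s IH s0].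
    under eq_int_over do rewrite big_nil.
    rewrite big_nil; elim: S z => //= k S' IH z'.
    by apply: integral0_eq => t _; rewrite IH.
  under eq_int_over do rewrite big_cons.
  have s0' x : x \in s -> (0 <= x)%R by move=> xs; rewrite s0// inE xs orbT.
  rewrite big_cons -(IH s0') int_overD//.
  - by apply: measurable_funeM; exact/measurable_EFinP.
  - apply: emeasurable_sum => n; apply: measurable_funeM; exact/measurable_EFinP.
  - by move=> y; rewrite mule_ge0// lee_fin// s0// mem_head.
  - move=> y; rewrite big_seq; apply: sume_ge0 => x xs.
    by rewrite mule_ge0// lee_fin// s0'.
apply: eq_fsbigr => r; rewrite inE => -[y _ <-].
rewrite (int_overZl S (fun x => (\1_(f @^-1` [set f y]) x)%:E) (fun=> f y))//.
exact/measurable_EFinP.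
Qed.

Lemma ge0_int_over_integral S F z : measurable_fun setT F -> (forall x, 0 <= F x) ->
  int_over S F z = \int[coord_measure S z]_x F x.
Proof.
move=> mF F0.
pose g := nnsfun_approx measurableT mF.
have gF x : (fun n => (g n x)%:E) @ \oo --> F x by exact: cvg_nnsfun_approx.
have c1 : (fun n => int_over S (EFin \o g n) z) @ \oo --> int_over S F z.
  apply: cvg_int_over => //.
  - by move=> n; exact/measurable_EFinP.
  - by move=> n x /=; rewrite lee_fin.
  - by move=> x a b ab; rewrite lee_fin; exact/lefP/nd_nnsfun_approx.
have c2 : (fun n => \int[coord_measure S z]_x (g n x)%:E) @ \oo -->
    \int[coord_measure S z]_x F x.
  have -> : \int[coord_measure S z]_x F x =
    \int[coord_measure S z]_x limn (fun n => (g n x)%:E).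
    by apply: eq_integral => x _; apply/esym/cvg_lim.
  apply: cvg_monotone_convergence => //.
  - by move=> n; exact/measurable_EFinP.
  - by move=> n x _; rewrite lee_fin.
  - by move=> x _ a b ab; rewrite lee_fin; exact/lefP/nd_nnsfun_approx.
have -> : \int[coord_measure S z]_x F x = limn (fun n => \int[coord_measure S z]_x (g n x)%:E).
  by apply/esym/cvg_lim.
have E : (fun n => int_over S (EFin \o g n) z) =
         (fun n => \int[coord_measure S z]_x (g n x)%:E).
  by apply/funext => n; exact: int_over_nnsfun.
by rewrite -E; apply/esym/cvg_lim.
Qed.

(** For signed functions, the iterated integrals of the positive and negative parts can be
    subtracted only where they are not both infinite. Integrability ensures this for almost every
    value of each coordinate, and the exceptional values do not affect the next integral. *)
Lemma int_overE S F z : measurable_fun setT F ->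
  (coord_measure S z).-integrable setT F ->
  int_over S F z = \int[coord_measure S z]_x F x.
Proof.
move=> mF /integrableP[_].
have mp := measurable_funepos mF; have mn := measurable_funeneg mF.
have ma : measurable_fun setT (fun x => `|F x|) by exact: measurableT_comp.
rewrite -(ge0_int_over_integral S (fun x => `|F x|) z ma)// => Foo.
rewrite integralE -!ge0_int_over_integral//.
elim: S z Foo => [|k S IH] z /= Foo; first exact: (congr1 (@^~ z) (funeposneg F)).
have le1 (G : T -> \bar R) : measurable_fun setT G -> (forall x, 0 <= G x) ->
    (forall x, G x <= `|F x|) -> forall x, int_over S G x <= int_over S (fun x => `|F x|) x.
  by move=> mG G0 GF; exact: le_int_over.
have pF x : F^\+ x <= `|F x|.
  by rewrite -[leRHS]/((abse \o F) x) fune_abse leeDl.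
have nF x : F^\- x <= `|F x|.
  by rewrite -[leRHS]/((abse \o F) x) fune_abse leeDr.
have mI := measurable_int_over_setc S _ z k.
have fin : {ae lam, forall t, int_over S (fun x => `|F x|) (setc z k t) \is a fin_num}.
  have : lam.-integrable setT (fun t => int_over S (fun x => `|F x|) (setc z k t)).
    apply/integrableP; split; first exact: mI.
    under eq_integral do rewrite gee0_abs ?int_over_ge0//.
    exact: Foo.
  by move/(integrable_ae measurableT); apply: filterS => t; exact.
transitivity (\int[lam]_t (int_over S F^\+ (setc z k t) - int_over S F^\- (setc z k t))).
  apply: ae_eq_integral => //.
  - exact: mI.
  - by apply: emeasurable_funB; exact: mI.
  - apply: (@filterS _ _ (ae_filter_ringOfSetsType lam) _ _ _ fin) => t ft _; apply: IH.
    by rewrite ltey_eq ft.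
rewrite integralB//.
- apply/integrableP; split; first exact: mI.
  apply: le_lt_trans Foo; apply: ge0_le_integral => //.
  + by apply: measurableT_comp => //; exact: mI.
  + exact: mI.
  + by move=> t _; rewrite gee0_abs ?int_over_ge0// le1.
- apply/integrableP; split; first exact: mI.
  apply: le_lt_trans Foo; apply: ge0_le_integral => //.
  + by apply: measurableT_comp => //; exact: mI.
  + exact: mI.
  + by move=> t _; rewrite gee0_abs ?int_over_ge0// le1.
Qed.

Lemma int_over_swap k l S F z : measurable_fun setT F -> (forall x, 0 <= F x) ->
  int_over (k :: l :: S) F z = int_over (l :: k :: S) F z.
Proof.
move=> mF F0 /=.
have [->//|kl] := eqVneq k l.
pose f (tu : measurableTypeR R * measurableTypeR R) :=
  int_over S F (setc (setc z k tu.1) l tu.2).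
have mf : measurable_fun setT f.
  apply: (measurableT_comp (measurable_int_over S F mF)).
  by apply: measurable_setc => //; exact: measurable_setc.
have -> : \int[lam]_t \int[lam]_u int_over S F (setc (setc z l t) k u) =
    \int[lam]_t \int[lam]_u f (u, t).
  by apply: eq_integral => t _; apply: eq_integral => u _; rewrite /f/= [in RHS]setcC.
by apply: (@fubini_tonelli _ _ _ _ R lam lam f mf) => x; exact: int_over_ge0.
Qed.

(** A swap of neighbours is Tonelli's theorem; [rot1] moves one coordinate to the front by such
    swaps, and induction handles the others. *)
Lemma perm_int_over S S' F : measurable_fun setT F -> (forall x, 0 <= F x) ->
  perm_eq S S' -> int_over S F = int_over S' F.
Proof.
move=> mF F0.
have rot1 k A B : int_over (A ++ k :: B) F = int_over (k :: A ++ B) F.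
  elim: A => //= l A IH; apply/funext => z.
  under eq_integral do rewrite IH.
  exact: (int_over_swap l k (A ++ B) F z).
elim: S S' => [|k S IH] S'.
  by move=> /perm_size/esym/eqP; rewrite size_eq0 => /eqP ->.
move=> SS'; have kS' : k \in S' by rewrite -(perm_mem SS') mem_head.
case/splitPr: kS' SS' => A B; rewrite perm_sym perm_catC/= perm_cons perm_catC perm_sym.
by move=> /IH SAB; rewrite rot1 /= SAB.
Qed.

End coord_measure_integral.

(** * The Gibbs variational principle *)

Section kl_lemmas.
Context {R : realType}.
Implicit Types a b c m N : R.

(** The integrand of [KL] at one point. The correction - a + b makes it nonnegative; it integrates
    to zero only against normalised densities, which is why masses B appear once the formula is
    restricted to slices. *)
Definition kl a b := a * ln (a / b) - a + b.

Lemma kl0 b : kl 0 b = b.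
Proof. by rewrite /kl mul0r subr0 add0r. Qed.

Lemma klE a b : 0 <= a -> 0 < b -> kl a b = a * (ln a - ln b) - a + b.
Proof.
rewrite le_eqVlt => /predU1P[<-|a0] b0; first by rewrite kl0 mul0r subr0 add0r.
by rewrite /kl ln_div// posrE.
Qed.

Lemma kl_ge0 a b : 0 <= a -> 0 < b -> 0 <= kl a b.
Proof.
move=> a0 b0; rewrite klE//.
move: a0; rewrite le_eqVlt => /predU1P[<-|a0].
  by rewrite mul0r subr0 add0r ltW.
have ab0 : 0 < b / a by rewrite divr_gt0.
have h : ln (1 + (b / a - 1)) <= b / a - 1 by apply: le_ln1Dx; rewrite ltrBrDl addrN.
rewrite addrC subrK ln_div ?posrE// in h.
have := ler_wpM2l (ltW a0) h.
have -> : a * (b / a - 1) = b - a by field; rewrite gt_eqF.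
lra.
Qed.

Lemma kl_eq0 a b : 0 <= a -> 0 < b -> kl a b = 0 -> a = b.
Proof.
move=> a0 b0; rewrite klE//.
move: a0; rewrite le_eqVlt => /predU1P[<-|a0].
  by rewrite mul0r subr0 add0r => ->.
have [e|ne] := eqVneq (ln b - ln a) 0.
  have -> : ln a - ln b = 0 by lra.
  lra.
have := expR_gt1Dx ne; rewrite expRB !lnK ?posrE// => h k0.
have := ltr_pM2l a0 (1 + (ln b - ln a)) (b / a); rewrite h.
have -> : a * (b / a) = b by field; rewrite gt_eqF.
lra.
Qed.

(** Extracts the factor that is constant along a slice: c will be the value of a marginal density
    and m a conditional one. *)
Lemma kl_scale c m b : 0 < c -> 0 <= m -> 0 < b ->
  kl (c * m) b = c * kl m b + c * ln c * m - c * b + b.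
Proof.
move=> c0 m0 b0; rewrite !klE ?mulr_ge0 ?(ltW c0)//.
move: m0; rewrite le_eqVlt => /predU1P[<-|m0]; first by ring.
by rewrite lnM ?posrE//; ring.
Qed.

Lemma kl_change a b c : 0 <= a -> 0 < b -> 0 < c ->
  kl a b = kl a c + a * (ln c - ln b) + b - c.
Proof. by move=> a0 b0 c0; rewrite !klE//; ring. Qed.

(** Lets a real of unknown sign be distributed over the two sides of an identity between extended
    reals, so that only integrals of nonnegative functions are ever added and infinite values need
    no separate treatment. *)
Lemma posneg_split x : exists p n : R, [/\ 0 <= p, 0 <= n & x = p - n].
Proof.
have [x0|x0] := leP 0 x; first by exists x, 0; split; rewrite ?subr0.
by exists 0, (- x); split; rewrite ?opprK ?add0r// oppr_ge0 ltW.
Qed.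

End kl_lemmas.

Section gibbs.
Local Open Scope ereal_scope.
Context {d} {T : measurableType d} {R : realType}.
Variable mu : {measure set T -> \bar R}.
Implicit Types m b : T -> R.

Definition klint m b := \int[mu]_x (kl (m x) (b x))%:E.

(* When [m] and [b] have integrals [1] and [B], [klint m b] is
   [\int m ln (m / b) - 1 + B]; hence [gibbsE m b] is [exp (- \int m ln (m / b))],
   with value [0] when the relative entropy is infinite. *)
Definition gibbsE m b : R :=
  if klint m b < +oo then
    expR (- (fine (klint m b) + 1 - fine (\int[mu]_x (b x)%:E)))
  else 0%R.

Lemma measurable_kl d' (T' : measurableType d') (m b : T' -> R) :
  measurable_fun setT m -> measurable_fun setT b ->
  (forall x, (0 <= m x)%R) -> (forall x, (0 < b x)%R) ->
  measurable_fun setT (fun x => kl (m x) (b x)).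
Proof.
move=> mm mb m0 b0.
under eq_fun do rewrite klE//.
apply: measurable_funD => //; apply: measurable_funB => //.
apply: measurable_funM => //; apply: measurable_funB.
- exact: (measurableT_comp (@measurable_ln R)).
- exact: (measurableT_comp (@measurable_ln R)).
Qed.

Variables m b : T -> R.
Hypotheses (mm : measurable_fun setT m) (mb : measurable_fun setT b).
Hypotheses (m0 : forall x, (0 <= m x)%R) (b0 : forall x, (0 < b x)%R).
Hypothesis m1 : \int[mu]_x (m x)%:E = 1.
Variable B : R.
Hypothesis bB : \int[mu]_x (b x)%:E = B%:E.

Lemma klint_ge0 c : (0 <= c)%R -> 0 <= klint (fun x => c * m x)%R b.
Proof.
move=> c0; apply: integral_ge0 => x _.
by rewrite lee_fin kl_ge0// mulr_ge0.
Qed.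

Let L := klint m b.

Let L0 : 0 <= L.
Proof. by apply: integral_ge0 => x _; rewrite lee_fin kl_ge0. Qed.

Let B0 : (0 <= B)%R.
Proof. by rewrite -lee_fin -bB integral_ge0// => x _; rewrite lee_fin ltW. Qed.

Let mk : measurable_fun setT (fun x => (kl (m x) (b x))%:E).
Proof. by apply/measurable_EFinP; exact: measurable_kl. Qed.

Let int_cst_mul (c : R) (f : T -> R) : (0 <= c)%R -> measurable_fun setT f ->
  (forall x, (0 <= f x)%R) ->
  \int[mu]_x (c * f x)%:E = c%:E * \int[mu]_x (f x)%:E.
Proof.
move=> c0 mf f0; under eq_integral do rewrite EFinM.
rewrite ge0_integralZl//; first exact/measurable_EFinP.
by move=> x _; rewrite lee_fin.
Qed.

Let int_add (f g : T -> R) : measurable_fun setT f -> measurable_fun setT g ->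
  (forall x, (0 <= f x)%R) -> (forall x, (0 <= g x)%R) ->
  \int[mu]_x (f x + g x)%:E = \int[mu]_x (f x)%:E + \int[mu]_x (g x)%:E.
Proof.
move=> mf mg f0 g0; under eq_integral do rewrite EFinD.
by rewrite ge0_integralD//; (try exact/measurable_EFinP) => x _; rewrite lee_fin.
Qed.

Let mcm (c : R) : measurable_fun setT (fun x => c * m x)%R.
Proof. exact: measurable_funM. Qed.

Let mcb (c : R) : measurable_fun setT (fun x => c * b x)%R.
Proof. exact: measurable_funM. Qed.

(** Integrated [kl_scale]. Writing c ln c = p - n and moving n and c B to the left gives an identity
    between sums of nonnegative terms, valid also when the relative entropy is infinite. *)
Lemma klint_scale c : (0 < c)%R ->
  klint (fun x => c * m x)%R b =
  if L < +oo then (c * fine L + c * ln c - c * B + B)%:E else +oo.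
Proof.
move=> c0; have c0' := ltW c0.
have [p [n [p0 n0 pn]]] := posneg_split (c * ln c)%R.
set X := klint _ _.
have X0 : 0 <= X by exact: klint_ge0.
have cm0 x : (0 <= c * m x)%R by rewrite mulr_ge0.
have cb0 x : (0 <= c * b x)%R by rewrite mulr_ge0// ltW.
have b0' x : (0 <= b x)%R by rewrite ltW.
have kc0 x : (0 <= kl (c * m x) (b x))%R by rewrite kl_ge0.
have k0 x : (0 <= kl (m x) (b x))%R by rewrite kl_ge0.
have mkl := measurable_kl _ _ _ _ mm mb m0 b0.
have mckl := measurable_kl _ _ _ _ (mcm c) mb cm0 b0.
have : X + (c * B)%:E + n%:E = c%:E * L + p%:E + B%:E.
  have -> : X + (c * B)%:E + n%:E =
      \int[mu]_x (kl (c * m x) (b x) + c * b x + n * m x)%:E.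
    rewrite int_add//; last 3 first.
    - exact: measurable_funD.
    - by move=> x; rewrite addr_ge0.
    - by move=> x; rewrite mulr_ge0.
    rewrite int_add//.
    by rewrite !int_cst_mul// bB m1 mule1 EFinM.
  have -> : c%:E * L + p%:E + B%:E =
      \int[mu]_x (c * kl (m x) (b x) + p * m x + b x)%:E.
    rewrite !int_add//; last 5 first.
    - exact: measurable_funM.
    - by move=> x; rewrite mulr_ge0.
    - by move=> x; rewrite mulr_ge0.
    - by apply: measurable_funD => //; exact: measurable_funM.
    - by move=> x; rewrite addr_ge0// mulr_ge0.
    by rewrite !int_cst_mul// bB m1 mule1.
  apply: eq_integral => x _; congr (_%:E).
  by rewrite kl_scale// pn; ring.
case: ifPn => [Loo|]; last first.
  rewrite -leNgt leye_eq => /eqP ->.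
  rewrite gt0_muley ?lte_fin// => h.
  by move: X0 h; case: X.
move: Loo L0; case: L => //= l _ _ h.
move: X0 h; case: X => //= x _ [] h; congr (_%:E).
by rewrite pn; lra.
Qed.

Lemma gibbsE_ge0 : (0 <= gibbsE m b)%R.
Proof. by rewrite /gibbsE; case: ifP => // _; exact: expR_ge0. Qed.

Lemma gibbsE_gt0 : (0 < gibbsE m b)%R = (L < +oo).
Proof. by rewrite /gibbsE -/L; case: ifP => // _; rewrite ?expR_gt0 ?ltxx. Qed.

Lemma klint_gibbsE : (0 < gibbsE m b)%R ->
  L = (- ln (gibbsE m b) - 1 + B)%:E.
Proof.
rewrite gibbsE_gt0 /gibbsE -/L => Loo; rewrite Loo expRK bB /=.
by move: Loo L0; case: L => //= l _ _; congr (_%:E); ring.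
Qed.

(** Jensen's inequality in dual form: integrating kl (m, e^x b) >= 0 bounds the relative entropy
    below for every x, and x = - ln B is the optimal choice. *)
Lemma gibbsE_le : (gibbsE m b <= B)%R.
Proof.
have [|] := ltP 0%R (gibbsE m b); last by move=> /le_trans; apply.
move=> E0; have := klint_gibbsE E0; set E := gibbsE m b => LE.
have key x : (- ln E - 1 + B >= x + B - expR x * B)%R.
  have [p [n [p0 n0 pn]]] := posneg_split x.
  have eb0 y : (0 < expR x * b y)%R by rewrite mulr_gt0// expR_gt0.
  have eb0' y : (0 <= expR x * b y)%R by rewrite ltW.
  have pm0 y : (0 <= p * m y)%R by rewrite mulr_ge0.
  have nm0 y : (0 <= n * m y)%R by rewrite mulr_ge0.
  have b0' y : (0 <= b y)%R by rewrite ltW.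
  have k0 y : (0 <= kl (m y) (b y))%R by rewrite kl_ge0.
  have mkl := measurable_kl _ _ _ _ mm mb m0 b0.
  have : p%:E + B%:E <= L + (expR x * B)%:E + n%:E.
    have -> : p%:E + B%:E = \int[mu]_y (p * m y + b y)%:E.
      by rewrite !int_add// !int_cst_mul// bB m1 mule1.
    have -> : L + (expR x * B)%:E + n%:E =
        \int[mu]_y (kl (m y) (b y) + expR x * b y + n * m y)%:E.
      rewrite int_add//; last 2 first.
      - exact: measurable_funD.
      - by move=> y; rewrite addr_ge0.
      rewrite int_add//.
      by rewrite !int_cst_mul ?expR_ge0// bB m1 mule1 EFinM.
    apply: ge0_le_integral => //.
    - by move=> y _; rewrite lee_fin addr_ge0.
    - by apply/measurable_EFinP; exact: measurable_funD.
    - by apply/measurable_EFinP; apply: measurable_funD => //; exact: measurable_funD.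
    move=> y _; rewrite lee_fin (kl_change (m y) (b y) (expR x * b y))//.
    rewrite lnM ?posrE ?expR_gt0// expRK.
    have := kl_ge0 (m y) (expR x * b y) (m0 y) (eb0 y).
    by rewrite pn; nra.
  by rewrite LE -!EFinD lee_fin pn; lra.
(* When B = 0 the logarithm of B is a default value; x = - ln E then turns [key] into a
   contradiction. *)
have [B00|BN0] := eqVneq B 0%R.
  by have := key (- ln E)%R; rewrite B00 mulr0; lra.
have Bp : (0 < B)%R by rewrite lt_neqAle eq_sym BN0 B0.
have := key (- ln B)%R; rewrite expRN lnK ?posrE// mulVf// => h.
by rewrite -ler_ln ?posrE//; lra.
Qed.

(** After integration the dependence on c is again a [kl], now relative to the single number E, so
    optimising a marginal is the same problem one dimension lower. The case c = 0 stands apart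
    because it gives the finite value B even when E = 0. *)
Lemma klint_scaleE c : (0 <= c)%R ->
  klint (fun x => c * m x)%R b =
  if (c == 0%R) || (0 < gibbsE m b)%R
  then (kl c (gibbsE m b) + B - gibbsE m b)%:E else +oo.
Proof.
rewrite le_eqVlt => /predU1P[<-|c0].
  rewrite eqxx /= kl0 addrAC subrr add0r -bB.
  by apply: eq_integral => x _; rewrite mul0r kl0.
rewrite gt_eqF//= klint_scale// -gibbsE_gt0.
case: ifPn => // E0; rewrite klint_gibbsE//=; congr (_%:E).
by rewrite klE// ?ltW//; ring.
Qed.

End gibbs.

Section gibbs_variational.
Local Open Scope ereal_scope.
Context {d} {T : measurableType d} {R : realType}.
Variable mu : {measure set T -> \bar R}.
Implicit Types u E B : T -> R.

(* The part of KL that depends on the first marginal [u] once the conditional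
   has been integrated out; it is [+oo] where [u] charges a point of infinite
   conditional entropy ([E = 0]). *)
Definition kltot u E B (x : T) : \bar R :=
  if (u x == 0%R) || (0 < E x)%R then (kl (u x) (E x) + B x - E x)%:E else +oo.

Variables E B : T -> R.
Hypotheses (mE : measurable_fun setT E) (mB : measurable_fun setT B).
Hypotheses (E0 : forall x, (0 <= E x)%R) (EB : forall x, (E x <= B x)%R).
Variable b : R.
Hypothesis Bb : \int[mu]_x (B x)%:E = b%:E.

Definition gibbsN : R := fine (\int[mu]_x (E x)%:E).
Let N := gibbsN.

Lemma gibbsNE : \int[mu]_x (E x)%:E = N%:E.
Proof.
rewrite fineK// ge0_fin_numE ?integral_ge0//; last by move=> x _; rewrite lee_fin.
apply: (@le_lt_trans _ _ (\int[mu]_x (B x)%:E)); last by rewrite Bb ltry.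
apply: ge0_le_integral => //.
- by move=> x _; rewrite lee_fin.
- exact/measurable_EFinP.
- exact/measurable_EFinP.
- by move=> x _; rewrite lee_fin.
Qed.

Let B0 x : (0 <= B x)%R. Proof. exact: le_trans (EB x). Qed.

Let iE : mu.-integrable setT (EFin \o E).
Proof.
apply/integrableP; split; first exact/measurable_EFinP.
under eq_integral do rewrite gee0_abs ?lee_fin//.
by rewrite gibbsNE ltry.
Qed.

Let iB : mu.-integrable setT (EFin \o B).
Proof.
apply/integrableP; split; first exact/measurable_EFinP.
under eq_integral do rewrite gee0_abs ?lee_fin//.
by rewrite Bb ltry.
Qed.

(** The ratio u / E is the constant 1 / N where E > 0, so the entropy collapses to - ln N; where E =
    0 the marginal vanishes as well. *)
Lemma integral_kltot_gibbs : (0 < N)%R ->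
  \int[mu]_x kltot (fun x => E x / N)%R E B x = (- ln N - 1 + b)%:E.
Proof.
move=> N0.
transitivity (\int[mu]_x ((B x)%:E - ((ln N + 1) / N)%:E * (E x)%:E)).
  apply: eq_integral => x _; rewrite /kltot.
  have := E0 x; rewrite le_eqVlt => /predU1P[<-|Ex0].
    by rewrite mul0r eqxx kl0 mule0 sube0 add0r subr0.
  rewrite Ex0 orbT -EFinM -EFinB; congr (_%:E).
  rewrite klE ?divr_ge0// ?ltW// ln_div ?posrE//.
  by field; rewrite gt_eqF.
rewrite integralB//; last exact: integrableZl.
rewrite integralZl// Bb gibbsNE -EFinM -EFinB; congr (_%:E).
by field; rewrite gt_eqF.
Qed.

Variable u : T -> R.
Hypotheses (mu_ : measurable_fun setT u) (u0 : forall x, (0 <= u x)%R).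
Hypothesis u1 : \int[mu]_x (u x)%:E = 1.
Let tot := kltot u E B.
Hypothesis mtot : measurable_fun setT tot.

(** The excess over the minimum is the integral of kl (u, E / N), which is nonnegative and vanishes
    only for u = E / N. *)
Lemma gibbs_minimal : \int[mu]_x tot x < +oo ->
  [/\ (0 < N)%R, (- ln N - 1 + b)%:E <= \int[mu]_x tot x &
      (\int[mu]_x tot x <= (- ln N - 1 + b)%:E -> {ae mu, forall x, u x = E x / N}%R)].
Proof.
have tot0 x : 0 <= tot x.
  rewrite /tot /kltot; case: ifPn => // /orP[/eqP ->|Ex0].
    by rewrite kl0 lee_fin addrAC subrr add0r.
  by rewrite lee_fin -addrA addr_ge0 ?kl_ge0// subr_ge0.
move=> Ioo.
have fin : {ae mu, forall x, (u x == 0%R) || (0 < E x)%R}.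
  have : mu.-integrable setT tot.
    by apply/integrableP; split => //; under eq_integral do rewrite gee0_abs//.
  move/(integrable_ae measurableT); apply: filterS => x /(_ I).
  by rewrite /tot /kltot; case: ifP.
(* If N were 0, E would vanish almost everywhere, and a finite total would then force u = 0, against
   its mass 1. *)
have N0 : (0 < N)%R.
  rewrite lt_neqAle -lee_fin -gibbsNE integral_ge0 ?andbT; last first.
    by move=> x _; rewrite lee_fin.
  apply/eqP => N0.
  have : \int[mu]_x `|(E x)%:E| = 0.
    by under eq_integral do rewrite gee0_abs ?lee_fin//; rewrite gibbsNE -N0.
  move/(ae_eq_integral_abs mu measurableT).
  have mE' : measurable_fun setT (fun x => (E x)%:E) by exact/measurable_EFinP.
  move=> /(_ mE') Eae.
  have : \int[mu]_x (u x)%:E = \int[mu]_x (cst 0 x : \bar R).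
    apply: ae_eq_integral => //; first exact/measurable_EFinP.
    apply: filterS2 fin Eae => x /orP[/eqP -> //|Ex0 /(_ I) []/= Ex].
    by rewrite Ex ltxx in Ex0.
  by rewrite integral0 u1 => /eqP; rewrite onee_eq0.
(* Finiteness forces u = 0 almost everywhere on E = 0, so both sides of u = E / N vanish there and
   the excess is set to 0. *)
pose D x : R := if E x == 0%R then 0%R else kl (u x) (E x / N)%R.
have D0 x : (0 <= D x)%R.
  rewrite /D; case: eqP => // /eqP Ex0.
  by rewrite kl_ge0// divr_gt0// lt_neqAle eq_sym Ex0 E0.
have mD : measurable_fun setT D.
  (* Any positive value serves where E = 0: [measurable_kl] asks for a positive second argument, and
     those points are masked by the conditional. *)
  pose E' x : R := if E x == 0%R then 1%R else E x.
  have mE' : measurable_fun setT E'.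
    apply: measurable_fun_ifT => //.
    exact: measurable_fun_eqr.
  have E'0 x : (0 < E' x)%R.
    by rewrite /E'; case: eqP => // /eqP Ex0; rewrite lt_neqAle eq_sym Ex0 E0.
  have -> : D = fun x => if E x == 0%R then 0%R else kl (u x) (E' x / N)%R.
    by apply/funext => x; rewrite /D /E'; case: eqP.
  apply: measurable_fun_ifT => //.
  - exact: measurable_fun_eqr.
  - apply: measurable_kl => //.
    + exact: measurable_funM.
    + by move=> x; rewrite divr_gt0.
have [p [n [p0 n0 pn]]] := posneg_split (ln N).
have meE : measurable_fun setT (fun x => (N^-1 * E x)%:E).
  by apply/measurable_EFinP; exact: measurable_funM.
have mpu (q : R) : measurable_fun setT (fun x => (q * u x)%:E).
  by apply/measurable_EFinP; exact: measurable_funM.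
have mD' : measurable_fun setT (fun x => (D x)%:E) by exact/measurable_EFinP.
have mB' : measurable_fun setT (fun x => (B x)%:E) by exact/measurable_EFinP.
have iqu (q : R) : (0 <= q)%R -> \int[mu]_x (q * u x)%:E = q%:E.
  move=> q0; under eq_integral do rewrite EFinM.
  rewrite ge0_integralZl// ?u1 ?mule1//; first exact/measurable_EFinP.
  by move=> x _; rewrite lee_fin.
have qu0 (q : R) x : (0 <= q)%R -> 0 <= (q * u x)%:E.
  by move=> q0; rewrite lee_fin mulr_ge0.
have NE0 x : 0 <= (N^-1 * E x)%:E by rewrite lee_fin mulr_ge0// invr_ge0 ltW.
have key : \int[mu]_x tot x + p%:E + 1 = \int[mu]_x (D x)%:E + n%:E + b%:E.
  transitivity (\int[mu]_x (tot x + (p * u x)%:E + (N^-1 * E x)%:E)).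
    rewrite ge0_integralD//; last 2 first.
    - by move=> x _; rewrite adde_ge0// qu0.
    - exact: emeasurable_funD.
    rewrite ge0_integralD//; last by move=> x _; rewrite qu0.
    rewrite iqu//; congr (_ + _).
    under eq_integral do rewrite EFinM.
    rewrite ge0_integralZl//.
    - by rewrite gibbsNE -EFinM mulVf// gt_eqF.
    - exact/measurable_EFinP.
    - by move=> x _; rewrite lee_fin.
    - by rewrite lee_fin invr_ge0 ltW.
  transitivity (\int[mu]_x ((D x)%:E + (n * u x)%:E + (B x)%:E)); last first.
    rewrite ge0_integralD//; last 3 first.
    - by move=> x _; rewrite adde_ge0// ?qu0// lee_fin.
    - exact: emeasurable_funD.
    - by move=> x _; rewrite lee_fin.
    rewrite ge0_integralD//; last 2 first.
    - by move=> x _; rewrite lee_fin.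
    - by move=> x _; rewrite qu0.
    by rewrite iqu// Bb.
  apply: ae_eq_integral => //.
  - by apply: emeasurable_funD => //; exact: emeasurable_funD.
  - by apply: emeasurable_funD => //; exact: emeasurable_funD.
  apply: filterS fin => x fx _.
  rewrite /tot /kltot fx -!EFinD; congr (_%:E).
  rewrite /D; move: fx; have := E0 x; rewrite le_eqVlt => /predU1P[<-|Ex0].
    by rewrite eqxx ltxx orbF => /eqP ->; rewrite kl0 !mulr0 subr0 !addr0 add0r.
  move=> _; rewrite gt_eqF//.
  have EN0 : (0 < E x / N)%R by rewrite divr_gt0.
  rewrite (kl_change (u x) (E x) (E x / N))// ln_div ?posrE// pn.
  by rewrite (mulrC N^-1%R); ring.
have ID0 : 0 <= \int[mu]_x (D x)%:E by apply: integral_ge0 => x _; rewrite lee_fin.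
have I0 : 0 <= \int[mu]_x tot x by exact: integral_ge0.
split => //.
  move: Ioo I0 ID0 key; case: (\int[mu]_x tot x) => // r _ r0.
  case: (\int[mu]_x (D x)%:E) => // s; rewrite !lee_fin => s0 [] h.
  by rewrite pn; lra.
move=> Ile.
have {}ID0 : \int[mu]_x `|(D x)%:E| = 0.
  under eq_integral do rewrite gee0_abs ?lee_fin//.
  move: Ile I0 ID0 key; case: (\int[mu]_x tot x) => // r.
  rewrite lee_fin => rle r0; case: (\int[mu]_x (D x)%:E) => // s.
  rewrite !lee_fin => s0 [] h; congr (_%:E).
  by move: rle; rewrite pn; lra.
move/(ae_eq_integral_abs mu measurableT mD') : ID0 => Dae.
apply: filterS2 fin Dae => x fx /(_ I) [].
rewrite /D; move: fx; have := E0 x; rewrite le_eqVlt => /predU1P[<-|Ex0].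
  by rewrite eqxx ltxx orbF => /eqP -> _; rewrite mul0r.
move=> _; rewrite gt_eqF// => /kl_eq0; apply => //.
by rewrite divr_gt0.
Qed.

End gibbs_variational.

(** The difference max (f, g) - f is nonnegative with integral 0; the finiteness of c is what
    permits the cancellation. *)
Lemma ae_le_of_integral_max {d} {T : measurableType d} {R : realType}
    (mu : {measure set T -> \bar R}) (f g : T -> R) :
  measurable_fun setT f -> measurable_fun setT g -> (forall x, 0 <= f x) ->
  forall c, (\int[mu]_x (f x)%:E = c%:E)%E ->
  (\int[mu]_x (Num.max (f x) (g x))%:E <= c%:E)%E -> {ae mu, forall x, g x <= f x}.
Proof.
move=> mf mg f0 c fc.
set h := fun x => Num.max (f x) (g x).
have mh : measurable_fun setT h by exact: measurable_maxr.
have fh x : f x <= h x by rewrite le_max lexx.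
have h0 x : 0 <= h x by exact: le_trans (fh x).
move=> hc.
have mD : measurable_fun setT (fun x => (h x - f x)%:E).
  by apply/measurable_EFinP; exact: measurable_funB.
have : (\int[mu]_x `|(h x - f x)%:E| = 0)%E.
  apply/eqP; rewrite eq_le integral_ge0// andbT.
  under eq_integral do rewrite gee0_abs ?lee_fin ?subr_ge0//.
  have : (\int[mu]_x (h x - f x)%:E + c%:E <= c%:E)%E.
    rewrite -{1}fc -ge0_integralD//.
    - by under eq_integral do rewrite -EFinD subrK.
    - by move=> x _; rewrite lee_fin subr_ge0.
    - by move=> x _; rewrite lee_fin.
    - exact/measurable_EFinP.
  have : (0 <= \int[mu]_x (h x - f x)%:E)%E.
    by apply: integral_ge0 => x _; rewrite lee_fin subr_ge0.
  by case: (\int[mu]_x _)%E => // r; rewrite -EFinD !lee_fin; lra.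
move/(ae_eq_integral_abs mu measurableT mD).
apply: filterS => x /(_ I) [] /eqP; rewrite subr_eq0 => /eqP <-.
by rewrite le_max lexx orbT.
Qed.

(** * Disintegration of the relative entropy along coordinates *)

Section disintegration.
Context {R : realType} {d : nat}.
Local Notation T := 'rV[R]_d.
Local Notation lam := (@lebesgue_measure R).
Local Open Scope ereal_scope.
Implicit Types (S : seq 'I_d) (z : T) (F G : T -> \bar R).

Definition indep S {X : Type} (f : T -> X) :=
  forall z k t, k \in S -> f (setc z k t) = f z.

Lemma indep_coord S (X : Type) (g : R -> X) k : k \notin S -> indep S (fun z => g (z 0%R k)).
Proof.
move=> kS z l t lS; rewrite setcE; case: eqP => // kl.
by move: kS; rewrite kl lS.
Qed.

(** Integration along [S] never changes the value of [u], so that value may be frozen. This turns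
    q_j (. | y_1) into a function of one variable when the first coordinate is not integrated. *)
Lemma int_over_indep S (X : Type) (u : T -> X) (F : X -> T -> \bar R) z : indep S u ->
  int_over S (fun y => F (u y) y) z = int_over S (fun y => F (u z) y) z.
Proof.
move=> iu; set G := (fun y => F (u y) y).
suff : forall x, u x = u z -> int_over S G x = int_over S (fun y => F (u z) y) x by exact.
elim: S iu => [_ x xz|k S IH iu x xz] /=; first by rewrite /G xz.
apply: eq_integral => t _; apply: IH; last by rewrite iu ?mem_head.
by move=> y l r lS; rewrite iu// inE lS orbT.
Qed.

(** Only the points of the slice through [z] are visited, so the pointwise inequality is asked only
    on the level set of [u] through [z]. *)
Lemma le_int_over_at S (X : Type) (u : T -> X) F G z : indep S u ->
  measurable_fun setT F -> measurable_fun setT G -> (forall y, 0 <= F y) ->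
  (forall y, 0 <= G y) -> (forall y, u y = u z -> F y <= G y) ->
  int_over S F z <= int_over S G z.
Proof.
move=> iu mF mG F0 G0; elim: S z iu => [z _ FG|k S IH z iu FG] /=; first exact: FG.
apply: ge0_le_integral => //.
- by move=> t _; exact: int_over_ge0.
- exact: measurable_int_over_setc.
- exact: measurable_int_over_setc.
move=> t _; apply: IH => [y l r lS|y uy]; first by rewrite iu// inE lS orbT.
by apply: FG; rewrite uy iu// mem_head.
Qed.

Lemma indep_int_over S (F : T -> \bar R) k t z : k \notin S -> indep [:: k] F ->
  int_over S F (setc z k t) = int_over S F z.
Proof.
move=> kS iF; rewrite int_over_setc//; apply: eq_int_over => y.
by rewrite iF// mem_head.
Qed.

Lemma int_over_prod S (f : 'I_d -> R -> R) (I : 'I_d -> R) z : uniq S ->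
  (forall j, j \in S -> measurable_fun setT (f j)) ->
  (forall j, j \in S -> forall x, (0 <= f j x)%R) ->
  (forall j, j \in S -> \int[lam]_x (f j x)%:E = (I j)%:E) ->
  int_over S (fun y => (\prod_(j <- S) f j (y 0%R j))%:E) z = (\prod_(j <- S) I j)%:E.
Proof.
elim: S z => [z _ _ _ _|k S IH z]; first by rewrite /= !big_nil.
rewrite cons_uniq => /andP[kS uS] mf f0 fI.
have S1 j : j \in S -> j \in k :: S by rewrite inE orbC => ->.
have -> : (fun y : T => (\prod_(j <- k :: S) f j (y 0%R j))%:E) =
    (fun y => (f k (y 0%R k))%:E * (\prod_(j <- S) f j (y 0%R j))%:E).
  by apply/funext => y; rewrite big_cons EFinM.
rewrite int_over_cons.
have f0k : forall x, (0 <= f k x)%R by apply: f0; exact: mem_head.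
have mprod : measurable_fun setT (fun y : T => \prod_(j <- S) f j (y 0%R j))%R.
  apply: measurable_prod => j jS.
  by apply: (measurableT_comp (mf j (S1 j jS))); exact: measurable_coord.
have prod0 (y : T) : (0 <= \prod_(j <- S) f j (y 0 j))%R.
  by rewrite big_seq; apply: prodr_ge0 => j jS; rewrite f0// S1.
transitivity (\int[lam]_t ((\prod_(j <- S) I j)%:E * (f k t)%:E)).
  apply: eq_integral => t _.
  rewrite (int_overZl S (fun y => (\prod_(j <- S) f j (y 0%R j))%:E) (fun y => f k (y 0%R k)))//.
  - rewrite IH//; first by rewrite setcE eqxx muleC.
    + by move=> j jS; apply: mf; exact: S1.
    + by move=> j jS; apply: f0; exact: S1.
    + by move=> j jS; apply: fI; exact: S1.
  - exact/measurable_EFinP.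
  - by move=> y l r lS; apply: indep_coord lS; rewrite kS.
have I0 j : j \in k :: S -> (0 <= I j)%R.
  by move=> jS; rewrite -lee_fin -fI// integral_ge0// => x _; rewrite lee_fin f0.
rewrite ge0_integralZl//.
- by rewrite fI ?mem_head// big_cons -EFinM mulrC.
- by apply/measurable_EFinP; apply: mf; exact: mem_head.
- by move=> x _; rewrite lee_fin.
- by rewrite lee_fin big_seq; apply: prodr_ge0 => j jS; rewrite I0// S1.
Qed.

Lemma klint_int_over S z (m b : T -> R) :
  measurable_fun setT m -> measurable_fun setT b ->
  (forall x, (0 <= m x)%R) -> (forall x, (0 < b x)%R) ->
  klint (coord_measure S z) m b = int_over S (fun y => (kl (m y) (b y))%:E) z.
Proof.
move=> mm mb m0 b0; rewrite [RHS]ge0_int_over_integral//.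
- by apply/measurable_EFinP; exact: measurable_kl.
- by move=> x; rewrite lee_fin kl_ge0.
Qed.

Variables (m b : T -> R).
Hypotheses (mm : measurable_fun setT m) (mb : measurable_fun setT b).
Hypotheses (m0 : forall x, (0 <= m x)%R) (b0 : forall x, (0 < b x)%R).

(** The marginal density left after integrating the coordinates in [S] out of [b]; [gibbs_at] is the
    matching Gibbs value. Both serve twice: with all coordinates but the first integrated out, and
    with all but the first and the i-th. *)
Definition int_b S z : R := fine (int_over S (EFin \o b) z).

Definition gibbs_at S z : R := gibbsE (coord_measure S z) m b.

Lemma measurable_int_b S : measurable_fun setT (int_b S).
Proof.
apply: measurableT_comp => //; apply: measurable_int_over.
exact/measurable_EFinP.
Qed.

(** In [gibbs_at] the base point enters through the measure, which hides measurability in [z]; here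
    it enters through iterated integrals, whose measurability is known. *)
Lemma gibbs_atE S : gibbs_at S = fun z =>
  if int_over S (fun y => (kl (m y) (b y))%:E) z < +oo then
    expR (- (fine (int_over S (fun y => (kl (m y) (b y))%:E) z) + 1 - int_b S z))
  else 0%R.
Proof.
apply/funext => z; rewrite /gibbs_at /gibbsE -!klint_int_over//.
case: ifP => // _; rewrite /int_b ge0_int_over_integral//.
- exact/measurable_EFinP.
- by move=> x; rewrite lee_fin ltW.
Qed.

Lemma measurable_gibbs_at S : measurable_fun setT (gibbs_at S).
Proof.
have mI : measurable_fun setT (int_over S (fun y => (kl (m y) (b y))%:E)).
  by apply: measurable_int_over; apply/measurable_EFinP; exact: measurable_kl.
rewrite gibbs_atE; apply: measurable_fun_ifT => //.
  exact: measurable_fun_lte.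
apply: (measurableT_comp (@measurable_expR R)).
apply: measurableT_comp => //; apply: measurable_funB; last exact: measurable_int_b.
by apply: measurable_funD => //; exact: measurableT_comp.
Qed.

Lemma gibbs_at_ge0 S z : (0 <= gibbs_at S z)%R.
Proof. exact: gibbsE_ge0. Qed.

Variable S : seq 'I_d.
Hypothesis m1 : forall z, int_over S (EFin \o m) z = 1.
Hypothesis bS : forall z, int_over S (EFin \o b) z < +oo.

Let m1' z : \int[coord_measure S z]_x (m x)%:E = 1.
Proof.
rewrite -(ge0_int_over_integral S (EFin \o m))//.
exact/measurable_EFinP.
Qed.

Lemma int_bE z : int_over S (EFin \o b) z = (int_b S z)%:E.
Proof.
rewrite /int_b fineK// ge0_fin_numE// int_over_ge0// => y.
by rewrite lee_fin ltW.
Qed.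

Let bB z : \int[coord_measure S z]_x (b x)%:E = (int_b S z)%:E.
Proof.
rewrite -int_bE [RHS]ge0_int_over_integral//; first exact/measurable_EFinP.
by move=> x; rewrite lee_fin ltW.
Qed.

Lemma gibbs_at_le z : (gibbs_at S z <= int_b S z)%R.
Proof. exact: (gibbsE_le _ _ _ mm mb m0 b0 (m1' z) (int_b S z) (bB z)). Qed.

(** Chain rule for relative entropy: along the slice [u] is a constant, so the scaling identity
    applies with c = u z. *)
Lemma int_over_kl_gibbs (u : T -> R) z : indep S u -> (forall x, (0 <= u x)%R) ->
  int_over S (fun y => (kl (u y * m y) (b y))%:E) z =
  kltot u (gibbs_at S) (int_b S) z.
Proof.
move=> iu u0.
rewrite (int_over_indep S _ u (fun c y => (kl (c * m y) (b y))%:E))//.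
have := klint_scaleE (coord_measure S z) m b mm mb m0 b0 (m1' z) (int_b S z) (bB z) (u z) (u0 z).
rewrite klint_int_over//.
- exact: measurable_funM.
- by move=> x; rewrite mulr_ge0.
Qed.

Lemma gibbs_at_gt0 z :
  (0 < gibbs_at S z)%R = (int_over S (fun y => (kl (m y) (b y))%:E) z < +oo).
Proof. by rewrite -klint_int_over// /gibbs_at gibbsE_gt0. Qed.

Lemma klint_gibbs_at z : (0 < gibbs_at S z)%R ->
  int_over S (fun y => (kl (m y) (b y))%:E) z =
  (- ln (gibbs_at S z) - 1 + int_b S z)%:E.
Proof.
move=> ?; rewrite -klint_int_over//.
exact: (klint_gibbsE _ _ _ m0 b0 _ (bB z)).
Qed.

Lemma int_over_kl_cons (u : T -> R) k z : measurable_fun setT u -> indep S u ->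
  (forall x, (0 <= u x)%R) ->
  int_over (k :: S) (fun y => (kl (u y * m y) (b y))%:E) z =
  \int[lam]_x kltot (fun x => u (setc z k x)) (fun x => gibbs_at S (setc z k x))
    (fun x => int_b S (setc z k x)) x.
Proof.
move=> mu iu u0 /=; apply: eq_integral => x _.
by rewrite int_over_kl_gibbs.
Qed.

Lemma measurable_kltot (u : T -> R) k z : measurable_fun setT u -> indep S u ->
  (forall x, (0 <= u x)%R) ->
  measurable_fun setT (fun x : R => kltot (fun x => u (setc z k x))
    (fun x => gibbs_at S (setc z k x)) (fun x => int_b S (setc z k x)) x).
Proof.
move=> mu iu u0.
have -> : (fun x : R => kltot (fun x => u (setc z k x))
    (fun x => gibbs_at S (setc z k x)) (fun x => int_b S (setc z k x)) x) =
    (fun x => int_over S (fun y => (kl (u y * m y) (b y))%:E) (setc z k x)).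
  by apply/funext => x; rewrite int_over_kl_gibbs.
apply: measurable_int_over_setc; apply/measurable_EFinP.
by apply: measurable_kl => // [|x]; [exact: measurable_funM|exact: mulr_ge0].
Qed.

End disintegration.

(** * Optimality of the marginal and of the conditional kernel *)

Section star.
Context {R : realType} {d : nat}.
Local Notation T := 'rV[R]_d.
Local Notation lam := (@lebesgue_measure R).
Local Open Scope ereal_scope.
Variables (i1 : 'I_d) (V : T -> R).
Local Notation others := (others i1).
Local Notation b := (pi_dens V).
Hypotheses (mb : measurable_fun setT b) (b0 : forall x, (0 < b x)%R).
Hypothesis bT : intRd (EFin \o b) = 1.
Hypothesis bO : forall z, int_over others (EFin \o b) z < +oo.

Definition wq (q : 'I_d -> R -> R -> R) (z : T) : R :=
  \prod_(j | j != i1) q j (z 0%R i1) (z 0%R j).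

(** The function E of the overview. The base point is 0 off the first coordinate, an arbitrary
    choice since all those coordinates are integrated. *)
Definition gibbs1 q (s : R) : R := gibbs_at (wq q) b others (setc 0%R i1 s).
Definition marg1 (s : R) : R := int_b b others (setc 0%R i1 s).

(** The part of [is_star] about the conditionals alone, so that kernels can be varied before a
    marginal is chosen. *)
Definition star_kernel (q : 'I_d -> R -> R -> R) : Prop :=
  forall j, j != i1 ->
    measurable_fun setT (fun xy : R * R => q j xy.1 xy.2) /\
    (forall x y, (0 <= q j x y)%R) /\
    (forall x, \int[lam]_(y in setT) (q j x y)%:E = 1).

Lemma i1_others : i1 \notin others.
Proof. by rewrite mem_filter eqxx. Qed.

Lemma uniq_others : uniq others.
Proof. exact: filter_uniq (enum_uniq _). Qed.

Lemma perm_others : perm_eq (enum 'I_d) (i1 :: others).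
Proof.
rewrite /Defs.others; apply: uniq_perm; rewrite ?enum_uniq//=.
  by rewrite filter_uniq ?enum_uniq// mem_filter eqxx.
move=> j; have jE : j \in enum 'I_d by rewrite mem_enum.
by rewrite [LHS]jE in_cons mem_filter [X in _ && X]jE andbT orbN.
Qed.

Lemma measurable_q (q : 'I_d -> R -> R -> R) j : star_kernel q -> j != i1 ->
  measurable_fun setT (fun z : T => q j (z 0%R i1) (z 0%R j)).
Proof.
move=> sq ji; have [mq _] := sq j ji.
apply: (measurableT_comp (f := fun xy : R * R => q j xy.1 xy.2)
   (g := fun z : T => (z 0%R i1, z 0%R j)) mq).
by apply/measurable_fun_pair; exact: measurable_coord.
Qed.

Lemma measurable_q1 (q : 'I_d -> R -> R -> R) j s : star_kernel q -> j != i1 ->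
  measurable_fun setT (q j s).
Proof.
move=> sq ji; have [mq _] := sq j ji.
apply: (measurableT_comp (f := fun xy : R * R => q j xy.1 xy.2)
   (g := fun y : R => (s, y)) mq).
by apply/measurable_fun_pair.
Qed.

Lemma measurable_prodq q (P : pred 'I_d) : star_kernel q -> (forall j, P j -> j != i1) ->
  measurable_fun setT (fun z : T => \prod_(j | P j) q j (z 0%R i1) (z 0%R j))%R.
Proof.
move=> sq Pi.
have -> : (fun z : T => \prod_(j | P j) q j (z 0%R i1) (z 0%R j))%R =
   (fun z : T => \prod_(j <- [seq j <- index_enum 'I_d | P j]) q j (z 0%R i1) (z 0%R j))%R.
  by apply/funext => z; rewrite big_filter.
apply: measurable_prod => j; rewrite mem_filter => /andP[Pj _].
by apply: measurable_q => //; exact: Pi.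
Qed.

Lemma measurable_wq q : star_kernel q -> measurable_fun setT (wq q).
Proof. by move=> sq; exact: measurable_prodq. Qed.

Lemma wq_ge0 q z : star_kernel q -> (0 <= wq q z)%R.
Proof. by move=> sq; apply: prodr_ge0 => j ji; have [_ []] := sq j ji. Qed.

Lemma int_prodq q (P : pred 'I_d) z : star_kernel q -> (forall j, P j -> j != i1) ->
  int_over [seq j <- enum 'I_d | P j]
    (fun z => (\prod_(j | P j) q j (z 0%R i1) (z 0%R j))%:E) z = 1.
Proof.
move=> sq Pi.
set S := [seq _ <- _ | _].
have iS : i1 \notin S.
  by rewrite mem_filter negb_and; apply/orP; left; apply/negP => /Pi; rewrite eqxx.
rewrite (int_over_indep S _ (fun z : T => z 0%R i1)
  (fun c y => (\prod_(j | P j) q j c (y 0%R j))%:E)); last exact: (indep_coord S _ id).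
have E (y : T) : (\prod_(j | P j) q j (z 0 i1) (y 0 j) = \prod_(j <- S) q j (z 0 i1) (y 0 j))%R.
  by rewrite big_filter big_enum_cond; apply: eq_bigl => j; rewrite inE.
under eq_int_over do rewrite E.
have jS j : j \in S -> j != i1 by rewrite mem_filter => /andP[/Pi].
rewrite (int_over_prod S (fun j => q j (z 0%R i1)) (fun=> 1%R)).
- by rewrite big1.
- by rewrite filter_uniq// enum_uniq.
- by move=> j /jS; exact: measurable_q1.
- by move=> j /jS ji; have [_ []] := sq j ji.
- by move=> j /jS ji; have [_ []] := sq j ji.
Qed.

Lemma int_wq q z : star_kernel q -> int_over others (EFin \o wq q) z = 1.
Proof. by move=> sq; exact: int_prodq. Qed.

Lemma gibbs1_ge0 q s : (0 <= gibbs1 q s)%R.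
Proof. exact: gibbs_at_ge0. Qed.

Lemma measurable_gibbs1 q : star_kernel q -> measurable_fun setT (gibbs1 q).
Proof.
move=> sq; rewrite /gibbs1; apply: (measurableT_comp (measurable_gibbs_at _ _ _ _ _ _ _)) => //.
- exact: measurable_wq.
- by move=> x; exact: wq_ge0.
- exact: measurable_setc.
Qed.

Lemma measurable_marg1 : measurable_fun setT marg1.
Proof.
rewrite /marg1; apply: (measurableT_comp (measurable_int_b _ _ _)) => //.
exact: measurable_setc.
Qed.

Lemma gibbs1_le q s : star_kernel q -> (gibbs1 q s <= marg1 s)%R.
Proof.
move=> sq; apply: gibbs_at_le => //.
- exact: measurable_wq.
- by move=> x; exact: wq_ge0.
- by move=> z; exact: int_wq.
Qed.

Lemma int_marg1 : \int[lam]_s (marg1 s)%:E = 1.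
Proof.
rewrite -bT /intRd (perm_int_over (enum 'I_d) (i1 :: others)) ?perm_others//; last 2 first.
- exact/measurable_EFinP.
- by move=> x; rewrite lee_fin ltW.
by rewrite /=; apply: eq_integral => s _; rewrite -int_bE.
Qed.

(** Nonnegativity of the integrand allows the first coordinate to be made the outermost one, and the
    chain rule handles the inner integrals. *)
Lemma KL_star (p : R -> R) q : measurable_fun setT p -> (forall x, (0 <= p x)%R) -> star_kernel q ->
  KL (star_dens i1 p q) V = \int[lam]_s kltot p (gibbs1 q) marg1 s /\
  measurable_fun setT (kltot p (gibbs1 q) marg1).
Proof.
move=> mp p0 sq.
pose u (z : T) := p (z 0%R i1).
have mu : measurable_fun setT u by apply: (measurableT_comp mp); exact: measurable_coord.
have iu : indep others u by apply: indep_coord; exact: i1_others.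
have u0 x : (0 <= u x)%R by exact: p0.
have w0 x : (0 <= wq q x)%R by exact: wq_ge0.
have mw := measurable_wq _ sq.
have w1 z := int_wq _ z sq.
have E : kltot p (gibbs1 q) marg1 = fun s => kltot (fun x => u (setc 0%R i1 x))
    (fun x => gibbs_at (wq q) b others (setc 0%R i1 x)) (fun x => int_b b others (setc 0%R i1 x)) s.
  by apply/funext => s; rewrite /kltot /u setcE eqxx.
split; last by rewrite E; exact: measurable_kltot.
rewrite E -int_over_kl_cons// /KL /intRd.
rewrite (perm_int_over (enum 'I_d) (i1 :: others)) ?perm_others//.
  apply/measurable_EFinP; apply: (measurable_kl _ _ (fun z => u z * wq q z)%R b) => //.
  - exact: measurable_funM.
  - by move=> x; rewrite mulr_ge0.
by move=> x; rewrite lee_fin; apply: (kl_ge0 (u x * wq q x)%R); rewrite ?mulr_ge0.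
Qed.

(** E at s sees only the conditional law at s. This locality makes it possible to paste kernels
    together pointwise in s. *)
Lemma gibbs1_ext (q r : 'I_d -> R -> R -> R) s : star_kernel q -> star_kernel r ->
  (forall j y, q j s y = r j s y) -> gibbs1 q s = gibbs1 r s.
Proof.
move=> sq sr h; rewrite /gibbs1.
have indepE (r' : 'I_d -> R -> R -> R) :
   int_over others (fun y => (kl (wq r' y) (b y))%:E) (setc 0%R i1 s) =
   int_over others (fun y : T => (kl (\prod_(j | j != i1) r' j s (y 0%R j))%R (b y))%:E) (setc 0%R i1 s).
  rewrite (int_over_indep others _ (fun z : T => z 0%R i1)
    (fun c y => (kl (\prod_(j | j != i1) r' j c (y 0%R j))%R (b y))%:E)) ?setcE ?eqxx//.
  by apply: (indep_coord _ _ id); exact: i1_others.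
rewrite !gibbs_atE//.
- rewrite !indepE.
  have -> // : (fun y : T => (kl (\prod_(j | j != i1) q j s (y 0%R j))%R (b y))%:E) =
     (fun y : T => (kl (\prod_(j | j != i1) r j s (y 0%R j))%R (b y))%:E).
  by apply/funext => y; under eq_bigr do rewrite h.
- exact: measurable_wq.
- by move=> x; exact: wq_ge0.
- exact: measurable_wq.
- by move=> x; exact: wq_ge0.
Qed.

Definition partition1 q : R := gibbsN lam (gibbs1 q).

Lemma partition1E q : star_kernel q -> \int[lam]_s (gibbs1 q s)%:E = (partition1 q)%:E.
Proof.
move=> sq; apply: (gibbsNE lam (gibbs1 q) marg1 _ _ _ _ 1%R) => //.
- exact: measurable_gibbs1.
- exact: measurable_marg1.
- exact: gibbs1_ge0.
- by move=> x; exact: gibbs1_le.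
- exact: int_marg1.
Qed.

(** With its best marginal, a kernel reaches - ln of its partition function; minimising [KL] thus
    amounts to maximising [partition1]. *)
Lemma KL_gibbs1 q : star_kernel q -> (0 < partition1 q)%R ->
  is_star i1 (fun s => gibbs1 q s / partition1 q)%R q /\
  KL (star_dens i1 (fun s => gibbs1 q s / partition1 q)%R q) V = (- ln (partition1 q))%:E.
Proof.
move=> sq N0.
have mg := measurable_gibbs1 _ sq.
have mp : measurable_fun setT (fun s => gibbs1 q s / partition1 q)%R by exact: measurable_funM.
have p0 s : (0 <= gibbs1 q s / partition1 q)%R by rewrite divr_ge0 ?gibbs1_ge0// ltW.
split.
  split => //; split => //; split => //.
  under eq_integral do rewrite mulrC EFinM.
  rewrite ge0_integralZl//.
  - by rewrite partition1E// -EFinM mulVf// gt_eqF.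
  - exact/measurable_EFinP.
  - by move=> s _; rewrite lee_fin gibbs1_ge0.
  - by rewrite lee_fin invr_ge0 ltW.
have [-> _] := KL_star _ _ mp p0 sq.
rewrite (integral_kltot_gibbs lam (gibbs1 q) marg1 mg measurable_marg1 (gibbs1_ge0 q)
  (fun s => gibbs1_le q s sq) 1%R int_marg1 N0).
by rewrite -addrA addNr addr0.
Qed.

Variables (p : R -> R) (q : 'I_d -> R -> R -> R).
Hypothesis pq : is_star i1 p q.
Hypothesis hmin : forall p' q', is_star i1 p' q' ->
  KL (star_dens i1 p q) V <= KL (star_dens i1 p' q') V.
Hypothesis q0 : exists2 q', star_kernel q' & (0 < partition1 q')%R.

Let sq : star_kernel q. Proof. by have [_ [_ [_]]] := pq. Qed.

(** The kernel given by [q0] shows that the minimum is finite. The minimizer is then compared with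
    its own kernel under that kernel's best marginal, and the equality case of the variational
    principle identifies [p]. *)
Lemma optimal_marginal :
  (0 < partition1 q)%R /\ {ae lam, forall s, p s = gibbs1 q s / partition1 q}%R.
Proof.
have [mp [p0 [p1 _]]] := pq.
have [KLE mk] := KL_star _ _ mp p0 sq.
have [q' sq' N'0] := q0.
have [s' KL'] := KL_gibbs1 _ sq' N'0.
have := gibbs_minimal lam (gibbs1 q) marg1 (measurable_gibbs1 _ sq) measurable_marg1
  (gibbs1_ge0 q) (fun s => gibbs1_le q s sq) 1%R int_marg1 p mp p0 p1 mk.
rewrite -KLE => -[|N0 _ H].
  by apply: le_lt_trans (hmin _ _ s') _; rewrite KL' ltry.
split => //; apply: H.
have [s KLq] := KL_gibbs1 _ sq N0.
by apply: le_trans (hmin _ _ s) _; rewrite KLq -addrA addNr addr0.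
Qed.

Lemma KL_optimal : KL (star_dens i1 p q) V = (- ln (partition1 q))%:E.
Proof.
have [N0 pE] := optimal_marginal.
have [mp [p0 [p1 _]]] := pq.
have [KLE mk] := KL_star _ _ mp p0 sq.
have [s KLq] := KL_gibbs1 _ sq N0.
have := gibbs_minimal lam (gibbs1 q) marg1 (measurable_gibbs1 _ sq) measurable_marg1
  (gibbs1_ge0 q) (fun s => gibbs1_le q s sq) 1%R int_marg1 p mp p0 p1 mk.
rewrite -KLE => -[|_ + _].
  by apply: le_lt_trans (hmin _ _ s) _; rewrite KLq ltry.
rewrite -addrA addNr addr0 => h; apply/eqP; rewrite eq_le h andbT.
by rewrite -KLq; exact: hmin.
Qed.

(* The competitor uses [q'] only where it increases [gibbs1], together with the
   corresponding optimal marginal; this strictly increases the partition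
   function unless the set is null. *)
Lemma optimal_kernel q' : star_kernel q' -> {ae lam, forall s, gibbs1 q' s <= gibbs1 q s}%R.
Proof.
move=> sq'.
have [N0 pE] := optimal_marginal.
have mg := measurable_gibbs1 _ sq.
have mg' := measurable_gibbs1 _ sq'.
pose q2 j x y : R := if (gibbs1 q x < gibbs1 q' x)%R then q' j x y else q j x y.
have sq2 : star_kernel q2.
  move=> j ji; have [m [g0 g1]] := sq j ji; have [m' [g0' g1']] := sq' j ji.
  rewrite /q2; split; [|split].
  - apply: measurable_fun_ifT => //; apply: measurable_fun_ltr.
    + by apply: (measurableT_comp mg); exact: measurable_fst.
    + by apply: (measurableT_comp mg'); exact: measurable_fst.
  - by move=> x y; case: ifP.
  - by move=> x; case: (gibbs1 q x < gibbs1 q' x)%R.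
have gE s : gibbs1 q2 s = Num.max (gibbs1 q s) (gibbs1 q' s).
  have [lt|le] := ltP (gibbs1 q s) (gibbs1 q' s).
    by apply: gibbs1_ext => // j y; rewrite /q2 lt.
  by apply: gibbs1_ext => // j y; rewrite /q2 ltNge le.
clearbody q2.
have gE2 : (fun s => (gibbs1 q2 s)%:E) = (fun s => (Num.max (gibbs1 q s) (gibbs1 q' s))%:E).
  by apply/funext => s; rewrite gE.
apply: (ae_le_of_integral_max lam _ _ mg mg' (gibbs1_ge0 q) (partition1 q)).
  exact: partition1E.
rewrite -gE2 (partition1E _ sq2) lee_fin leNgt; apply/negP => N2.
have N20 : (0 < partition1 q2)%R by exact: lt_trans N2.
have [s2 KL2] := KL_gibbs1 _ sq2 N20.
have := hmin _ _ s2; rewrite KL2 KL_optimal lee_fin lerN2 ler_ln; [|exact: N20|exact: N0].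
by rewrite leNgt N2.
Qed.

End star.

(** * Convex potentials *)

Section continuous_measurable_rowvec.
Context {R : realType} {d : nat}.
Local Notation T := 'rV[R]_d.

Let grid n (z : T) : 'rV[int]_d := \row_j Num.floor (z 0 j * n.+1%:R).
Let ungrid n (w : 'rV[int]_d) : T := \row_j ((w 0 j)%:~R / n.+1%:R).

Let measurable_box n w : measurable [set z : T | grid n z = w].
Proof.
have -> : [set z : T | grid n z = w] = \bigcap_(j in [set: 'I_d])
    ((fun z : T => z 0 j * n.+1%:R) @^-1` `[(w 0 j)%:~R, (w 0 j + 1)%:~R[%classic).
  apply/seteqP; split => z /=.
    by move=> <- j _ /=; rewrite mxE in_itv/= floor_le floorD1_gt.
  move=> h; apply/rowP => j; rewrite mxE; apply: floor_def.
  by have := h j I; rewrite /= in_itv.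
apply: fin_bigcap_measurable => // j _.
rewrite -[X in measurable X]setTI.
have mz : measurable_fun setT (fun z : T => z 0 j * n.+1%:R).
  by apply: measurable_funM => //; exact: measurable_coord.
by apply: mz => //; exact: measurable_itv.
Qed.

Let cvg_ungrid (z : T) : (fun n => ungrid n (grid n z)) @ \oo --> z.
Proof.
apply/cvgrPdist_le => e e0.
near=> n.
rewrite /Num.norm/= mx_normrE; apply: bigmax_le; first exact: ltW.
move=> [i j] _ /=; rewrite !mxE ord1.
have n0 : (0 : R) < n.+1%:R by rewrite ltr0n.
have fl := floor_le (z 0 j * n.+1%:R).
have fu := floorD1_gt (z 0 j * n.+1%:R); rewrite intrD in fu.
have -> : z 0 j - (Num.floor (z 0 j * n.+1%:R))%:~R / n.+1%:R =
   (z 0 j * n.+1%:R - (Num.floor (z 0 j * n.+1%:R))%:~R) / n.+1%:R.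
  by rewrite mulrBl mulfK// gt_eqF.
rewrite normrM ger0_norm ?subr_ge0// ger0_norm ?invr_ge0 ?ltW//.
apply: (@le_lt_trans _ _ n.+1%:R^-1).
  rewrite ler_pdivrMr// mulVf ?gt_eqF//; by rewrite lerBlDl; exact: ltW.
by near: n; exact: (near_infty_natSinv_lt (PosNum e0)).
Unshelve. all: by end_near. Qed.

(** Rounding the coordinates down to multiples of 1 / (n + 1) gives a map with countably many values
    on measurable boxes, and f is the pointwise limit of its compositions with these maps. Working
    with boxes keeps the argument inside the product sigma-algebra. *)
Lemma continuous_measurable_rowvec (f : T -> R) : continuous f -> measurable_fun setT f.
Proof.
move=> cf.
apply: (measurable_fun_cvg (h := fun n z => f (ungrid n (grid n z)))); last first.
  move=> z _; apply: (cvg_comp _ _ (cvg_ungrid z)); exact: cf.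
move=> n _ Y mY; rewrite setTI.
have -> : (fun z => f (ungrid n (grid n z))) @^-1` Y =
  \bigcup_w [set z | grid n z = w /\ Y (f (ungrid n w))].
  apply/seteqP; split => z /=.
    by move=> Yz; exists (grid n z).
  by move=> [w _ [<-]].
apply: countable_bigcupT_measurable; first exact: countableP.
move=> w; have [Yw|nYw] := pselect (Y (f (ungrid n w))).
  rewrite (_ : [set _ | _] = [set z | grid n z = w]); first exact: measurable_box.
  by apply/seteqP; split => z //= -[].
rewrite (_ : [set _ | _] = set0)//.
by apply/seteqP; split => z //= -[].
Qed.

End continuous_measurable_rowvec.

Section partial_derivatives.
Context {R : realType} {d : nat}.
Local Notation T := 'rV[R]_d.
Implicit Types (f : T -> R) (z v : T).

Lemma setc_evec z k t h : setc z k (h + t) = h *: evec R k + setc z k t.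
Proof.
apply/rowP => j; rewrite !mxE /=.
by case: eqP => _; rewrite ?mulr1// mulr0 add0r.
Qed.

Lemma is_derive_setc f k z t : derivable f (setc z k t) (evec R k) ->
  is_derive t 1 (fun x : R => f (setc z k x)) (partial k f (setc z k t)).
Proof.
move=> df.
have E : (fun h : R => h^-1 *: (((fun x : R => f (setc z k x)) \o shift t) (h *: (1 : R)) -
             f (setc z k t))) =
  (fun h => h^-1 *: ((f \o shift (setc z k t)) (h *: evec R k) - f (setc z k t))).
  by apply/funext => h /=; rewrite [h%:A]mulr1 setc_evec.
apply: DeriveDef; first by rewrite /derivable E; exact: df.
by rewrite /derive E.
Qed.

Lemma continuous_setc f k z : (forall x, derivable f x (evec R k)) ->
  continuous (fun x : R => f (setc z k x)).
Proof.
move=> df x; apply/differentiable_continuous/derivable1_diffP.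
by have [] := is_derive_setc f k z x (df _).
Qed.

Lemma MVT_setc f k z a b : (forall x, derivable f x (evec R k)) -> a <= b ->
  exists2 c, a <= c <= b &
    f (setc z k b) - f (setc z k a) = partial k f (setc z k c) * (b - a).
Proof.
move=> df ab.
have [x _| |c] := @MVT_segment R (fun x => f (setc z k x)) (fun x => partial k f (setc z k x)) a b ab.
- exact: is_derive_setc.
- exact/continuous_subspaceT/continuous_setc.
by rewrite in_itv/= => cab E; exists c.
Qed.

(* Moves from [z] to [z + h *: v] one coordinate at a time, so that continuity of
   the partial derivatives yields the chain rule along lines. *)
Let stair z v (h : R) k : T := \row_j (if (j < k)%N then z 0 j + h * v 0 j else z 0 j).

Let stair0 z v h : stair z v h 0 = z.
Proof. by apply/rowP => j; rewrite mxE. Qed.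

Let stairT z v h : stair z v h d = z + h *: v.
Proof. by apply/rowP => j; rewrite !mxE ltn_ord. Qed.

Let stairS z v h (k : 'I_d) : stair z v h k.+1 = setc (stair z v h k) k (z 0 k + h * v 0 k).
Proof.
apply/rowP => j; rewrite !mxE; case: eqP => [->|/eqP jk]; first by rewrite ltnS leqnn.
by rewrite ltnS leq_eqVlt -val_eqE/= in jk *; rewrite (negbTE jk).
Qed.

Let stair_setc z v h (k : 'I_d) : stair z v h k = setc (stair z v h k) k (z 0 k).
Proof. by apply/rowP => j; rewrite !mxE; case: eqP => // ->; rewrite ltnn. Qed.

Let stair_step f z v h (k : 'I_d) : (forall x, derivable f x (evec R k)) ->
  exists y : T, (forall j, `|y 0 j - z 0 j| <= `|h| * `|v 0 j|) /\
  f (stair z v h k.+1) - f (stair z v h k) = h * (v 0 k * partial k f y).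
Proof.
move=> df; rewrite stairS [in X in _ - f X]stair_setc; set w := stair z v h k.
have near_c c : `|c - z 0 k| <= `|h * v 0 k| ->
    forall j, `|setc w k c 0 j - z 0 j| <= `|h| * `|v 0 j|.
  move=> hc j; rewrite setcE -normrM; case: eqP => [->//|_].
  rewrite mxE; case: ifP => _; first by rewrite addrAC subrr add0r.
  by rewrite subrr normr0.
have [le|ge] := leP 0 (h * v 0 k).
  have [c cab E] := MVT_setc f k w (z 0 k) (z 0 k + h * v 0 k) df ltac:(by rewrite lerDl).
  exists (setc w k c); split; last by rewrite E addrAC subrr add0r; ring.
  by apply: near_c; rewrite !ger0_norm//; lra.
have [c cab E] := MVT_setc f k w (z 0 k + h * v 0 k) (z 0 k) df ltac:(by rewrite gerDl ltW).
exists (setc w k c); split; last by rewrite -opprB E; ring.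
by apply: near_c; rewrite (ltr0_norm ge) ler_norml; lra.
Qed.

Lemma is_derive_line f z v (t : R) :
  (forall k x, derivable f x (evec R k)) -> (forall k, continuous (partial k f)) ->
  is_derive t 1 (fun s : R => f (z + s *: v)) (\sum_k v 0 k * partial k f (z + t *: v)).
Proof.
move=> df cf.
pose x : T := z + t *: v.
rewrite -[z + t *: v]/x.
set D := \sum_k _.
suff H : (fun h : R => h^-1 *: (((fun s : R => f (z + s *: v)) \o shift t) (h *: (1 : R)) -
    f x)) @ 0^' --> D.
  by apply: DeriveDef; [apply/cvg_ex; exists D|exact/cvg_lim].
have -> : (fun h : R => h^-1 *: (((fun s : R => f (z + s *: v)) \o shift t) (h *: (1 : R)) -
    f x)) = fun h => h^-1 * (f (x + h *: v) - f x).
  apply/funext => h /=.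
  have -> // : z + (h%:A + t) *: v = x + h *: v.
  by rewrite [h%:A]mulr1 /x scalerDl addrA addrAC.
apply/cvgrPdist_le => e e0.
(* The added 1 keeps M positive when v = 0. *)
pose M := \sum_k `|v 0 k| + 1.
have M0 : 0 < M by rewrite ltr_wpDl// sumr_ge0.
have eM : 0 < e / M by rewrite divr_gt0.
have [delta delta0 Hd] : exists2 delta, 0 < delta & forall y, `|x - y| < delta ->
    forall k, `|partial k f x - partial k f y| <= e / M.
  suff : \forall y \near x, forall k, `|partial k f x - partial k f y| <= e / M.
    move=> /nbhs_ballP[r /= r0 rP]; exists r => // y xy; apply: rP.
    by rewrite mx_norm_ball.
  suff : forall s : seq 'I_d, \forall y \near x, forall k, k \in s ->
      `|partial k f x - partial k f y| <= e / M.
    by move/(_ (enum 'I_d)); apply: filterS => y yP k; apply: yP; rewrite mem_enum.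
  elim=> [|k s IH]; first by apply: (@nearW _ (nbhs x)) => y k; rewrite in_nil.
  have /cvgrPdist_le /(_ _ eM) := cf k x.
  by apply: filterS2 IH => y yP kP l; rewrite inE => /predU1P[->//|]; exact: yP.
near=> h.
have h0 : h != 0 by near: h; exact: nbhs_dnbhs_neq.
have hM : `|h| * M < delta.
  rewrite -ltr_pdivlMr//; near: h; apply: nbhs_dnbhs.
  exists (delta / M) => /=; first by rewrite divr_gt0.
  by move=> y /=; rewrite sub0r normrN.
have [y Hy] := choice (fun k : 'I_d => stair_step f x v h k (df k)).
have tele : f (x + h *: v) - f x = \sum_k h * (v 0 k * partial k f (y k)).
  rewrite -stairT -[in X in _ - f X](stair0 x v h).
  rewrite -(telescope_sumr (fun k => f (stair x v h k)) (leq0n d)) big_mkord.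
  by apply: eq_bigr => k _; have [_ ->] := Hy k.
rewrite tele -mulr_sumr mulrA mulVf// mul1r /D -sumrB.
apply: (le_trans (ler_norm_sum _ _ _)).
apply: (@le_trans _ _ (\sum_k `|v 0 k| * (e / M))).
  apply: ler_sum => k _; rewrite -mulrBr normrM ler_wpM2l//.
  apply: Hd; apply: le_lt_trans hM.
  rewrite [leLHS]/Num.norm/= mx_normrE; apply: bigmax_le; first by rewrite mulr_ge0// ltW.
  move=> [i j] _; rewrite ord1 !mxE /=.
  have [/(_ j) + _] := Hy k; rewrite distrC !mxE => /le_trans; apply.
  rewrite ler_wpM2l// /M (bigD1 j)//= -addrA lerDl addr_ge0//.
  exact: sumr_ge0.
rewrite -mulr_suml mulrCA ler_piMr ?(ltW e0)//.
by rewrite ler_pdivrMr// mul1r /M lerDl.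
Unshelve. all: by end_near. Qed.

End partial_derivatives.

Section convex_potential.
Context {R : realType} {d : nat}.
Local Notation T := 'rV[R]_d.
Variables (V : T -> R) (alpha : R).
Hypotheses (hC2 : C2 V) (a0 : 0 < alpha) (hconv : hess_ge V alpha).

Lemma C2_continuous : continuous V. Proof. by case: hC2. Qed.
Lemma C2_derivable i z : derivable V z (evec R i). Proof. by case: hC2 => _ []. Qed.
Lemma C2_partial_continuous i : continuous (partial i V).
Proof. by case: hC2 => _ [_ []]. Qed.
Lemma C2_partial_derivable i j z : derivable (partial i V) z (evec R j).
Proof. by case: hC2 => _ [_ [_ []]]. Qed.
Lemma C2_hess_continuous i j : continuous (partial j (partial i V)).
Proof. by case: hC2 => _ [_ [_ [_]]]. Qed.

(** Along the ray t z the derivative of the directional derivative is the Hessian form at z, at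
    least alpha |z|^2; the mean value theorem integrates this once. *)
Let ray_le (z : T) (t : R) : 0 <= t ->
  \sum_i z 0 i * partial i V 0 + alpha * sqnorm z * t <= \sum_i z 0 i * partial i V (t *: z).
Proof.
move=> t0.
pose g (s : R) := \sum_i z 0 i * partial i V (0 + s *: z).
pose dg (s : R) := \sum_i z 0 i * \sum_j z 0 j * hess V (0 + s *: z) i j.
have Dg (s : R) : is_derive s 1 g (dg s).
  have -> : g = \sum_i (z 0 i \*: (fun s : R => partial i V (0 + s *: z))).
    by apply/funext => r; rewrite fct_sumE.
  apply: is_derive_sum => i; apply: is_deriveZ; apply: is_derive_line.
  - by move=> k x; exact: C2_partial_derivable.
  - by move=> k; exact: C2_hess_continuous.
have cg : continuous g.
  by move=> s; apply/differentiable_continuous/derivable1_diffP; have [] := Dg s.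
have [|c cab E] := @MVT_segment R g dg 0 t t0.
  exact: continuous_subspaceT.
have -> : \sum_i z 0 i * partial i V (t *: z) = g t by apply: eq_bigr => i _; rewrite add0r.
have -> : \sum_i z 0 i * partial i V 0 = g 0.
  by apply: eq_bigr => i _; rewrite scale0r addr0.
suff : alpha * sqnorm z <= dg c by move: E; rewrite subr0; nra.
apply: le_trans (hconv (0 + c *: z) z) _.
rewrite /dg; apply: ler_sum => i _; rewrite mulr_sumr.
by apply: ler_sum => j _; rewrite mulrA.
Qed.

(** Second integration along the ray: by [ray_le], V (s z) minus its quadratic minorant is
    nondecreasing for s in [0, 1]. *)
Lemma potential_ge (z : T) :
  V 0 + \sum_i z 0 i * partial i V 0 + alpha / 2 * sqnorm z <= V z.
Proof.
pose G (s : R) := V (0 + s *: z) - ((\sum_i z 0 i * partial i V 0) * s + alpha / 2 * sqnorm z * s ^+ 2).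
pose dG (s : R) := \sum_i z 0 i * partial i V (0 + s *: z) -
   (\sum_i z 0 i * partial i V 0 + alpha * sqnorm z * s).
have DG (s : R) : is_derive s 1 G (dG s).
  have D1 : is_derive s 1 (fun s : R => V (0 + s *: z)) (\sum_i z 0 i * partial i V (0 + s *: z)).
    by apply: is_derive_line; [exact: C2_derivable|exact: C2_partial_continuous].
  rewrite /G.
  set A := \sum_i z 0 i * partial i V 0.
  pose B := alpha / 2 * sqnorm z.
  have -> : (fun s : R => V (0 + s *: z) - (A * s + alpha / 2 * sqnorm z * s ^+ 2)) =
     (fun s : R => V (0 + s *: z)) - ((A \*: @id R) + (B \*: (@id R * @id R))).
    by apply/funext => r; rewrite -[RHS]/(_ - (A * r + B * (r * r))) expr2.
  apply: is_derive_eq; rewrite /dG -/A; congr (_ - _).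
  by rewrite /GRing.scale/= /B; field.
have cG : continuous G.
  by move=> s; apply/differentiable_continuous/derivable1_diffP; have [] := DG s.
have [|c cab E] := @MVT_segment R G dG 0 1 ler01.
  exact: continuous_subspaceT.
have dG0 : 0 <= dG c.
  rewrite in_itv/= in cab; have /andP[c0 _] := cab.
  by rewrite /dG add0r subr_ge0 ray_le.
move: E; rewrite /G scale1r scale0r !add0r subr0 mulr1 expr1n mulr1 mulr0 expr0n/= mulr0 addr0 subr0 mulr1.
by lra.
Qed.

Lemma potential_quadratic : exists C, forall z, alpha / 4 * sqnorm z - C <= V z.
Proof.
(* Half of the coefficient alpha / 2 is spent on absorbing the linear term by completing the square,
   which costs |grad V (0)|^2 / alpha and leaves alpha / 4. *)
exists (\sum_i partial i V 0 ^+ 2 / alpha - V 0) => z.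
apply: le_trans (potential_ge z).
suff : - (alpha / 4 * sqnorm z) - \sum_i partial i V 0 ^+ 2 / alpha <=
       \sum_i z 0 i * partial i V 0 by lra.
rewrite /sqnorm mulr_sumr -opprD -big_split/= -sumrN; apply: ler_sum => i _.
set g := partial i V 0; set y := z 0 i.
have -> : y * g = - (alpha / 4 * y ^+ 2 + g ^+ 2 / alpha) + alpha * (y / 2 + g / alpha) ^+ 2.
  by field; rewrite gt_eqF.
by rewrite lerDl mulr_ge0 ?sqr_ge0// ltW.
Qed.

Lemma partial_nondecreasing i z a b : a <= b ->
  partial i V (setc z i a) <= partial i V (setc z i b).
Proof.
move=> ab; rewrite -subr_ge0.
have [c _ ->] := MVT_setc (partial i V) i z a b (fun x => C2_partial_derivable i i x) ab.
rewrite mulr_ge0 ?subr_ge0//.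
have := hconv (setc z i c) (evec R i).
rewrite /sqnorm (bigD1 i)//= big1 => [|j ji]; last first.
  by rewrite mxE (negbTE ji) andbF expr0n.
rewrite [X in _ <= X](bigD1 i)//= [X in _ <= _ + X]big1 => [|j ji]; last first.
  by apply: big1 => k _; rewrite mxE (negbTE ji) andbF !mul0r.
rewrite (bigD1 i)//= [X in _ <= _ + X + _]big1 => [|j ji]; last first.
  by rewrite !mxE (negbTE ji) andbF mulr0 mul0r.
rewrite !mxE !eqxx expr1n !mul1r !addr0 mulr1 /hess => h.
by apply: le_trans h; exact: ltW.
Qed.

(** A nondecreasing derivative lies between the backward and the forward difference quotient of step
    1. Through this bound the growth condition on V reaches its partial derivatives. *)
Lemma partial_bound i z (t : R) :
  `|partial i V (setc z i t)| <=
  `|V (setc z i (t + 1))| + `|V (setc z i t)| + `|V (setc z i (t - 1))|.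
Proof.
have [c /andP[c1 c2] E] := MVT_setc V i z t (t + 1) (C2_derivable i) ltac:(by rewrite lerDl).
have [c' /andP[c1' c2'] E'] := MVT_setc V i z (t - 1) t (C2_derivable i) ltac:(by rewrite gerBl).
have h := partial_nondecreasing i z _ _ c1.
have h' := partial_nondecreasing i z _ _ c2'.
move: E E'; rewrite addrAC subrr add0r mulr1 opprB addrCA subrr addr0 mulr1 => E E'.
rewrite ler_norml; apply/andP; split.
  apply: le_trans h'; rewrite -E'.
  have := ler_norm (V (setc z i (t - 1))); have := normr_ge0 (V (setc z i (t + 1))).
  have := ler_norm (- V (setc z i t)); rewrite normrN; lra.
apply: le_trans h _; rewrite -E.
have := ler_norm (V (setc z i (t + 1))); have := normr_ge0 (V (setc z i (t - 1))).
have := ler_norm (- V (setc z i t)); rewrite normrN; lra.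
Qed.

End convex_potential.

(** * Gaussian estimates *)

Section gaussian_1d.
Context {R : realType}.
Local Notation lam := (@lebesgue_measure R).

Lemma measurable_sqfun (c : R) : measurable_fun setT (fun x : R => expR (c * x ^+ 2)).
Proof.
apply: (measurableT_comp (@measurable_expR R)).
by apply: measurable_funM => //; exact: exprn_measurable.
Qed.

Lemma gauss_integral_fin (c : R) : 0 < c ->
  exists g, (\int[lam]_x (expR (- c * x ^+ 2))%:E = g%:E)%E.
Proof.
move=> c0.
(* The standard deviation for which the normal density is proportional to exp (- c x^2). *)
pose s := Num.sqrt (2 * c)^-1.
have cc : 0 < (2 * c)^-1 by rewrite invr_gt0 mulr_gt0.
have s0 : s != 0 by rewrite gt_eqF// sqrtr_gt0.
have pk : 0 < normal_peak s by exact: normal_peak_gt0.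
exists (normal_peak s)^-1.
transitivity (\int[lam]_x ((normal_peak s)^-1%:E * (normal_pdf 0 s x)%:E))%E.
  apply: eq_integral => x _; rewrite normal_pdfE// -EFinM; congr (_%:E).
  rewrite [RHS]mulrA mulVf ?gt_eqF// mul1r.
  rewrite /normal_fun subr0 /s sqr_sqrtr ?ltW//; congr expR.
  by field; rewrite gt_eqF.
rewrite ge0_integralZl//.
- by rewrite integral_normal_pdf mule1.
- by apply/measurable_EFinP; exact: measurable_normal_pdf.
- by move=> x _; rewrite lee_fin normal_pdf_ge0.
- by rewrite lee_fin invr_ge0 ltW.
Qed.

End gaussian_1d.

Section gaussian_integrals.
Context {R : realType} {d : nat}.
Local Notation T := 'rV[R]_d.
Local Notation lam := (@lebesgue_measure R).
Implicit Types (S : seq 'I_d) (z : T).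

Definition rest_sq S z : R := \sum_(j | j \notin S) z 0 j ^+ 2.

Lemma rest_sq_ge0 S z : 0 <= rest_sq S z.
Proof. by apply: sumr_ge0 => j _; exact: sqr_ge0. Qed.

Lemma rest_sq_ge S z k : k \notin S -> z 0 k ^+ 2 <= rest_sq S z.
Proof.
move=> kS; rewrite /rest_sq (bigD1 k)//= lerDl.
by apply: sumr_ge0 => j _; exact: sqr_ge0.
Qed.

Lemma expR_sqnorm S c z : uniq S ->
  expR (c * sqnorm z) = expR (c * rest_sq S z) * \prod_(j <- S) expR (c * z 0 j ^+ 2).
Proof.
move=> uS; rewrite -expR_sum -expRD; congr expR.
rewrite -mulr_sumr -mulrDr; congr (_ * _).
by rewrite /sqnorm (bigID (fun j => j \in S))/= addrC -big_uniq.
Qed.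

Lemma measurable_expR_sqnorm c : measurable_fun setT (fun z : T => expR (c * sqnorm z)).
Proof.
apply: (measurableT_comp (@measurable_expR R)); apply: measurable_funM => //.
apply: measurable_sum => j; apply: (measurableT_comp (f := fun x : R => x ^+ 2)).
  exact: exprn_measurable.
exact: measurable_coord.
Qed.

(** The Gaussian weight is a product over coordinates: those in [S] are integrated one by one, the
    others come out as a constant. The factors [f j] will be 1 or conditional densities. *)
Lemma int_over_expsq S (f : 'I_d -> R -> R) (M : 'I_d -> R) c z : uniq S ->
  (forall j, j \in S -> measurable_fun setT (f j)) ->
  (forall j, j \in S -> forall x, 0 <= f j x) ->
  (forall j, j \in S -> \int[lam]_x (expR (c * x ^+ 2) * f j x)%:E = (M j)%:E)%E ->
  int_over S (fun y => (expR (c * sqnorm y) * \prod_(j <- S) f j (y 0 j))%:E) z =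
  (expR (c * rest_sq S z) * \prod_(j <- S) M j)%:E.
Proof.
move=> uS mf f0 fM.
pose g j x := expR (c * x ^+ 2) * f j x.
have E : (fun y : T => (expR (c * sqnorm y) * \prod_(j <- S) f j (y 0 j))%:E) =
   (fun y : T => (expR (c * rest_sq S y))%:E * (\prod_(j <- S) g j (y 0 j))%:E)%E.
  apply/funext => y; rewrite (expR_sqnorm S c y uS) -EFinM -mulrA; congr (_ * _)%:E.
  by rewrite -big_split.
have mg j : j \in S -> measurable_fun setT (g j).
  by move=> jS; apply: measurable_funM; [exact: measurable_sqfun|exact: mf].
have g0 j : j \in S -> forall x, 0 <= g j x.
  by move=> jS x; rewrite mulr_ge0 ?expR_ge0// f0.
rewrite E (int_overZl S (fun y => (\prod_(j <- S) g j (y 0 j))%:E) (fun y => expR (c * rest_sq S y))).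
- by rewrite (int_over_prod S g M)// -EFinM.
- apply/measurable_EFinP; apply: measurable_prod => j jS.
  by apply: (measurableT_comp (mg j jS)); exact: measurable_coord.
- by move=> y; rewrite lee_fin big_seq; apply: prodr_ge0 => j jS; exact: g0.
- by move=> y; exact: expR_ge0.
- move=> y k t kS; congr (expR (c * _)); apply: eq_bigr => j jS; rewrite setcE.
  by case: eqP => // jk; rewrite jk kS in jS.
Qed.

End gaussian_integrals.

(** * Integrability of the target and the cube competitor *)

Section target.
Context {R : realType} {d : nat}.
Local Notation T := 'rV[R]_d.
Local Notation lam := (@lebesgue_measure R).
Local Open Scope ereal_scope.
Implicit Types (S : seq 'I_d) (z : T).
Variables (V : T -> R) (a C0 : R).
Hypotheses (mV : measurable_fun setT V) (a0 : (0 < a)%R).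
Hypothesis V_ge : forall z, (a * sqnorm z - C0 <= V z)%R.
Hypothesis hgrowth : growth V.
Local Notation b := (pi_dens V).

Let eV z : R := expR (- V z).
Let Z : R := fine (intRd (fun z => (eV z)%:E)).

Let meV : measurable_fun setT (fun z => (eV z)%:E).
Proof.
apply/measurable_EFinP; apply: (measurableT_comp (@measurable_expR R)).
exact: measurableT_comp.
Qed.

(** The decay in the coordinates that are not integrated is the point: through E <= B it later gives
    each conditional factor a Gaussian tail. *)
Lemma int_over_expV S : uniq S -> exists2 K, (0 <= K)%R & forall z,
  int_over S (fun z => (eV z)%:E) z <= (K * expR (- a * rest_sq S z))%:E.
Proof.
move=> uS; have [g gE] := gauss_integral_fin a a0.
have g0 : (0 <= g)%R.
  by rewrite -lee_fin -gE integral_ge0// => x _; rewrite lee_fin expR_ge0.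
exists (expR C0 * \prod_(j <- S) g)%R.
  by rewrite mulr_ge0 ?expR_ge0//; apply: prodr_ge0.
move=> z; set F := fun y : T => (expR (- a * sqnorm y) * \prod_(j <- S) 1)%R.
have mF : measurable_fun setT F.
  by apply: measurable_funM => //; exact: measurable_expR_sqnorm.
have F0 y : (0 <= F y)%R by rewrite mulr_ge0 ?expR_ge0// prodr_ge0.
apply: (@le_trans _ _ (int_over S (fun y => (expR C0)%:E * (F y)%:E) z)).
  apply: le_int_over => //.
  - by apply: measurable_funeM; exact/measurable_EFinP.
  - by move=> y; rewrite lee_fin expR_ge0.
  - move=> y; rewrite -EFinM lee_fin /F big1// mulr1 -expRD ler_expR.
    by have := V_ge y; lra.
have mF' : measurable_fun setT (EFin \o F) by exact/measurable_EFinP.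
rewrite (int_overZl S (EFin \o F) (fun=> expR C0))//.
rewrite /F /= (int_over_expsq S (fun _ _ => 1%R) (fun=> g))//.
  by rewrite -EFinM lee_fin le_eqVlt; apply/orP; left; apply/eqP; ring.
by move=> j _; under eq_integral do rewrite mulr1.
Qed.

Lemma normalizer_gt0 : (0 < Z)%R /\ intRd (fun z => (eV z)%:E) = Z%:E.
Proof.
have [K K0 /(_ 0%R) HK] := int_over_expV (enum 'I_d) (enum_uniq _).
have fin : intRd (fun z => (eV z)%:E) \is a fin_num.
  rewrite ge0_fin_numE; first by apply: le_lt_trans HK _; rewrite ltry.
  by apply: int_over_ge0 => z; rewrite lee_fin expR_ge0.
have E : intRd (fun z => (eV z)%:E) = Z%:E by rewrite fineK.
split => //; rewrite -lte_fin -E; apply: int_over_gt0 => // z.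
by rewrite lte_fin expR_gt0.
Qed.

Lemma pi_densE z : b z = (Z^-1 * eV z)%R.
Proof. by rewrite mulrC. Qed.

Lemma pi_dens_gt0 z : (0 < b z)%R.
Proof.
have [Z0 _] := normalizer_gt0.
by rewrite pi_densE mulr_gt0 ?invr_gt0// expR_gt0.
Qed.

Lemma measurable_pi_dens : measurable_fun setT b.
Proof.
rewrite (_ : b = fun z => Z^-1 * eV z)%R; last by apply/funext => z; exact: pi_densE.
by apply: measurable_funM => //; exact/measurable_EFinP.
Qed.

Let int_over_b S z :
  int_over S (EFin \o b) z = (Z^-1)%:E * int_over S (fun z => (eV z)%:E) z.
Proof.
have [Z0 _] := normalizer_gt0.
rewrite -(int_overZl S (fun z => (eV z)%:E) (fun=> Z^-1%R))//.
- by apply: eq_int_over => y; rewrite /= pi_densE EFinM.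
- by move=> y; rewrite lee_fin expR_ge0.
- by move=> y; rewrite invr_ge0 ltW.
Qed.

Lemma int_pi_dens : intRd (EFin \o b) = 1.
Proof.
have [Z0 ZE] := normalizer_gt0.
rewrite /intRd int_over_b -/(intRd _) ZE -EFinM mulVf// gt_eqF//.
Qed.

Lemma int_over_pi_dens_le S : uniq S -> exists2 K, (0 <= K)%R & forall z,
  int_over S (EFin \o b) z <= (K * expR (- a * rest_sq S z))%:E.
Proof.
move=> uS; have [K K0 HK] := int_over_expV S uS.
have [Z0 ZE] := normalizer_gt0.
exists (Z^-1 * K)%R; first by rewrite mulr_ge0// invr_ge0 ltW.
move=> z; rewrite int_over_b -mulrA EFinM lee_wpmul2l// lee_fin invr_ge0 ltW//.
Qed.

Lemma int_over_pi_dens_fin S z : uniq S -> int_over S (EFin \o b) z < +oo.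
Proof.
move=> uS; have [K _ HK] := int_over_pi_dens_le S uS.
by apply: le_lt_trans (HK z) _; rewrite ltry.
Qed.

Lemma int_b_le S : uniq S -> exists2 K, (0 <= K)%R & forall z,
  (int_b b S z <= K * expR (- a * rest_sq S z))%R.
Proof.
move=> uS; have [K K0 HK] := int_over_pi_dens_le S uS; exists K => // z.
rewrite -lee_fin -(int_bE _ pi_dens_gt0)//.
by move=> y; exact: int_over_pi_dens_fin.
Qed.

Lemma ln_pi_dens z : ln (b z) = (- V z - ln Z)%R.
Proof.
have [Z0 _] := normalizer_gt0.
rewrite pi_densE lnM ?posrE ?invr_gt0 ?expR_gt0//.
by rewrite lnV ?posrE// expRK addrC.
Qed.

(** The uniform law on the unit cube for every first coordinate: V is controlled on its support by
    the growth condition, and its density takes only the values 0 and 1, so that its entropy is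
    zero. *)
Definition cube_kernel (j : 'I_d) (x y : R) : R := \1_(`[0%R, 1%R]%classic : set R) y.

Lemma star_cube (i1 : 'I_d) : star_kernel i1 cube_kernel.
Proof.
move=> j ji; split; last split.
- have mi : measurable_fun setT (\1_(`[0%R, 1%R]%classic : set R) : R -> R).
    by apply: measurable_indic; exact: measurable_itv.
  exact: (measurableT_comp mi measurable_snd).
- by move=> x y; rewrite /cube_kernel.
- move=> x; rewrite /cube_kernel integral_indic//= setIT lebesgue_measure_itv/=.
  by rewrite lte_fin ltr01 sube0.
Qed.

(** On the cube over s the squared norm is at most s^2 + d, so the growth condition with c2 = 1
    bounds V, hence the relative entropy, by a multiple of exp (s^2). *)
Lemma gibbs1_cube (i1 : 'I_d) : exists K, forall s,
  (expR (- (K * expR (s ^+ 2) + K)) <= gibbs1 i1 V cube_kernel s)%R.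
Proof.
have [c1 [c10 hc]] := hgrowth 1%R ltr01.
have [Z0 _] := normalizer_gt0.
(* The first term comes from V on the cube, the second from the normalising constant. *)
pose K := (c1 * expR d%:R + `|ln Z|)%R.
exists K => s.
have sq := star_cube i1.
have mb := measurable_pi_dens; have b0 := pi_dens_gt0.
have bS z : int_over (others i1) (EFin \o b) z < +oo.
  by apply: int_over_pi_dens_fin; exact: uniq_others.
set w := wq i1 cube_kernel.
have mw : measurable_fun setT w by exact: measurable_wq.
have w0 z : (0 <= w z)%R by exact: wq_ge0.
have w1 z : int_over (others i1) (EFin \o w) z = 1 by exact: int_wq.
have wK z : w z = 0%R \/ (w z = 1%R /\ forall j, j != i1 -> (0 <= z 0 j <= 1)%R).
  rewrite /w /wq /cube_kernel.
  have [h|] := pselect (forall j, j != i1 -> (0 <= z 0 j <= 1)%R).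
    right; split => //; apply: big1 => j /h hj.
    by rewrite indicE mem_set//= in_itv.
  move/existsNP => [j /not_implyP[ji hj]]; left; rewrite (bigD1 j)//= indicE memNset ?mul0r//=.
pose L := (K * expR (s ^+ 2) + K - 1)%R.
have K0 : (0 <= K)%R by rewrite addr_ge0// mulr_ge0 ?expR_ge0// ltW.
have es1 : (1 <= expR (s ^+ 2))%R by rewrite -expR0 ler_expR sqr_ge0.
(* Off the cube both sides equal b; on the cube - ln b = V + ln Z is at most L + 1. The term w is
   then moved to the left so that both integrands are nonnegative. *)
have klw z : z 0%R i1 = s -> (kl (w z) (b z) <= b z + (L + 1) * w z - w z)%R.
  move=> zs; have [->|[-> h]] := wK z; first by rewrite kl0 mulr0 addr0 subr0.
  rewrite klE// ln1 ln_pi_dens /L.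
  have hV : (V z <= c1 * expR (d%:R) * expR (s ^+ 2))%R.
    apply: le_trans (ler_norm _) _; apply: le_trans (hc z) _.
    rewrite mul1r -mulrA -expRD ler_wpM2l ?(ltW c10)// ler_expR.
    rewrite /sqnorm (bigD1 i1)//= zs addrC lerD2r.
    apply: (@le_trans _ _ (\sum_(j < d) 1)%R); last by rewrite big_const_ord iter_addr_0.
    rewrite [leRHS](bigD1 i1)//= -[leLHS]add0r; apply: lerD => //.
    by apply: ler_sum => j /h hj; rewrite expr_le1//; have /andP[] := hj.
  have lZ := ler_norm (ln Z).
  have lZ0 := normr_ge0 (ln Z).
  have : (`|ln Z| <= `|ln Z| * expR (s ^+ 2))%R by rewrite ler_peMr.
  rewrite /K mulrDl.
  have : (0 <= c1 * expR d%:R)%R by rewrite mulr_ge0 ?expR_ge0// ltW.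
  by lra.
have L0 : (0 <= L + 1)%R by rewrite subrK addr_ge0// mulr_ge0// expR_ge0.
set z0 : T := setc 0%R i1 s.
have bB : int_over (others i1) (EFin \o b) z0 = (int_b b (others i1) z0)%:E by exact: int_bE.
have mkl : measurable_fun setT (fun z => (kl (w z) (b z))%:E).
  by apply/measurable_EFinP; exact: measurable_kl.
have mw' : measurable_fun setT (EFin \o w) by exact/measurable_EFinP.
have mb' : measurable_fun setT (EFin \o b) by exact/measurable_EFinP.
have kl0' z : 0 <= (kl (w z) (b z))%:E by rewrite lee_fin kl_ge0.
have w0' z : 0 <= (EFin \o w) z by rewrite lee_fin.
have b0' z : 0 <= (EFin \o b) z by rewrite lee_fin ltW.
have mLw : measurable_fun setT (fun z => (L + 1)%:E * (EFin \o w) z) by exact: measurable_funeM.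
have Lw0 z : 0 <= (L + 1)%:E * (EFin \o w) z by rewrite mule_ge0.
have key : int_over (others i1) (fun z => (kl (w z) (b z))%:E) z0 + 1 <=
    (int_b b (others i1) z0 + (L + 1))%:E.
  have -> : (int_b b (others i1) z0 + (L + 1))%:E =
      int_over (others i1) (fun z => (EFin \o b) z + (L + 1)%:E * (EFin \o w) z) z0.
    by rewrite int_overD// (int_overZl _ (EFin \o w) (fun=> L + 1)%R)// w1 mule1 bB.
  have -> : int_over (others i1) (fun z => (kl (w z) (b z))%:E) z0 + 1 =
      int_over (others i1) (fun z => (kl (w z) (b z))%:E + (EFin \o w) z) z0.
    by rewrite int_overD// w1.
  apply: (le_int_over_at _ _ (fun z : T => z 0%R i1)).
  - by apply: (indep_coord _ _ id); exact: i1_others.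
  - exact: emeasurable_funD.
  - exact: emeasurable_funD.
  - by move=> y; rewrite adde_ge0.
  - by move=> y; rewrite adde_ge0.
  - move=> y; rewrite /z0 setcE eqxx => /klw h.
    by rewrite /= -EFinM -!EFinD lee_fin; lra.
have E0 : (0 < gibbs1 i1 V cube_kernel s)%R.
  rewrite /gibbs1 gibbs_at_gt0//.
  move: key; case: (int_over _ _ _) => //= r _; rewrite ?ltry//.
have := klint_gibbs_at w b mw mb w0 b0 (others i1) bS z0.
rewrite -/(gibbs1 i1 V cube_kernel s) => /(_ E0) klE.
move: key; rewrite klE -EFinD lee_fin => key.
rewrite -ler_ln ?posrE ?expR_gt0// expRK.
by move: key; rewrite /L; lra.
Qed.

End target.

(** * Almost-everywhere statements for Lebesgue measure *)

Section ae_lemmas.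
Context {R : realType}.
Local Notation lam := (@lebesgue_measure R).
Implicit Types P Q : R -> Prop.

Let aeF : Filter (almost_everywhere lam) := ae_filter_ringOfSetsType lam.

Lemma ae_mono P Q : (forall x, P x -> Q x) ->
  {ae lam, forall x, P x} -> {ae lam, forall x, Q x}.
Proof. by move=> PQ; apply: (@filterS _ _ aeF). Qed.

Lemma ae_and P Q : {ae lam, forall x, P x} -> {ae lam, forall x, Q x} ->
  {ae lam, forall x, P x /\ Q x}.
Proof. by move=> hP hQ; apply: (@filterI _ _ aeF). Qed.

Lemma ae_all (I : eqType) (s : seq I) (P : I -> R -> Prop) :
  (forall i, i \in s -> {ae lam, forall x, P i x}) ->
  {ae lam, forall x, forall i, i \in s -> P i x}.
Proof.
elim: s => [_|i s IH h].
  by apply: (ae_mono (fun=> True)) => //; exact: (@filterT _ _ aeF).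
apply: (ae_mono _ _ _ (ae_and _ _ (h i (mem_head _ _)) (IH _))).
  by move=> x [Pi Ps] j; rewrite inE => /predU1P[->//|]; exact: Ps.
by move=> j js; apply: h; rewrite inE js orbT.
Qed.

Lemma ae_nonempty P : {ae lam, forall x, P x} -> exists x, P x.
Proof.
move=> [N [mN N0 sN]].
have [x nx] : exists x, ~ N x.
  apply/not_existsP => h.
  have : (lam setT <= lam N)%E.
    by apply: le_measure; rewrite ?inE// => t _; have /contrapT := h t.
  by rewrite N0 -set_itvNyy lebesgue_measure_itv.
by exists x; apply: contrapT => nP; apply: nx; exact: sN.
Qed.

End ae_lemmas.

Lemma measurable_fine_comp {d1 d2} {T1 : measurableType d1} {T2 : measurableType d2}
    {R : realType} (f : T1 -> T2) (g : T2 -> \bar R) :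
  measurable_fun setT g -> measurable_fun setT f ->
  measurable_fun setT (fun x => fine (g (f x))).
Proof. by move=> mg mf; apply: measurableT_comp => //; exact: (measurableT_comp mg mf). Qed.

Lemma measurable_funV_ge0 {d1} {T1 : measurableType d1} {R : realType} (f : T1 -> R) :
  measurable_fun setT f -> (forall x, 0 <= f x) -> measurable_fun setT (fun x => (f x)^-1).
Proof.
move=> mf f0.
(* The power - 1 agrees with the inverse on nonnegative reals, including the default value 0 at
   0. *)
have h : measurable_fun setT (fun y : R => y `^ (-1)) by exact: measurable_powR.
have -> : (fun x => (f x)^-1) = (fun y : R => y `^ (-1)) \o f.
  by apply/funext => x /=; rewrite powR_inv1.
exact: (measurableT_comp h mf).
Qed.

Lemma integral_normalized {d1} {T1 : measurableType d1} {R : realType}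
    (mu : {measure set T1 -> \bar R}) (f : T1 -> R) (N : R) :
  measurable_fun setT f -> (forall x, 0 <= f x) -> 0 < N ->
  (\int[mu]_x (f x)%:E = N%:E)%E -> (\int[mu]_x (f x / N)%:E = 1)%E.
Proof.
move=> mf f0 N0 fN.
under eq_integral do rewrite mulrC EFinM.
rewrite ge0_integralZl//.
- by rewrite fN -EFinM mulVf// gt_eqF.
- exact/measurable_EFinP.
- by move=> y _; rewrite lee_fin.
- by rewrite lee_fin invr_ge0 ltW.
Qed.

(** * Optimality of one conditional factor *)

Section coordinate_update.
Context {R : realType} {d : nat}.
Local Notation T := 'rV[R]_d.
Local Notation lam := (@lebesgue_measure R).
Local Open Scope ereal_scope.
Variables (i1 : 'I_d) (V : T -> R).
Local Notation others := (others i1).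
Local Notation b := (pi_dens V).
Local Notation star_kernel := (star_kernel i1).
Hypotheses (mb : measurable_fun setT b) (b0 : forall x, (0 < b x)%R).
Hypothesis bT : intRd (EFin \o b) = 1.
Hypothesis bS : forall S z, uniq S -> int_over S (EFin \o b) z < +oo.

Definition rest (i : 'I_d) := [seq j <- enum 'I_d | (j != i1) && (j != i)].

Definition wrest (q : 'I_d -> R -> R -> R) (i : 'I_d) (z : T) : R :=
  \prod_(j | (j != i1) && (j != i)) q j (z 0%R i1) (z 0%R j).

(** The analogue of E when the first and the i-th coordinates are both frozen; up to a factor it is
    the Gibbs update of the i-th factor. *)
Definition gibbs2 q i (z : T) : R := gibbs_at (wrest q i) b (rest i) z.

Lemma wq_split q i z : i != i1 -> wq i1 q z = (q i (z 0 i1) (z 0 i) * wrest q i z)%R.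
Proof. by move=> ii1; rewrite /wq (bigD1 i). Qed.

Lemma uniq_rest i : uniq (rest i).
Proof. exact: filter_uniq (enum_uniq _). Qed.

Lemma i_rest i : i \notin rest i.
Proof. by rewrite mem_filter eqxx andbF. Qed.

Lemma i1_rest i : i1 \notin rest i.
Proof. by rewrite mem_filter eqxx. Qed.

Lemma perm_rest i : i != i1 -> perm_eq others (i :: rest i).
Proof.
move=> ii1; apply: uniq_perm; first exact: uniq_others.
  by rewrite cons_uniq i_rest uniq_rest.
move=> j; have jE : j \in enum 'I_d by rewrite mem_enum.
rewrite in_cons [LHS]mem_filter [X in _ || X]mem_filter [X in _ && X]jE [X in _ || (_ && X)]jE.
by have [->|ji] := eqVneq j i; rewrite ?ii1// !andbT.
Qed.

Lemma int_others_rest i F z : i != i1 -> measurable_fun setT F -> (forall x, 0 <= F x) ->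
  int_over others F z = \int[lam]_x int_over (rest i) F (setc z i x).
Proof.
by move=> ii1 mF F0; rewrite (perm_int_over others (i :: rest i))//; exact: perm_rest.
Qed.

Lemma measurable_wrest q i : star_kernel q -> measurable_fun setT (wrest q i).
Proof. by move=> sq; apply: measurable_prodq => // j /andP[]. Qed.

Lemma wrest_ge0 q i z : star_kernel q -> (0 <= wrest q i z)%R.
Proof. by move=> sq; apply: prodr_ge0 => j /andP[ji _]; have [_ []] := sq j ji. Qed.

Lemma int_wrest q i z : star_kernel q -> int_over (rest i) (EFin \o wrest q i) z = 1.
Proof. by move=> sq; apply: int_prodq => // j /andP[]. Qed.

Lemma measurable_gibbs2 q i : star_kernel q -> measurable_fun setT (gibbs2 q i).
Proof.
move=> sq; apply: measurable_gibbs_at => //; first exact: measurable_wrest.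
by move=> x; exact: wrest_ge0.
Qed.

Lemma gibbs2_ge0 q i z : (0 <= gibbs2 q i z)%R.
Proof. exact: gibbs_at_ge0. Qed.

Lemma gibbs2_le q i z : star_kernel q -> (gibbs2 q i z <= int_b b (rest i) z)%R.
Proof.
move=> sq; apply: gibbs_at_le => //.
- exact: measurable_wrest.
- by move=> x; exact: wrest_ge0.
- by move=> y; exact: int_wrest.
- by move=> y; apply: bS; exact: uniq_rest.
Qed.

Lemma int_int_b_rest i z : i != i1 ->
  \int[lam]_x (int_b b (rest i) (setc z i x))%:E = (int_b b others z)%:E.
Proof.
move=> ii1.
have bO y : int_over others (EFin \o b) y < +oo by apply: bS; exact: uniq_others.
rewrite -(int_bE b b0 others bO) (int_others_rest i)//.
- apply: eq_integral => x _; rewrite int_bE// => y; apply: bS; exact: uniq_rest.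
- exact/measurable_EFinP.
- by move=> y; rewrite lee_fin ltW.
Qed.

(** The chain rule one level down: for fixed s, the i-th factor plays the part of the marginal and
    the other factors that of the kernel. *)
Lemma int_over_kl_coord q i s : i != i1 -> star_kernel q ->
  int_over others (fun y => (kl (wq i1 q y) (b y))%:E) (setc 0%R i1 s) =
    \int[lam]_x kltot (q i s) (fun x => gibbs2 q i (setc (setc 0%R i1 s) i x))
       (fun x => int_b b (rest i) (setc (setc 0%R i1 s) i x)) x /\
  measurable_fun setT (kltot (q i s) (fun x => gibbs2 q i (setc (setc 0%R i1 s) i x))
       (fun x => int_b b (rest i) (setc (setc 0%R i1 s) i x))).
Proof.
move=> ii1 sq; set z0 := setc 0%R i1 s.
pose u (z : T) := q i (z 0%R i1) (z 0%R i).
have mu : measurable_fun setT u by exact: measurable_q.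
have iu : indep (rest i) u.
  move=> z k t kr; rewrite /u (indep_coord (rest i) _ id i1 (i1_rest i) z k t kr).
  by rewrite (indep_coord (rest i) _ id i (i_rest i) z k t kr).
have u0 z : (0 <= u z)%R by have [_ [h _]] := sq i ii1; exact: h.
have m0 z : (0 <= wrest q i z)%R by exact: wrest_ge0.
have mm := measurable_wrest q i sq.
have m1 z := int_wrest q i z sq.
have bR z : int_over (rest i) (EFin \o b) z < +oo by apply: bS; exact: uniq_rest.
have E : kltot (q i s) (fun x => gibbs2 q i (setc z0 i x)) (fun x => int_b b (rest i) (setc z0 i x)) =
   fun x => kltot (fun x => u (setc z0 i x)) (fun x => gibbs_at (wrest q i) b (rest i) (setc z0 i x))
    (fun x => int_b b (rest i) (setc z0 i x)) x.
  apply/funext => x; rewrite /kltot /u !setcE !eqxx.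
  by rewrite (eq_sym i1) (negbTE ii1).
split; last by rewrite E; exact: measurable_kltot.
rewrite E -int_over_kl_cons// (int_others_rest i)//.
- apply: eq_integral => x _; apply: eq_int_over => y.
  by rewrite (wq_split _ i).
- apply/measurable_EFinP; apply: measurable_kl => //; first exact: measurable_wq.
  by move=> x; exact: wq_ge0.
- by move=> x; rewrite lee_fin kl_ge0// wq_ge0.
Qed.

Lemma gibbs1_gt0 q s : star_kernel q -> (0 < gibbs1 i1 V q s)%R =
  (int_over others (fun y => (kl (wq i1 q y) (b y))%:E) (setc 0%R i1 s) < +oo).
Proof.
move=> sq; rewrite /gibbs1 gibbs_at_gt0//; first exact: measurable_wq.
by move=> x; exact: wq_ge0.
Qed.

Lemma int_over_kl_gibbs1 q s : star_kernel q -> (0 < gibbs1 i1 V q s)%R ->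
  int_over others (fun y => (kl (wq i1 q y) (b y))%:E) (setc 0%R i1 s) =
  (- ln (gibbs1 i1 V q s) - 1 + int_b b others (setc 0%R i1 s))%:E.
Proof.
move=> sq g0; apply: klint_gibbs_at => //.
- exact: measurable_wq.
- by move=> x; exact: wq_ge0.
- by move=> y; apply: bS; exact: uniq_others.
Qed.

Variables (p : R -> R) (q : 'I_d -> R -> R -> R).
Hypothesis pq : is_star i1 p q.
Hypothesis hmin : forall p' q', is_star i1 p' q' ->
  KL (star_dens i1 p q) V <= KL (star_dens i1 p' q') V.
Hypothesis q0 : exists2 q', star_kernel q' & (0 < partition1 i1 V q')%R.

Let sq : star_kernel q. Proof. by have [_ [_ [_]]] := pq. Qed.

(** Replacing q_i (. | s) by [gibbs2] normalised to mass 1 changes E (s) into the normaliser N (s).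
    Maximality of E gives N <= E almost everywhere, the variational principle gives N >= E, and its
    equality case is the fixed-point equation. *)
Lemma optimal_coordinate i : i != i1 ->
  {ae lam, forall s, (0 < gibbs1 i1 V q s)%R ->
     {ae lam, forall x, q i s x = gibbs2 q i (setc (setc 0%R i1 s) i x) / gibbs1 i1 V q s}%R}.
Proof.
move=> ii1.
have bO y : int_over others (EFin \o b) y < +oo by apply: bS; exact: uniq_others.
pose E s x := gibbs2 q i (setc (setc 0%R i1 s) i x).
pose B s x := int_b b (rest i) (setc (setc 0%R i1 s) i x).
(* Written as an iterated integral so that measurability in s is available. *)
pose N s := fine (int_over [:: i] (EFin \o gibbs2 q i) (setc 0%R i1 s)).
have mE s : measurable_fun setT (E s).
  apply: (measurableT_comp (measurable_gibbs2 q i sq)).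
  exact: measurable_setc.
have mB s : measurable_fun setT (B s).
  apply: (measurableT_comp (measurable_int_b b mb (rest i))).
  exact: measurable_setc.
have E0 s x : (0 <= E s x)%R by exact: gibbs2_ge0.
have EB s x : (E s x <= B s x)%R by exact: gibbs2_le.
have IB s : \int[lam]_x (B s x)%:E = (int_b b others (setc 0%R i1 s))%:E.
  exact: int_int_b_rest.
have NE s : \int[lam]_x (E s x)%:E = (N s)%:E 
  by exact: (gibbsNE lam (E s) (B s) (mE s) (mB s) (E0 s) (EB s) _ (IB s)).
have mq s : measurable_fun setT (q i s) by exact: (measurable_q1 i1 q i s sq ii1).
have [_ [q0' q1']] := sq i ii1.
have minimal s (g0 : (0 < gibbs1 i1 V q s)%R) := gibbs_minimal lam (E s) (B s) (mE s) (mB s)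
  (E0 s) (EB s) _ (IB s) (q i s) (mq s) (q0' s) (q1' s) (proj2 (int_over_kl_coord q i s ii1 sq)).
have N0 s : (0 < gibbs1 i1 V q s)%R -> (0 < N s)%R.
  move=> g0; have [] := minimal s g0 => //.
  by rewrite -(proj1 (int_over_kl_coord q i s ii1 sq)) -gibbs1_gt0.
have Nge0 s : (0 <= N s)%R.
  by rewrite -lee_fin -NE integral_ge0// => x _; rewrite lee_fin.
have mN : measurable_fun setT N.
  have mg2 : measurable_fun setT (int_over [:: i] (EFin \o gibbs2 q i)).
    by apply: measurable_int_over; apply/measurable_EFinP; exact: measurable_gibbs2.
  apply: (measurable_fine_comp _ _ mg2).
  exact: measurable_setc.
have mNV : measurable_fun setT (fun s => (N s)^-1%R).
  exact: measurable_funV_ge0.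
(* The update is restricted to E (s) > 0, where N (s) > 0 is known; elsewhere the quotient might not
   be a probability density. *)
pose q' j s x : R := if (j == i) && (0 < gibbs1 i1 V q s)%R then (E s x / N s)%R else q j s x.
have mg := measurable_gibbs1 i1 V mb b0 q sq.
have sq' : star_kernel q'.
  move=> j ji; rewrite /q'; case: eqP => [->|_] /=; last exact: sq.
  have [m [_ _]] := sq i ii1.
  split; last split.
  - apply: measurable_fun_ifT => //.
    + apply: measurable_fun_ltr => //.
      by apply: (measurableT_comp mg); exact: measurable_fst.
    + apply: measurable_funM.
      * apply: (measurableT_comp (measurable_gibbs2 q i sq)).
        by apply: measurable_setc; [apply: measurable_setc|].
      * exact: (measurableT_comp mNV measurable_fst).
  - move=> x y; case: ifP => _; [exact: (divr_ge0 (E0 x y) (Nge0 x))|exact: q0'].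
  - move=> x; case: (ltP 0%R (gibbs1 i1 V q x)) => [g0|_]; last exact: q1'.
    exact: (integral_normalized lam _ _ (mE x) (E0 x) (N0 x g0) (NE x)).
have opt := optimal_kernel i1 V mb b0 bT bO p q pq hmin q0 q' sq'.
apply: ae_mono opt => s opts g0.
(* The update leaves the other factors alone, so the Gibbs value it was built from is the same for
   the new kernel. *)
have wE : wrest q' i = wrest q i.
  apply/funext => z; apply: eq_bigr => j /andP[_ ji].
  by rewrite /q' (negbTE ji).
have g2 : gibbs2 q' i = gibbs2 q i by rewrite /gibbs2 wE.
have KL' : int_over others (fun y => (kl (wq i1 q' y) (b y))%:E) (setc 0%R i1 s) =
    (- ln (N s) - 1 + int_b b others (setc 0%R i1 s))%:E.
  rewrite (proj1 (int_over_kl_coord q' i s ii1 sq')) g2.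
  rewrite -(integral_kltot_gibbs lam (E s) (B s) (mE s) (mB s) (E0 s) (EB s) _ (IB s) (N0 s g0)).
  by apply: eq_integral => x _; rewrite /kltot /q' eqxx g0.
have g'0 : (0 < gibbs1 i1 V q' s)%R by rewrite gibbs1_gt0// KL' ltry.
have gN : gibbs1 i1 V q' s = N s.
  have := int_over_kl_gibbs1 q' s sq' g'0; rewrite KL' => -[] /addIr/addIr/oppr_inj/esym.
  by apply: ln_inj; rewrite posrE// N0.
have [] := minimal s g0.
  by rewrite -(proj1 (int_over_kl_coord q i s ii1 sq)) -gibbs1_gt0.
rewrite -(proj1 (int_over_kl_coord q i s ii1 sq)) int_over_kl_gibbs1//.
move=> _; rewrite -/(N s) !lee_fin => h1 h2.
have le1 : (N s <= gibbs1 i1 V q s)%R by rewrite -gN.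
have le2 : (gibbs1 i1 V q s <= N s)%R.
  have : (- ln (N s) - 1 + int_b b others (setc 0%R i1 s) <=
      - ln (gibbs1 i1 V q s) - 1 + int_b b others (setc 0%R i1 s))%R by exact: h1.
  rewrite lerD2r lerD2r lerN2 ler_ln; [by []|exact: g0|exact: N0].
have eqN : gibbs1 i1 V q s = N s by apply/eqP; rewrite eq_le le1 le2.
apply: ae_mono (h2 _) => [x ->|]; first by rewrite eqN.
by rewrite eqN lexx.
Qed.

End coordinate_update.

(** * Free energies and the conditional formula *)

Section free_energy.
Local Open Scope ereal_scope.
Context {d} {T : measurableType d} {R : realType}.
Variable mu : {measure set T -> \bar R}.
Variables m b : T -> R.
Hypotheses (mm : measurable_fun setT m) (mb : measurable_fun setT b).
Hypotheses (m0 : forall x, (0 <= m x)%R) (b0 : forall x, (0 < b x)%R).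
Hypothesis m1 : \int[mu]_x (m x)%:E = 1.
Variable B : R.
Hypothesis bB : \int[mu]_x (b x)%:E = B%:E.

Let nonneg_integrable (f : T -> R) c : measurable_fun setT f -> (forall x, (0 <= f x)%R) ->
  \int[mu]_x (f x)%:E = c%:E -> mu.-integrable setT (EFin \o f).
Proof.
move=> mf f0 fc; apply/integrableP; split; first exact/measurable_EFinP.
by under eq_integral do rewrite gee0_abs ?lee_fin//; rewrite fc ltry.
Qed.

Let im : mu.-integrable setT (EFin \o m). Proof. exact: (nonneg_integrable m 1%R). Qed.
Let ib : mu.-integrable setT (EFin \o b).
Proof. by apply: (nonneg_integrable b B) => // x; exact: ltW. Qed.

Definition entropy_fun (x : T) : R := (m x * ln (m x))%R.
(** For b = [pi_dens V] this is - m (V + ln Z), so its integral is minus the mean energy up to a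
    constant. *)
Definition energy_fun (x : T) : R := (m x * ln (b x))%R.

Lemma measurable_entropy_fun : measurable_fun setT entropy_fun.
Proof.
apply: measurable_funM => //.
exact: (measurableT_comp (@measurable_ln R)).
Qed.

Hypothesis iU : mu.-integrable setT (EFin \o energy_fun).

Let klU x : kl (m x) (b x) = (entropy_fun x - energy_fun x - m x + b x)%R.
Proof. by rewrite klE// /entropy_fun /energy_fun mulrBr. Qed.

(** E > 0 makes the nonnegative integrand [kl] integrable; the entropy is recovered from it by
    adding the energy and m and removing b, each integrable. *)
Lemma integrable_entropy : (0 < gibbsE mu m b)%R -> mu.-integrable setT (EFin \o entropy_fun).
Proof.
move=> E0.
have ik : mu.-integrable setT (EFin \o (fun x => kl (m x) (b x))).
  apply: (nonneg_integrable _ (- ln (gibbsE mu m b) - 1 + B)%R).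
  - exact: measurable_kl.
  - by move=> x; exact: kl_ge0.
  - exact: (klint_gibbsE mu m b m0 b0 B bB).
have -> : EFin \o entropy_fun = (fun x => (EFin \o (fun x => kl (m x) (b x))) x +
    (EFin \o energy_fun) x + (EFin \o m) x - (EFin \o b) x).
  by apply/funext => x /=; rewrite klU -!EFinD; congr (_%:E); ring.
apply: integrableB => //; apply: integrableD => //; exact: integrableD.
Qed.

Lemma gibbsE_free : mu.-integrable setT (EFin \o entropy_fun) ->
  gibbsE mu m b = expR (- (fine (\int[mu]_x (entropy_fun x)%:E) -
                           fine (\int[mu]_x (energy_fun x)%:E))).
Proof.
move=> iE.
have fE : \int[mu]_x (entropy_fun x)%:E \is a fin_num by exact: integrable_fin_num iE.
have fU : \int[mu]_x (energy_fun x)%:E \is a fin_num by exact: integrable_fin_num iU.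
have LE : klint mu m b = (fine (\int[mu]_x (entropy_fun x)%:E) -
    fine (\int[mu]_x (energy_fun x)%:E) - 1 + B)%:E.
  rewrite /klint.
  transitivity (\int[mu]_x ((EFin \o entropy_fun) x - (EFin \o energy_fun) x - (EFin \o m) x + (EFin \o b) x)).
    by apply: eq_integral => x _; rewrite klU.
  rewrite integralD//; last by apply: integrableB => //; exact: integrableB.
  rewrite integralB//; last exact: integrableB.
  by rewrite integralB// bB m1 /= !EFinD !EFinN !fineK.
rewrite /gibbsE LE ltry bB /=; congr (expR (- _)); ring.
Qed.

End free_energy.

(** * Gaussian moments of the optimal kernel *)

Section moments.
Context {R : realType} {d : nat}.
Local Notation T := 'rV[R]_d.
Local Notation lam := (@lebesgue_measure R).
Local Open Scope ereal_scope.
Variables (i1 : 'I_d) (V : T -> R) (a C0 : R).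
Local Notation others := (others i1).
Local Notation b := (pi_dens V).
Local Notation star_kernel := (star_kernel i1).
Local Notation rest := (rest i1).
Local Notation wrest := (wrest i1).
Local Notation wq := (wq i1).
Local Notation gibbs1 := (gibbs1 i1 V).
Local Notation gibbs2 := (gibbs2 i1 V).
Hypotheses (mV : measurable_fun setT V) (a0 : (0 < a)%R).
Hypothesis V_ge : forall z, (a * sqnorm z - C0 <= V z)%R.
Hypothesis hgrowth : growth V.

Let mb : measurable_fun setT b. Proof. exact: measurable_pi_dens. Qed.
Let b0 : forall z, (0 < b z)%R. Proof. exact: (pi_dens_gt0 V a C0). Qed.
Let bT : intRd (EFin \o b) = 1. Proof. exact: (int_pi_dens V a C0). Qed.
Let bS : forall S z, uniq S -> int_over S (EFin \o b) z < +oo.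
Proof. exact: (int_over_pi_dens_fin V a C0). Qed.

Variables (p : R -> R) (q : 'I_d -> R -> R -> R).
Hypothesis pq : is_star i1 p q.
Hypothesis hmin : forall p' q', is_star i1 p' q' ->
  KL (star_dens i1 p q) V <= KL (star_dens i1 p' q') V.

Let sq : star_kernel q. Proof. by have [_ [_ [_]]] := pq. Qed.

Lemma partition1_cube_gt0 : exists2 q', star_kernel q' & (0 < partition1 i1 V q')%R.
Proof.
exists (@cube_kernel R d); first exact: star_cube.
have sqc := @star_cube R d i1.
have [K HK] := gibbs1_cube V a C0 mV a0 V_ge hgrowth i1.
have bO z : int_over others (EFin \o b) z < +oo by apply: bS; exact: uniq_others.
rewrite -lte_fin -(partition1E i1 V mb b0 bT bO _ sqc).
have mg := measurable_gibbs1 i1 V mb b0 _ sqc.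
have mG : measurable_fun setT (fun z : T => (gibbs1 (@cube_kernel R d) (z 0%R i1))%:E).
  apply/measurable_EFinP; apply: (measurableT_comp mg).
  exact: measurable_coord.
have G0 z : 0 < (gibbs1 (@cube_kernel R d) ((z : T) 0%R i1))%:E.
  by rewrite lte_fin; apply: lt_le_trans (HK _); exact: expR_gt0.
have := int_over_gt0 [:: i1] _ mG G0 0%R; rewrite /=.
by under eq_integral do rewrite setcE eqxx.
Qed.

Let q0 := partition1_cube_gt0.

(* Almost every [s] is good: the lower bound comes from comparing with the uniform
   law on the unit cube, the fixed-point equation from replacing one factor by its
   Gibbs update. *)
Definition good K s := (expR (- (K * expR (s ^+ 2) + K)) <= gibbs1 q s)%R /\
  forall i, i \in others ->
   {ae lam, forall x, q i s x = gibbs2 q i (setc (setc 0%R i1 s) i x) / gibbs1 q s}%R.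

Lemma in_others i : (i \in others) = (i != i1).
Proof.
have iE : i \in enum 'I_d by rewrite mem_enum.
by rewrite /Defs.others [LHS]mem_filter [X in _ && X]iE andbT.
Qed.

Lemma ae_good : exists K, {ae lam, forall s, good K s}.
Proof.
have [K HK] := gibbs1_cube V a C0 mV a0 V_ge hgrowth i1.
have bO z : int_over others (EFin \o b) z < +oo by apply: bS; exact: uniq_others.
exists K.
have h1 := optimal_kernel i1 V mb b0 bT bO p q pq hmin q0 _ (@star_cube R d i1).
have h2 : {ae lam, forall s, forall i, i \in others -> (0 < gibbs1 q s)%R ->
   {ae lam, forall x, q i s x = gibbs2 q i (setc (setc 0%R i1 s) i x) / gibbs1 q s}%R}.
  apply: ae_all => i; rewrite in_others => ii1.
  exact: (optimal_coordinate i1 V mb b0 bT bS p q pq hmin q0 i ii1).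
apply: ae_mono (ae_and _ _ h1 h2) => s [g1 g2].
have g : (expR (- (K * expR (s ^+ 2) + K)) <= gibbs1 q s)%R by exact: le_trans (HK s) g1.
split => // i io; apply: g2 => //.
by apply: lt_le_trans g; exact: expR_gt0.
Qed.

Variable K : R.

Lemma good_gt0 s : good K s -> (0 < gibbs1 q s)%R.
Proof. by move=> [h _]; apply: lt_le_trans h; exact: expR_gt0. Qed.

Definition gmom (s : R) (j : 'I_d) : R := fine (\int[lam]_x (expR (a / 2 * x ^+ 2) * q j s x)%:E).

Lemma gmomE : exists2 Kc, (0 <= Kc)%R & forall s, good K s -> forall j, j \in others ->
  \int[lam]_x (expR (a / 2 * x ^+ 2) * q j s x)%:E = (gmom s j)%:E /\
  (0 <= gmom s j <= Kc / gibbs1 q s)%R.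
Proof.
have [g gE] := gauss_integral_fin (a / 2) ltac:(by rewrite divr_gt0).
have g0 : (0 <= g)%R.
  by rewrite -lee_fin -gE integral_ge0// => x _; rewrite lee_fin expR_ge0.
have /choice[Kj HKj] : forall j : 'I_d, exists k : R, (0 <= k)%R /\ forall z,
    (int_b b (rest j) z <= k * expR (- a * rest_sq (rest j) z))%R.
  move=> j; have [k k0 hk] := int_b_le V a C0 mV a0 V_ge (rest j) (uniq_rest i1 j).
  by exists k.
have Kj0 j : (0 <= Kj j)%R by have [] := HKj j.
(* The sum dominates every single K_j g, so that one constant serves all factors. *)
exists (\sum_j Kj j * g)%R; first by apply: sumr_ge0 => j _; rewrite mulr_ge0.
move=> s gs j jo; have E0 := good_gt0 s gs.
have ji1 : j != i1 by rewrite -in_others.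
have mq : measurable_fun setT (q j s) by exact: (measurable_q1 i1 q j s sq ji1).
have [_ [q0' _]] := sq j ji1.
have mF : measurable_fun setT (fun x : R => (expR (a / 2 * x ^+ 2) * q j s x)%:E).
  by apply/measurable_EFinP; apply: measurable_funM => //; exact: measurable_sqfun.
have F0 x : 0 <= (expR (a / 2 * x ^+ 2) * q j s x)%:E by rewrite lee_fin mulr_ge0 ?expR_ge0.
have I0 : 0 <= \int[lam]_x (expR (a / 2 * x ^+ 2) * q j s x)%:E.
  by apply: integral_ge0 => x _; exact: F0.
have le1 : \int[lam]_x (expR (a / 2 * x ^+ 2) * q j s x)%:E <= (Kj j * g / gibbs1 q s)%:E.
  have -> : (Kj j * g / gibbs1 q s)%:E =
      \int[lam]_x ((Kj j / gibbs1 q s)%:E * (expR (- (a / 2) * x ^+ 2))%:E).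
    rewrite ge0_integralZl//.
    - by rewrite gE -EFinM; congr (_%:E); ring.
    - by apply/measurable_EFinP; exact: measurable_sqfun.
    - by rewrite lee_fin divr_ge0// ltW.
  apply: ae_ge0_le_integral => //.
  - by move=> x _; rewrite -EFinM lee_fin mulr_ge0 ?expR_ge0// divr_ge0// ltW.
  - apply: measurable_funeM; apply/measurable_EFinP; exact: measurable_sqfun.
  - have [_ /(_ j jo)] := gs; apply: ae_mono => x -> _; rewrite -EFinM lee_fin.
    set z := setc _ j x.
    have gl : (gibbs2 q j z <= Kj j * expR (- a * x ^+ 2))%R.
      apply: le_trans (gibbs2_le i1 V mb b0 bS q j z sq) _.
      have [_ /(_ z)/le_trans] := HKj j; apply.
      rewrite ler_wpM2l// ler_expR !mulNr lerN2 ler_wpM2l ?(ltW a0)//.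
      have := rest_sq_ge (rest j) z j (i_rest i1 j).
      by rewrite /z setcE eqxx.
    rewrite mulrA -[leRHS]mulrA [X in (_ <= _ * X)%R]mulrC [leRHS]mulrA ler_wpM2r ?invr_ge0 ?(ltW E0)//.
    apply: le_trans (ler_wpM2l (expR_ge0 _) gl) _.
    rewrite mulrCA -expRD le_eqVlt; apply/orP; left; apply/eqP; congr (_ * expR _)%R.
    by field.
have fin : \int[lam]_x (expR (a / 2 * x ^+ 2) * q j s x)%:E \is a fin_num.
  by rewrite ge0_fin_numE//; apply: le_lt_trans le1 _; rewrite ltry.
have E : \int[lam]_x (expR (a / 2 * x ^+ 2) * q j s x)%:E = (gmom s j)%:E.
  by rewrite /gmom fineK.
split => //; rewrite -!lee_fin -E I0 /=; apply: le_trans le1 _.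
rewrite lee_fin ler_wpM2r ?invr_ge0 ?(ltW E0)// (bigD1 j)//= lerDl.
by apply: sumr_ge0 => k _; rewrite mulr_ge0.
Qed.

(** Freezes the first coordinate inside the conditional densities and indexes their product by the
    list of integration, the form required by [int_over_expsq]. The predicate stays general because
    the i-th coordinate is sometimes excluded too. *)
Lemma int_over_prodqE (P : pred 'I_d) (F : R -> T -> \bar R) z : (forall j, P j -> j != i1) ->
  int_over [seq j <- enum 'I_d | P j]
    (fun y => F (\prod_(j | P j) q j (y 0%R i1) (y 0%R j))%R y) z =
  int_over [seq j <- enum 'I_d | P j]
    (fun y => F (\prod_(j <- [seq j <- enum 'I_d | P j]) q j (z 0%R i1) (y 0%R j))%R y) z.
Proof.
move=> Pi; set S := [seq _ <- _ | _].
have iS : i1 \notin S.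
  by rewrite mem_filter negb_and; apply/orP; left; apply/negP => /Pi; rewrite eqxx.
rewrite (int_over_indep S _ (fun z : T => z 0%R i1)
  (fun c y => F (\prod_(j | P j) q j c (y 0%R j))%R y)); last exact: (indep_coord S _ id).
apply: eq_int_over => y; congr (F _ y).
by rewrite big_filter big_enum_cond; apply: eq_bigl => j; rewrite inE.
Qed.

Lemma weighted_moment (P : pred 'I_d) (z : T) : (forall j, P j -> j != i1) -> good K (z 0%R i1) ->
  int_over [seq j <- enum 'I_d | P j] (fun y => (expR (a / 2 * sqnorm y) *
     \prod_(j | P j) q j (y 0%R i1) (y 0%R j))%:E) z =
  (expR (a / 2 * rest_sq [seq j <- enum 'I_d | P j] z) *
     \prod_(j <- [seq j <- enum 'I_d | P j]) gmom (z 0%R i1) j)%:E.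
Proof.
move=> Pi gs.
rewrite (int_over_prodqE P (fun w y => (expR (a / 2 * sqnorm y) * w)%:E))//.
set S := [seq _ <- _ | _].
have jS j : j \in S -> j != i1 by rewrite mem_filter => /andP[/Pi].
have [Kc _ Hg] := gmomE.
apply: (int_over_expsq S (q ^~ (z 0%R i1))).
- by rewrite filter_uniq// enum_uniq.
- by move=> j /jS ji; exact: (measurable_q1 i1 q j _ sq ji).
- by move=> j /jS ji; have [_ [h _]] := sq j ji; exact: h.
- by move=> j /jS ji; have [] := Hg _ gs j; rewrite ?in_others.
Qed.

Lemma weighted_integrable (P : pred 'I_d) (H : T -> R) (k : R) (z : T) : (forall j, P j -> j != i1) ->
  good K (z 0%R i1) -> measurable_fun setT H -> (0 <= k)%R ->
  (forall y, `|H y| <= k * expR (a / 2 * sqnorm y))%R ->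
  (coord_measure [seq j <- enum 'I_d | P j] z).-integrable setT
     (fun y => (H y * \prod_(j | P j) q j (y 0%R i1) (y 0%R j))%:E).
Proof.
move=> Pi gs mH k0 Hk.
have mw := measurable_prodq i1 q P sq Pi.
have w0 (y : T) : (0 <= \prod_(j | P j) q j (y 0 i1) (y 0 j))%R.
  by apply: prodr_ge0 => j /Pi ji; have [_ [h _]] := sq j ji; exact: h.
have mHw : measurable_fun setT (fun y : T => (H y * \prod_(j | P j) q j (y 0%R i1) (y 0%R j))%:E).
  by apply/measurable_EFinP; exact: measurable_funM.
have me : measurable_fun setT (fun y : T => (expR (a / 2 * sqnorm y) *
     \prod_(j | P j) q j (y 0%R i1) (y 0%R j))%:E).
  by apply/measurable_EFinP; apply: measurable_funM => //; exact: measurable_expR_sqnorm.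
apply/integrableP; split => //.
rewrite -ge0_int_over_integral//; last exact: measurableT_comp.
apply: (@le_lt_trans _ _ (int_over [seq j <- enum 'I_d | P j] (fun y => k%:E *
   (expR (a / 2 * sqnorm y) * \prod_(j | P j) q j (y 0%R i1) (y 0%R j))%:E) z)).
  apply: le_int_over => //.
  - exact: measurableT_comp.
  - exact: measurable_funeM.
  - move=> y; rewrite -EFinM abse_EFin lee_fin normrM [X in (_ * X)%R]ger0_norm// mulrA.
    by rewrite ler_wpM2r.
rewrite (int_overZl _ (fun y : T => (expR (a / 2 * sqnorm y) *
   \prod_(j | P j) q j (y 0%R i1) (y 0%R j))%:E) (fun=> k))//.
  by rewrite weighted_moment// -EFinM ltry.
by move=> y; rewrite lee_fin mulr_ge0 ?expR_ge0.
Qed.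

Let Z : R := fine (intRd (fun z => (expR (- V z))%:E)).

(** ln [gibbs2] is minus the entropy of the other factors, minus their mean of V, minus ln Z. The
    entropy does not involve z_i, so it enters only the constant c; its finiteness has to be
    established at one point first. *)
Lemma cond_V_free_energy i s : i != i1 -> good K s -> exists2 c, (0 < c)%R & forall x, exists r,
  cond_V i1 V q i s x = r%:E /\ (gibbs2 q i (setc (setc 0%R i1 s) i x) = c * expR (- r))%R.
Proof.
move=> ii1 gs; set z0 := setc 0%R i1 s.
have zs x : setc z0 i x 0%R i1 = s.
  by rewrite !setcE eq_sym (negbTE ii1) eqxx.
pose P j := (j != i1) && (j != i).
have Pi j : P j -> j != i1 by case/andP.
pose m := wrest q i.
have mm : measurable_fun setT m by exact: measurable_wrest.
have m0 y : (0 <= m y)%R by exact: wrest_ge0.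
have m1 x : \int[coord_measure (rest i) (setc z0 i x)]_y (m y)%:E = 1.
  rewrite -(ge0_int_over_integral _ (EFin \o m))//; first exact: int_wrest.
  exact/measurable_EFinP.
have bB x : \int[coord_measure (rest i) (setc z0 i x)]_y (b y)%:E =
    (int_b b (rest i) (setc z0 i x))%:E.
  rewrite -int_bE//; last by move=> y; apply: bS; exact: uniq_rest.
  rewrite [RHS]ge0_int_over_integral//; first exact/measurable_EFinP.
  by move=> y; rewrite lee_fin ltW.
have [c1 [c10 hc]] := hgrowth (a / 2)%R ltac:(by rewrite divr_gt0).
have iV x : (coord_measure (rest i) (setc z0 i x)).-integrable setT (fun y => (V y * m y)%:E).
  have gx : good K (setc z0 i x 0%R i1) by rewrite zs.
  exact: (weighted_integrable P V c1 _ Pi gx mV (ltW c10) hc).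
have im x : (coord_measure (rest i) (setc z0 i x)).-integrable setT (fun y => (m y)%:E).
  apply/integrableP; split; first exact/measurable_EFinP.
  by under eq_integral do rewrite gee0_abs ?lee_fin//; rewrite m1 ltry.
have EU y : (EFin \o energy_fun m b) y = (-1)%:E * (V y * m y)%:E + (- ln Z)%:E * (m y)%:E.
  rewrite /= -!EFinM -EFinD /energy_fun (ln_pi_dens V a C0 mV a0 V_ge); congr (_%:E).
  by rewrite -/Z; ring.
have iU x : (coord_measure (rest i) (setc z0 i x)).-integrable setT (EFin \o energy_fun m b).
  rewrite (funext EU); exact: (integrableD measurableT (integrableZl measurableT _ (iV x)) (integrableZl measurableT _ (im x))).
have ment := measurable_entropy_fun m mm.
(* Otherwise the fixed-point equation would make q_i (. | s) vanish almost everywhere, against its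
   mass 1. *)
have [x0 Ex0] : exists x, (0 < gibbs2 q i (setc z0 i x))%R.
  apply/not_existsP => h.
  have [_ [_ /(_ s) q1]] := sq i ii1.
  have : \int[lam]_x (q i s x)%:E = \int[lam]_x (cst 0 x).
    apply: ae_eq_integral => //.
    - by apply/measurable_EFinP; exact: (measurable_q1 i1 q i s sq ii1).
    - have [_ /(_ i)] := gs; rewrite in_others => /(_ ii1).
      apply: ae_mono => x -> _ /=; have /negP := h x; rewrite -leNgt => g0.
      have -> : gibbs2 q i (setc (setc 0%R i1 s) i x) = 0%R.
        by apply/eqP; rewrite eq_le g0 gibbs2_ge0.
      by rewrite mul0r.
  by rewrite q1 integral0 => /eqP; rewrite onee_eq0.
have indm (X : Type) (f : R -> X) : indep [:: i] (f \o m).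
  move=> z k t; rewrite inE => /eqP ->; congr f; apply: eq_bigr => j /andP[_ ji].
  by rewrite !setcE (negbTE ji) eq_sym (negbTE ii1).
have iE0 : (coord_measure (rest i) (setc z0 i x0)).-integrable setT (EFin \o entropy_fun m).
  exact: (integrable_entropy _ m b mm mb m0 b0 (m1 x0) _ (bB x0) (iU x0)).
(* Finiteness spreads from x0 to every x because the entropy integrand is constant in the i-th
   coordinate. *)
have iE x : (coord_measure (rest i) (setc z0 i x)).-integrable setT (EFin \o entropy_fun m).
  move/integrableP : iE0 => [mE]; rewrite -ge0_int_over_integral//; last exact: measurableT_comp.
  rewrite indep_int_over//; last 2 first.
  - exact: i_rest.
  - exact: (indm _ (fun w => `|(w * ln w)%:E|)).
  move=> Eoo; apply/integrableP; split => //.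
  rewrite -ge0_int_over_integral//; last exact: measurableT_comp.
  rewrite indep_int_over//; first exact: i_rest.
  exact: (indm _ (fun w => `|(w * ln w)%:E|)).
pose ent := fine (int_over (rest i) (EFin \o entropy_fun m) z0).
have entE x : fine (\int[coord_measure (rest i) (setc z0 i x)]_y (entropy_fun m y)%:E) = ent.
  rewrite -(int_overE _ (EFin \o entropy_fun m))//; last exact/measurable_EFinP.
  rewrite indep_int_over//; first exact: i_rest.
  exact: (indm _ (fun w => (w * ln w)%:E)).
exists (expR (- (ent + ln Z))); first exact: expR_gt0.
move=> x; set z := setc z0 i x; exists (fine (\int[coord_measure (rest i) z]_y (V y * m y)%:E)).
split.
  rewrite fineK; last exact: integrable_fin_num (iV x).
  rewrite -int_overE//; last exact: iV.
  by apply/measurable_EFinP; exact: measurable_funM.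
rewrite /gibbs2 /gibbs_at (gibbsE_free _ m b mm mb m0 b0 (m1 x) _ (bB x) (iU x) (iE x)) entE -expRD.
congr expR.
rewrite [X in (ent - fine X)%R](eq_integral _ _ (fun y _ => EU y)).
rewrite (integralD measurableT (integrableZl measurableT _ (iV x)) (integrableZl measurableT _ (im x))).
rewrite (integralZl measurableT (iV x)) (integralZl measurableT (im x)) m1 mule1 fineD//; last by rewrite fin_numM//; exact: integrable_fin_num (iV x).
rewrite fineM//; last exact: integrable_fin_num (iV x).
by rewrite /=; ring.
Qed.

Lemma conditional_formula i s : i != i1 -> good K s -> exists c : R, (0 < c)%R /\
  {ae lam, forall x : R, exists r : R, cond_V i1 V q i s x = r%:E /\ q i s x = (c * expR (- r))%R}.
Proof.
move=> ii1 gs; have [c c0 Hc] := cond_V_free_energy i s ii1 gs.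
have g0 := good_gt0 s gs.
exists (c / gibbs1 q s)%R; split; first by rewrite divr_gt0.
have [_ /(_ i)] := gs; rewrite in_others => /(_ ii1); apply: ae_mono => x qE.
have [r [rE gE]] := Hc x; exists r; split => //.
by rewrite qE gE mulrAC.
Qed.

End moments.

(** * Difference quotients on the line *)

Section line.
Context {R : realType}.
Local Notation lam := (@lebesgue_measure R).
Local Open Scope ereal_scope.
Implicit Types (f g : R -> \bar R) (A : set R).

Lemma ae_foralln_lebesgue (P : nat -> R -> Prop) : (forall n, {ae lam, forall x, P n x}) ->
  {ae lam, forall x, forall n, P n x}.
Proof. exact: ae_foralln. Qed.

Lemma ae_bounded_integrable A f (M : R) : measurable A -> lam A < +oo -> measurable_fun A f ->
  {ae lam, forall x, A x -> `|f x| <= M%:E} -> lam.-integrable A f.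
Proof.
move=> mA Aoo mf fM; apply/integrableP; split => //.
apply: (@le_lt_trans _ _ (\int[lam]_(x in A) (cst `|M|%:E) x)).
  apply: ae_ge0_le_integral => //.
  - exact: measurableT_comp.
  - by move=> x _; rewrite lee_fin.
  - apply: ae_mono fM => x h Ax; apply: le_trans (h Ax) _.
    by rewrite lee_fin ler_norm.
rewrite integral_cst// lte_mul_pinfty//; by rewrite lee_fin.
Qed.

Lemma ae_le_integral A f g : measurable A -> lam.-integrable A f -> lam.-integrable A g ->
  {ae lam, forall x, A x -> f x <= g x} ->
  \int[lam]_(x in A) f x <= \int[lam]_(x in A) g x.
Proof.
move=> mA If Ig [N [mN N0 fgN]].
rewrite (negligible_integral mN mA If N0) (negligible_integral mN mA Ig N0).
have mAN : measurable (A `\` N) by exact: measurableD.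
apply: le_integral => //.
- by apply: integrableS If => //; exact: subDsetl.
- by apply: integrableS Ig => //; exact: subDsetl.
- move=> x; rewrite inE => -[Ax Nx]; apply: contrapT => h; apply: Nx; apply: fgN => /(_ Ax).
  exact: h.
Qed.

Definition translation (k : R) : measurableTypeR R -> measurableTypeR R := fun x => (x + k : R)%R.

Lemma measurable_translation k : measurable_fun setT (translation k).
Proof. exact: (@measurable_funD _ _ R). Qed.

HB.instance Definition _ k := isMeasurableFun.Build _ _ _ _ (translation k) (measurable_translation k).

Lemma lebesgue_measure_translation (k : R) A : measurable A ->
  pushforward lam (translation k) A = lam A.
Proof.
move=> mA; apply/esym/lebesgue_measure_unique => //= _ [[a b]] _ <-.
rewrite /pushforward /=.
have -> : translation k @^-1` `]a, b] = `](a - k)%R, (b - k)%R]%classic.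
  by apply/seteqP; split => x /=; rewrite /translation !in_itv/= ltrBlDr lerBrDr.
rewrite !lebesgue_measure_itv/= !lte_fin ltrD2r.
by case: ifP => // _; rewrite -!EFinD; congr (_%:E); ring.
Qed.

Lemma ae_shift (k : R) (P : R -> Prop) : {ae lam, forall x, P x} -> {ae lam, forall x, P (x + k)%R}.
Proof.
move=> [N [mN N0 PN]]; exists (translation k @^-1` N); split.
- by rewrite -[X in measurable X]setTI; exact: measurable_translation.
- by rewrite -N0 -[RHS](lebesgue_measure_translation k).
- by move=> x h; exact: PN.
Qed.

Lemma integral_shift (k al be : R) (f : R -> R) : measurable_fun setT f ->
  lam.-integrable `]al, be] (EFin \o (fun x => f (x + k)%R)) ->
  \int[lam]_(x in `](al + k)%R, (be + k)%R]) (f x)%:E = \int[lam]_(x in `]al, be]) (f (x + k)%R)%:E.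
Proof.
move=> mf If.
have pre : translation k @^-1` `](al + k)%R, (be + k)%R] = `]al, be]%classic.
  by apply/seteqP; split => x /=; rewrite /translation !in_itv/= ltrD2r lerD2r.
rewrite -(eq_measure_integral lam (m1 := pushforward lam (translation k))).
- by rewrite (integral_pushforward (measurable_translation k)) ?pre//; exact/measurable_EFinP.
- by move=> A mA _; exact: lebesgue_measure_translation.
Qed.

(** Used with e = 1 and e = -1, for steps to the right and to the left. *)
Lemma harmonic_dnbhs (e : R) : (e != 0)%R -> (fun n => e * harmonic n)%R @ \oo --> (0%R : R)^'.
Proof.
move=> e0.
have h : ((fun n => e * harmonic n) @ \oo --> (0%R:R))%R.
  rewrite -[X in _ --> X](mulr0 e); apply: cvgMr; exact: cvg_harmonic.
move=> A /h [n _ hn]; exists n => // m nm; apply: (hn m nm).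
by rewrite mulf_neq0// gt_eqF// /harmonic/= invr_gt0.
Qed.

Lemma cvg_difference_quotient (h : R -> R) x (k : R^nat) : derivable h x 1%R ->
  k @ \oo --> (0%R : R)^' -> ((h (x + k m) - h x) / k m)%R @[m --> \oo] --> 'D_1%R h x.
Proof.
move=> dx kc.
have h' : (fun e : R => (e^-1 *: (h (e *: 1%R + x) - h x))%R) @ (0%R : R)^' --> 'D_1%R h x.
  exact: dx.
have := cvg_comp _ _ kc h'; apply: cvg_trans; apply: near_eq_cvg; near=> m.
by rewrite /= /GRing.scale /= mulr1 [(k m + x)%R]addrC mulrC.
Unshelve. all: by end_near. Qed.

Lemma lebesgue_itv_oc_fin (al be : R) : lam `]al, be]%classic < +oo.
Proof. by rewrite lebesgue_measure_itv/=; case: ifP => // _; rewrite -EFinD ltry. Qed.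

End line.

(** * From increment inequalities to an integral formula *)

Section increments.
Context {R : realType}.
Local Notation lam := (@lebesgue_measure R).
Local Open Scope ereal_scope.
Variables (F : R -> R) (D : R -> R -> \bar R) (G : R -> \bar R).
Hypothesis mF : measurable_fun setT F.
Hypothesis mD : forall k, measurable_fun setT (D k).
Hypothesis mG : measurable_fun setT G.
Hypothesis F_bound : forall t : R, exists M : R, {ae lam, forall s, (`|s| <= t -> `|F s| <= M)%R}.
Hypothesis D_bound : forall t : R, exists M : R, {ae lam, forall s, (`|s| <= t)%R ->
  forall k, (k != 0)%R -> (`|k| <= 1)%R -> `|D k s| <= M%:E}.
Hypothesis D_cvg : forall k : R^nat, (forall n, `|k n| <= 1)%R -> k @ \oo --> (0%R : R)^' ->
  {ae lam, forall s, D (k n) s @[n --> \oo] --> G s}.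
Hypothesis F_incr : forall k, (k != 0)%R -> (`|k| <= 1)%R ->
  {ae lam, forall s, (F (s + k) - F s)%:E <= k%:E * D k s}.

(** F is only locally bounded, almost everywhere; truncation makes it integrable on the whole line,
    as differentiation of its primitive from minus infinity requires. *)
Let Ft (n : nat) : R -> R := F \_ `[(- n%:R)%R, n%:R]%classic.

Let mFt n : measurable_fun setT (Ft n).
Proof. by apply/(measurable_restrictT _ _).1 => //; exact: measurable_funTS. Qed.

Let FtE n (s : R) : (`|s| <= n%:R)%R -> Ft n s = F s.
Proof. by move=> sn; rewrite /Ft patchE mem_set//= in_itv/= -ler_norml. Qed.

Let iFt n : lam.-integrable setT (EFin \o Ft n).
Proof.
have [M hM] := F_bound n%:R.
have -> : EFin \o Ft n = (EFin \o F) \_ `[(- n%:R)%R, n%:R]%classic.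
  by apply/funext => x; rewrite /= /Ft !patchE; case: ifP.
apply/(integrable_mkcond _ _).1 => //.
apply: (ae_bounded_integrable _ _ M) => //.
- by rewrite lebesgue_measure_itv/=; case: ifP => // _; rewrite -EFinD ltry.
- by apply/measurable_EFinP; exact: measurable_funTS.
- apply: ae_mono hM => x h; rewrite /= in_itv/= -ler_norml => /h.
  by rewrite lee_fin.
Qed.

Let Phi n x : R := (\int[lam]_(t in `]-oo, x]) Ft n t)%R.

(** The points where the primitives of all truncations have the expected derivative at once;
    countably many conditions still leave a set of full measure. *)
Let L x := forall n : nat, derivable (Phi n) x 1%R /\ 'D_1%R (Phi n) x = Ft n x.

Let aeL : {ae lam, forall x, L x}.
Proof.
apply: ae_foralln_lebesgue => n.
have : {ae lam, forall x, derivable (Phi n) x 1%R /\ derive1 (Phi n) x = Ft n x}; last first.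
  by apply: ae_mono => x [h]; rewrite derive1E.
apply: (@FTC1Ny R (Ft n)).
- by move=> y; apply: integrableS (iFt n).
- by apply: open_integrable_locally; [exact: openT|exact: iFt].
Qed.

(** Shifting the variable makes the integral collapse to increments of a primitive at the two
    endpoints; after division by k these converge to the values of F at Lebesgue points. *)
Let increment n (al be k : R) : (al <= be)%R -> (`|al| <= n%:R)%R -> (`|be| <= n%:R)%R ->
  (`|al + k| <= n%:R)%R -> (`|be + k| <= n%:R)%R ->
  \int[lam]_(s in `]al, be]) (F (s + k) - F s)%:E =
  ((Phi n (be + k) - Phi n be) - (Phi n (al + k) - Phi n al))%:E.
Proof.
move=> ab an bn akn bkn.
have sub (c x y : R) : (`|c + x| <= n%:R)%R -> (`|c + y| <= n%:R)%R ->
    forall s : R, s \in `]x, y] -> (`|s + c| <= n%:R)%R.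
  rewrite !ler_norml => /andP[h1 h2] /andP[h3 h4] s; rewrite in_itv/= => /andP[h5 h6].
  by rewrite ler_norml; apply/andP; split; lra.
have i1 : lam.-integrable `]al, be] (EFin \o Ft n) by exact: integrableS (iFt n).
have i2 : lam.-integrable `]al, be] (EFin \o (fun s => Ft n (s + k)%R)).
  have [M hM] := F_bound n%:R.
  apply: (ae_bounded_integrable _ _ M) => //; first exact: lebesgue_itv_oc_fin.
  - apply/measurable_EFinP; apply: measurable_funTS; apply: (measurableT_comp (mFt n)).
    exact: measurable_funD.
  - apply: ae_mono (ae_shift k _ hM) => s hs sab; rewrite /= lee_fin FtE.
      by apply: hs; apply: (sub _ al be); rewrite 1?addrC.
    by apply: (sub _ al be); rewrite 1?addrC.
have e : \int[lam]_(s in `]al, be]) (F (s + k) - F s)%:E =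
    \int[lam]_(s in `]al, be]) ((Ft n (s + k))%:E - (Ft n s)%:E).
  apply: eq_integral => s /set_mem /= sab; rewrite -EFinB !FtE//.
    by rewrite -[s]addr0; apply: (sub _ al be); rewrite 1?add0r.
  by apply: (sub _ al be); rewrite 1?addrC.
rewrite e integralB_EFin// -(integral_shift k)//.
have PhiB (x y : R) : (x <= y)%R -> (Phi n y - Phi n x)%R = fine (\int[lam]_(s in `]x, y]) (Ft n s)%:E).
  move=> xy; rewrite /Phi Rintegral_itvB//.
  - exact: integrableS (iFt n).
have fin (x y : R) : \int[lam]_(s in `]x, y]) (Ft n s)%:E \is a fin_num.
  by apply: integrable_fin_num; first exact: measurable_itv; exact: integrableS (iFt n).
rewrite -[X in X - _]fineK// -[X in _ - X]fineK// -!PhiB ?lerD2r//.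
by rewrite -EFinB; congr (_%:E); ring.
Qed.

Let iD (al be : R) k : (k != 0)%R -> (`|k| <= 1)%R -> lam.-integrable `]al, be] (D k).
Proof.
move=> k0 k1; have [M hM] := D_bound (Num.max `|al| `|be|)%R.
apply: (ae_bounded_integrable _ _ M) => //; first exact: lebesgue_itv_oc_fin.
- exact: measurable_funTS.
- apply: ae_mono hM => s h; rewrite /= in_itv/= => /andP[as_ sb]; apply: h => //.
  by rewrite ler_norml; have := ler_norm (- al); have := ler_norm be; rewrite normrN;
    rewrite le_max ?opprK; case: (leP `|al| `|be|)%R; lra.
Qed.

Let step_facts (e : R) : (`|e| = 1)%R -> [/\ forall m, (e * harmonic m != 0)%R,
  forall m, (`|e * harmonic m| <= 1)%R & (fun m => e * harmonic m)%R @ \oo --> (0%R : R)^'].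
Proof.
move=> e1; have e0 : e != 0%R by rewrite -normr_gt0 e1.
split; last exact: harmonic_dnbhs.
- by move=> m; rewrite mulf_neq0// gt_eqF// /harmonic/= invr_gt0.
- by move=> m; rewrite normrM e1 mul1r /harmonic/= ger0_norm ?invr_ge0// invf_le1// ler1n.
Qed.

Let dct (al be e : R) : (`|e| = 1)%R -> lam.-integrable `]al, be] G /\
  (fun m => fine (\int[lam]_(s in `]al, be]) D (e * harmonic m) s)) @ \oo -->
    fine (\int[lam]_(s in `]al, be]) G s).
Proof.
move=> /step_facts[h0 h1 hc]; pose k : R^nat := (fun m => e * harmonic m)%R.
have k0 m : k m != 0%R by exact: h0.
have k1 m : (`|k m| <= 1)%R by exact: h1.
have kc : k @ \oo --> (0%R : R)^' by exact: hc.
have [M hM] := D_bound (Num.max `|al| `|be|)%R.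
have inM s : s \in `]al, be] -> (`|s| <= Num.max `|al| `|be|)%R.
  rewrite in_itv/= => /andP[as_ sb].
  by rewrite ler_norml; have := ler_norm (- al)%R; have := ler_norm be; rewrite normrN;
    case: (leP `|al| `|be|)%R; move=> *; apply/andP; split; lra.
have [iG _ cI] : [/\ lam.-integrable `]al, be] G,
   [sequence \int[lam]_(s in `]al, be]) `|D (k n) s - G s|]_n @ \oo --> 0 &
   [sequence \int[lam]_(s in `]al, be]) D (k n) s]_n @ \oo --> \int[lam]_(s in `]al, be]) G s].
  apply: (@dominated_convergence _ _ _ lam `]al, be]%classic _ (fun n => D (k n)) G (cst M%:E)) => //.
  - by move=> n; exact: (measurable_funTS (mD (k n))).
  - exact: (measurable_funTS mG).
  - by apply: ae_mono (D_cvg _ k1 kc) => s h _.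
  - apply: (ae_bounded_integrable _ _ `|M|%R) => //; first exact: lebesgue_itv_oc_fin.
    by apply/aeW => s _; rewrite /= lee_fin.
  - by apply: ae_mono hM => s h n sab; apply: h => //; exact: inM.
split => //.
by apply: fine_cvg; rewrite fineK//; exact: integrable_fin_num iG.
Qed.

(** Q is the divided left-hand side and I the averaged right-hand side along the steps e / (m + 1).
    The factor e records the reversal of the inequality when the step is negative. *)
Let slope_bound (al be e : R) : L al -> L be -> (al < be)%R -> (`|e| = 1)%R ->
  exists Q I : R^nat, [/\ Q @ \oo --> (F be - F al)%R,
    I @ \oo --> fine (\int[lam]_(s in `]al, be]) G s) & forall n, (e * Q n <= e * I n)%R].
Proof.
move=> Lal Lbe ab e1; have [h0 h1 hc] := step_facts e e1.
pose k : R^nat := (fun m => e * harmonic m)%R.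
have k0 m : k m != 0%R by exact: h0.
have k1 m : (`|k m| <= 1)%R by exact: h1.
have kc : k @ \oo --> (0%R : R)^' by exact: hc.
have [n hn] : exists n : nat, (`|al| + `|be| + 1 <= n%:R)%R.
  exists (Num.bound (`|al| + `|be| + 1)%R); apply/ltW/archi_boundP.
  by rewrite !addr_ge0.
have bnd x : x = al \/ x = be -> (`|x| <= n%:R)%R /\ forall m, (`|x + k m| <= n%:R)%R.
  move=> xE; have xn : (`|x| + 1 <= n%:R)%R.
    by case: xE hn => ->; have := normr_ge0 al; have := normr_ge0 be; lra.
  split; first by lra.
  by move=> m; apply: le_trans (ler_normD _ _) _; have := k1 m; lra.
have [aln alk] := bnd al (or_introl erefl).
have [ben bek] := bnd be (or_intror erefl).
pose Q (m : nat) : R := (((Phi n (be + k m) - Phi n be) / k m) - ((Phi n (al + k m) - Phi n al) / k m))%R.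
pose I (m : nat) : R := fine (\int[lam]_(s in `]al, be]) D (k m) s).
exists Q, I; split.
- have [dal Dal] := Lal n; have [dbe Dbe] := Lbe n.
  rewrite -(FtE n be ben) -(FtE n al aln) -Dal -Dbe.
  by apply: cvgB; exact: cvg_difference_quotient.
- by have [_] := dct al be e e1.
- move=> m.
  have : \int[lam]_(s in `]al, be]) (F (s + k m) - F s)%:E <=
      \int[lam]_(s in `]al, be]) ((k m)%:E * D (k m) s).
    apply: ae_le_integral => //.
    + have [N hN] := F_bound n%:R.
      have sn (s : R) : s \in `]al, be] -> (`|s| <= n%:R)%R /\ (`|s + k m| <= n%:R)%R.
        rewrite in_itv/= => /andP[as_ sb].
        have := alk m; have := bek m; move: aln ben; rewrite !ler_norml.
        move=> /andP[h1' _] /andP[_ h2'] /andP[_ h3'] /andP[h4' _].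
        by split; apply/andP; split; lra.
      apply: (ae_bounded_integrable _ _ (N + N)%R) => //; first exact: lebesgue_itv_oc_fin.
      * apply/measurable_EFinP; apply: measurable_funTS; apply: measurable_funB => //.
        by apply: (measurableT_comp mF); exact: measurable_funD.
      * apply: ae_mono (ae_and _ _ hN (ae_shift (k m) _ hN)) => s [b1 b2] /sn[s1 s2].
        by rewrite abse_EFin lee_fin (le_trans (ler_normB _ _))// lerD//; [exact: b2|exact: b1].
    + by apply: integrableZl => //; exact: iD.
    + by apply: ae_mono (F_incr _ (k0 m) (k1 m)) => s h _.
  rewrite (increment n)// ?(ltW ab)// integralZl//; last exact: iD.
  rewrite -[X in _ * X]fineK; last by apply: integrable_fin_num => //; exact: iD.
  rewrite -EFinM lee_fin -/(I m) => h.
  have hp : (0 < harmonic m :> R)%R by rewrite /harmonic/= invr_gt0.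
  (* Division is by the positive number 1 / (m + 1), with the sign e kept apart, so both cases are
     treated together. *)
  rewrite -(ler_pM2l hp) !mulrA [(harmonic m * e)%R]mulrC -/(k m).
  by apply: le_trans h; rewrite /Q le_eqVlt; apply/orP; left; apply/eqP; field.
Qed.

(** Steps to the right bound the integral from below and steps to the left from above; both bounds
    have the limit F (be) - F (al). *)
Lemma increment_formula : exists2 P : R -> Prop, {ae lam, forall x, P x} &
  forall al be, P al -> P be -> (al < be)%R ->
    \int[lam]_(s in `[al, be]) G s = (F be - F al)%:E.
Proof.
exists L => // al be Lal Lbe ab.
have [iG _] := dct al be 1%R (normr1 _).
have [Q [I [cQ cI QI]]] := slope_bound al be 1%R Lal Lbe ab (normr1 _).
have [Q' [I' [cQ' cI' QI']]] := slope_bound al be (-1)%R Lal Lbe ab (normrN1 _).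
rewrite -integral_itv_obnd_cbnd; last exact: measurable_funTS.
rewrite -[LHS]fineK; last exact: integrable_fin_num iG.
congr (_%:E); apply/eqP; rewrite eq_le; apply/andP; split.
- apply: (ler_cvg_to cI' cQ'); apply: nearW => n.
  by have := QI' n; rewrite !mulN1r lerN2.
- apply: (ler_cvg_to cQ cI); apply: nearW => n.
  by have := QI n; rewrite !mul1r.
Qed.

Let iG al be : lam.-integrable `]al, be] G.
Proof. by have [] := dct al be 1%R (normr1 _). Qed.

(** A common lower endpoint m removes the case distinction of [oint]: differences of integrals from
    m need no ordering of x and y. *)
Lemma oint_subE (m x y : R) : (m <= x)%R -> (m <= y)%R ->
  oint x y G = \int[lam]_(s in `]m, y]) G s - \int[lam]_(s in `]m, x]) G s.
Proof.
have add (u v : R) : (m <= u)%R -> (u <= v)%R -> \int[lam]_(s in `[u, v]) G s =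
    \int[lam]_(s in `]m, v]) G s - \int[lam]_(s in `]m, u]) G s.
  move=> mu uv; rewrite -integral_itv_obnd_cbnd; last exact: (measurable_funTS mG).
  have fin u' v' : \int[lam]_(s in `]u', v']) G s \is a fin_num.
    exact: integrable_fin_num (iG _ _).
  rewrite (@itv_bndbnd_setU _ _ (BRight m) (BRight u) (BRight v)) ?bnd_simp//.
  rewrite integral_setU//=.
  - by rewrite addeAC subee ?add0e.
  - exact: (measurable_funTS mG).
  - apply/disj_setPS => s [/=]; rewrite 2!in_itv/= => /andP[_ su] /andP[].
    by rewrite ltNge su.
move=> mx my; rewrite /oint; case: leP => [xy|/ltW yx]; first exact: add.
rewrite add// fin_num_oppeB//; last exact: integrable_fin_num (iG _ _).
by rewrite addeC.
Qed.

(** The origin need not be a Lebesgue point, so the formula is anchored at some Lebesgue point x0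
    and the discrepancy goes into c. *)
Lemma oint_increment : exists c : R, {ae lam, forall x, oint 0 x G = (F x - c)%:E}.
Proof.
have [P aeP PG] := increment_formula.
have [x0 Px0] := ae_nonempty _ aeP.
have fin u v : \int[lam]_(s in `]u, v]) G s \is a fin_num.
  exact: integrable_fin_num (iG _ _).
exists (F x0 - fine (oint 0 x0 G))%R; apply: ae_mono aeP => x Px.
pose m := Num.min 0%R (Num.min x0 x).
have [m0 mx0 mx] : [/\ m <= 0, m <= x0 & m <= x]%R.
  by rewrite !ge_min !lexx !orbT.
have x0x : \int[lam]_(s in `]m, x]) G s - \int[lam]_(s in `]m, x0]) G s = (F x - F x0)%:E.
  rewrite -(oint_subE m)// /oint; have [lt|lt|->] := ltgtP x0 x.
  - exact: PG.
  - by rewrite PG// -EFinN opprB.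
  - by rewrite set_itv1 integral_set1 subrr.
move: x0x (fin m x) (fin m x0) (fin m 0%R); rewrite (oint_subE m _ _ m0 mx) (oint_subE m _ _ m0 mx0).
move: (\int[lam]_(s in `]m, x]) G s) (\int[lam]_(s in `]m, x0]) G s) (\int[lam]_(s in `]m, 0%R]) G s).
move=> [u||] [v||] [w||]//= [E] _ _ _; rewrite -EFinB; congr (_%:E).
have FE : F x = (F x0 + (u - v))%R by rewrite E; ring.
by rewrite FE; ring.
Qed.

End increments.

(** * The marginal formula *)

Section marginal.
Context {R : realType} {d : nat}.
Local Notation T := 'rV[R]_d.
Local Notation lam := (@lebesgue_measure R).
Local Open Scope ereal_scope.
Variables (i1 : 'I_d) (V : T -> R) (a C0 : R).
Local Notation others := (others i1).
Local Notation b := (pi_dens V).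
Local Notation star_kernel := (star_kernel i1).
Local Notation wq := (wq i1).
Local Notation gibbs1 := (gibbs1 i1 V).
Hypotheses (hC2 : C2 V) (a0 : (0 < a)%R).
Hypothesis V_ge : forall z, (a * sqnorm z - C0 <= V z)%R.
Hypothesis hgrowth : growth V.
Variable alpha : R.
Hypotheses (alpha0 : (0 < alpha)%R) (hconv : hess_ge V alpha).

Let mV : measurable_fun setT V.
Proof. by apply: continuous_measurable_rowvec; exact: C2_continuous. Qed.
Let mb : measurable_fun setT b. Proof. exact: measurable_pi_dens. Qed.
Let b0 : forall z, (0 < b z)%R. Proof. exact: (pi_dens_gt0 V a C0). Qed.
Let bT : intRd (EFin \o b) = 1. Proof. exact: (int_pi_dens V a C0). Qed.
Let bS : forall S z, uniq S -> int_over S (EFin \o b) z < +oo.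
Proof. exact: (int_over_pi_dens_fin V a C0). Qed.
Let bO z : int_over others (EFin \o b) z < +oo. Proof. by apply: bS; exact: uniq_others. Qed.

Variables (p : R -> R) (q : 'I_d -> R -> R -> R).
Hypothesis pq : is_star i1 p q.
Hypothesis hmin : forall p' q', is_star i1 p' q' ->
  KL (star_dens i1 p q) V <= KL (star_dens i1 p' q') V.

Let sq : star_kernel q. Proof. by have [_ [_ [_]]] := pq. Qed.
Let q0 := partition1_cube_gt0 i1 V a C0 mV a0 V_ge hgrowth.

Variable K : R.
Local Notation good := (good i1 V q K).
Local Notation mu s := (coord_measure others (setc (0%R : T) i1 s)).

Definition push (k : R) (y : T) : T := setc y i1 (y 0 i1 + k)%R.
Definition slope (k : R) (y : T) : R := ((V (push k y) - V y) / k)%R.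
Definition mean_slope (k s : R) : \bar R :=
  int_over others (fun y => (slope k y * wq q y)%:E) (setc 0%R i1 s).

Let measurable_push k : measurable_fun setT (push k).
Proof.
apply: measurable_setc => //; apply: measurable_funD => //; exact: measurable_coord.
Qed.

Let measurable_slope k : measurable_fun setT (slope k).
Proof.
apply: measurable_funM => //; apply: measurable_funB => //.
exact: (measurableT_comp mV (measurable_push k)).
Qed.

Lemma sqnorm_setc (y : T) (i : 'I_d) (t : R) :
  sqnorm (setc y i t) = (sqnorm y - y 0 i ^+ 2 + t ^+ 2)%R.
Proof.
rewrite /sqnorm (bigD1 i)//= [X in _ = (X - _ + _)%R](bigD1 i)//= setcE eqxx.
rewrite (eq_bigr (fun j => y 0%R j ^+ 2)%R); first by ring.
by move=> j ji; rewrite setcE (negbTE ji).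
Qed.

(** The bound |y + k e_1|^2 <= 2 |y|^2 + 2 k^2 <= 2 |y|^2 + 8 doubles the rate a / 4 to a / 2 and
    costs the factor exp (2 a). Shifts up to 2 are needed because [partial_bound] reaches 1 beyond a
    point already shifted by at most 1. *)
Lemma growth_push : exists2 c, (0 <= c)%R & forall k y, (`|k| <= 2)%R ->
  (`|V (push k y)| <= c * expR (a / 2 * sqnorm y))%R.
Proof.
have [c1 [c10 hc]] := hgrowth (a / 4)%R ltac:(by rewrite divr_gt0).
exists (c1 * expR (2 * a))%R; first by rewrite mulr_ge0 ?expR_ge0 ?(ltW c10).
move=> k y k2; apply: le_trans (hc _) _.
rewrite -[leRHS]mulrA -expRD ler_wpM2l ?(ltW c10)// ler_expR /push sqnorm_setc.
have yi : (y 0 i1 ^+ 2 <= sqnorm y)%R.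
  by rewrite /sqnorm (bigD1 i1)//= lerDl sumr_ge0// => j _; rewrite sqr_ge0.
have kk : (k ^+ 2 <= 4)%R by rewrite -real_normK ?num_real//; have := normr_ge0 k; nra.
have : (sqnorm y - y 0 i1 ^+ 2 + (y 0 i1 + k) ^+ 2 <= 2 * sqnorm y + 8)%R.
  by have := sqr_ge0 (y 0 i1 - k)%R; rewrite !expr2 in yi kk *; lra.
move=> /(ler_wpM2l (ltW (divr_gt0 a0 (ltr0n _ 4)))) /le_trans; apply.
by rewrite le_eqVlt; apply/orP; left; apply/eqP; field.
Qed.

(** A difference quotient is a partial derivative at an intermediate point, and [partial_bound]
    controls it by three values of V, hence the factor 3. This is the common dominating function for
    all steps. *)
Lemma slope_growth : exists2 c, (0 <= c)%R & forall y,
  (`|partial i1 V y| <= c * expR (a / 2 * sqnorm y))%R /\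
  forall k, (`|k| <= 1)%R -> (`|slope k y| <= c * expR (a / 2 * sqnorm y))%R.
Proof.
have [c c0 hc] := growth_push.
exists (3 * c)%R; first by rewrite mulr_ge0.
move=> y.
have hp (u : R) : (`|u| <= 1)%R ->
    (`|partial i1 V (setc y i1 (y 0 i1 + u))| <= 3 * c * expR (a / 2 * sqnorm y))%R.
  move=> u1; apply: le_trans (partial_bound V alpha hC2 alpha0 hconv i1 y _) _.
  have h (e : R) : (`|e| <= 1)%R -> (`|V (setc y i1 (y 0 i1 + u + e)%R)| <= c * expR (a / 2 * sqnorm y))%R.
    move=> e1; rewrite -addrA; apply: hc; apply: le_trans (ler_normD _ _) _; lra.
  have := h 1%R; have := h (-1)%R; have := h 0%R.
  rewrite normrN normr1 normr0 addr0 => /(_ ler01) h1 /(_ (lexx _)) h2 /(_ (lexx _)) h3.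
  by lra.
split; first by have := hp 0%R; rewrite normr0 addr0 setc_id; apply.
move=> k k1; rewrite /slope /push.
have dV z : derivable V z (evec R i1) by exact: C2_derivable.
have [k0|k0|->] := ltgtP k 0%R.
- have [c' /andP[h1 h2] E] := MVT_setc V i1 y (y 0%R i1 + k)%R (y 0%R i1) dV ltac:(by lra).
  move: E; rewrite setc_id => E.
  have -> : ((V (setc y i1 (y 0 i1 + k)) - V y) / k)%R = partial i1 V (setc y i1 c').
    by rewrite -opprB E; field; rewrite lt_eqF.
  have := hp (c' - y 0 i1)%R; rewrite [(y 0 i1 + _)%R]addrC subrK; apply.
  by move: k1; rewrite !ler_norml => /andP[? ?]; apply/andP; split; lra.
- have [c' /andP[h1 h2] E] := MVT_setc V i1 y (y 0%R i1) (y 0%R i1 + k)%R dV ltac:(by lra).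
  move: E; rewrite setc_id => E.
  have -> : ((V (setc y i1 (y 0 i1 + k)) - V y) / k)%R = partial i1 V (setc y i1 c').
    by rewrite E; field; rewrite gt_eqF.
  have := hp (c' - y 0 i1)%R; rewrite [(y 0 i1 + _)%R]addrC subrK; apply.
  by move: k1; rewrite !ler_norml => /andP[? ?]; apply/andP; split; lra.
- by rewrite invr0 mulr0 normr0 mulr_ge0 ?expR_ge0// mulr_ge0.
Qed.

Let Pi : forall j, j != i1 -> j != i1. Proof. by []. Qed.

Let zs s : setc (0%R : T) i1 s 0%R i1 = s. Proof. by rewrite setcE eqxx. Qed.

Lemma weighted_integrable_others (H : T -> R) (k s : R) : good s -> measurable_fun setT H ->
  (0 <= k)%R -> (forall y, `|H y| <= k * expR (a / 2 * sqnorm y))%R ->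
  (mu s).-integrable setT (fun y => (H y * wq q y)%:E).
Proof.
move=> gs mH k0 Hk.
have gs' : good (setc (0%R : T) i1 s 0%R i1) by rewrite zs.
exact: (weighted_integrable i1 V a C0 mV a0 V_ge p q pq K (fun j => j != i1) H k _ Pi gs' mH k0 Hk).
Qed.

(** The first coordinate is not integrated, so moving the base point is the same as translating the
    integrand. *)
Lemma int_over_push (F : T -> \bar R) k s :
  int_over others F (setc 0%R i1 (s + k)%R) = int_over others (F \o push k) (setc 0%R i1 s).
Proof.
rewrite !int_over_setc ?i1_others//; apply: eq_int_over => y.
by rewrite /= /push setcK setcE eqxx.
Qed.

Lemma integrable_push (F : T -> \bar R) k s : measurable_fun setT F ->
  (mu s).-integrable setT (F \o push k) -> (mu (s + k)%R).-integrable setT F.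
Proof.
move=> mF /integrableP[mFk Foo]; apply/integrableP; split => //.
rewrite -ge0_int_over_integral//; last exact: measurableT_comp.
rewrite int_over_push ge0_int_over_integral//.
- by apply: (measurableT_comp _ (measurable_push k)); exact: measurableT_comp.
- by move=> y; exact: abse_ge0.
Qed.

Let Z : R := fine (intRd (fun z => (expR (- V z))%:E)).

Let entropy (w : T -> R) s := fine (int_over others (EFin \o entropy_fun w) (setc 0%R i1 s)).
Let energy (w : T -> R) s := fine (int_over others (fun y => (V y * w y)%:E) (setc 0%R i1 s)).

Section free.
Variables (q' : 'I_d -> R -> R -> R) (s : R).
Hypothesis sq' : star_kernel q'.
Hypothesis iV : (mu s).-integrable setT (fun y => (V y * wq q' y)%:E).

Let m := wq q'.
Let mm : measurable_fun setT m. Proof. exact: measurable_wq. Qed.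
Let m0 y : (0 <= m y)%R. Proof. exact: wq_ge0. Qed.
Let m1 : \int[mu s]_y (m y)%:E = 1.
Proof.
rewrite -(ge0_int_over_integral _ (EFin \o m))//; first exact: int_wq.
exact/measurable_EFinP.
Qed.
Let bB : \int[mu s]_y (b y)%:E = (int_b b others (setc 0%R i1 s))%:E.
Proof.
rewrite -int_bE//.
rewrite [RHS]ge0_int_over_integral//; first exact/measurable_EFinP.
by move=> y; rewrite lee_fin ltW.
Qed.
Let im : (mu s).-integrable setT (fun y => (m y)%:E).
Proof.
apply/integrableP; split; first exact/measurable_EFinP.
by under eq_integral do rewrite gee0_abs ?lee_fin//; rewrite m1 ltry.
Qed.
Let EU y : (EFin \o energy_fun m b) y = (-1)%:E * (V y * m y)%:E + (- ln Z)%:E * (m y)%:E.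
Proof.
rewrite /= -!EFinM -EFinD /energy_fun (ln_pi_dens V a C0 mV a0 V_ge); congr (_%:E).
by rewrite -/Z; ring.
Qed.
Let iU : (mu s).-integrable setT (EFin \o energy_fun m b).
Proof.
rewrite (funext EU).
exact: (integrableD measurableT (integrableZl measurableT _ iV) (integrableZl measurableT _ im)).
Qed.

Lemma integrable_entropy_wq : (0 < gibbs1 q' s)%R ->
  (mu s).-integrable setT (EFin \o entropy_fun m).
Proof. exact: (integrable_entropy _ m b mm mb m0 b0 m1 _ bB iU). Qed.

(** Stated for a general kernel at one point because it is applied both to [q] at s and to its
    translate at s + k. *)
Lemma gibbs1_free : (mu s).-integrable setT (EFin \o entropy_fun m) ->
  gibbs1 q' s = expR (- (entropy m s + energy m s + ln Z)).
Proof.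
move=> iE.
rewrite /Submission.gibbs1 /gibbs_at (gibbsE_free _ m b mm mb m0 b0 m1 _ bB iU iE).
congr expR.
rewrite /entropy /energy (int_overE _ _ _ _ iE); last first.
  by apply/measurable_EFinP; exact: measurable_entropy_fun.
rewrite (int_overE _ _ _ _ iV); last first.
  by apply/measurable_EFinP; exact: measurable_funM.
rewrite [X in (_ - fine X)%R](eq_integral _ _ (fun y _ => EU y)).
rewrite (integralD measurableT (integrableZl measurableT _ iV) (integrableZl measurableT _ im)).
rewrite (integralZl measurableT iV) (integralZl measurableT im) m1 mule1.
have fV := integrable_fin_num measurableT iV.
rewrite [fine (_ * _ + _)]fineD ?fin_numM// [fine (_ * _)]fineM//.
by rewrite /=; ring.
Qed.

End free.

Lemma integrable_V_wq s : good s -> (mu s).-integrable setT (fun y => (V y * wq q y)%:E).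
Proof.
move=> gs; have [c c0 hc] := growth_push.
apply: (weighted_integrable_others V c s gs mV c0) => y.
by have := hc 0%R y; rewrite normr0 /push addr0 setc_id; apply.
Qed.

Lemma integrable_slope k s : good s -> (`|k| <= 1)%R ->
  (mu s).-integrable setT (fun y => (slope k y * wq q y)%:E).
Proof.
move=> gs k1; have [c c0 hc] := slope_growth.
apply: (weighted_integrable_others (slope k) c s gs (measurable_slope k) c0) => y.
by have [_] := hc y; apply.
Qed.

Let measurable_slope_wq k : measurable_fun setT (fun y => (slope k y * wq q y)%:E).
Proof. by apply/measurable_EFinP; apply: measurable_funM => //; exact: measurable_wq. Qed.

(* The competitor translated by [k] in the first coordinate: it has the entropy of
   [q] at [s] when evaluated at [s + k], so only the energy changes. *)
Let delay k (j : 'I_d) (x y : R) : R := q j (x - k)%R y.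

Let star_delay k : star_kernel (delay k).
Proof.
move=> j ji; have [h1 [h2 h3]] := sq j ji; split; last by split => *; [exact: h2|exact: h3].
have -> : (fun xy : R * R => delay k j xy.1 xy.2) =
  (fun xy : R * R => q j xy.1 xy.2) \o (fun xy : R * R => (xy.1 - k, xy.2)%R) by [].
apply: (measurableT_comp h1); apply/measurable_fun_pairP; split => /=.
- by apply: measurable_funB => //; exact: measurable_fst.
- exact: measurable_snd.
Qed.

Let wq_delay k y : wq (delay k) (push k y) = wq q y.
Proof.
rewrite /Submission.wq; apply: eq_bigr => j ji.
by rewrite /delay /push !setcE eqxx (negbTE ji) addrK.
Qed.

Let neg_log s : R := (- ln (gibbs1 q s))%R.

(** Maximality of E at s + k is tested against the translated kernel, whose free energy there is
    that of [q] at s plus k times the mean slope. *)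
Lemma neg_log_increment k : (k != 0)%R -> (`|k| <= 1)%R -> {ae lam, forall s, good s} ->
  {ae lam, forall s, (neg_log (s + k) - neg_log s)%:E <= k%:E * mean_slope k s}.
Proof.
move=> k0 k1 aeg.
have := optimal_kernel i1 V mb b0 bT bO p q pq hmin q0 (delay k) (star_delay k).
(* Maximality holds at almost every point; translation invariance of null sets turns this into
   almost every s, evaluated at s + k. *)
move/(ae_shift k) => h; apply: ae_mono (ae_and _ _ aeg h) => s [gs hs].
have iV := integrable_V_wq s gs.
have iS := integrable_slope k s gs k1.
have E0 := good_gt0 i1 V q K s gs.
have iE := integrable_entropy_wq q s sq iV E0.
have Vpush y : V (push k y) = (V y + k * slope k y)%R by rewrite /slope; field.
have pushE (y : T) : (V (push k y) * wq (delay k) (push k y))%:E =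
    (V y * wq q y)%:E + k%:E * (slope k y * wq q y)%:E.
  by rewrite wq_delay Vpush -EFinM -EFinD; congr (_%:E); ring.
have iP : (mu s).-integrable setT ((fun y => (V y * wq (delay k) y)%:E) \o push k).
  have -> : (fun y => (V y * wq (delay k) y)%:E) \o push k =
      (fun y => (V y * wq q y)%:E + k%:E * (slope k y * wq q y)%:E) by apply/funext.
  exact: (integrableD measurableT iV (integrableZl measurableT _ iS)).
have mwd : measurable_fun setT (wq (delay k)) by exact: measurable_wq.
have iVd : (mu (s + k)%R).-integrable setT (fun y => (V y * wq (delay k) y)%:E).
  by apply: integrable_push => //; apply/measurable_EFinP; exact: measurable_funM.
have entE : (EFin \o entropy_fun (wq (delay k))) \o push k = EFin \o entropy_fun (wq q).
  by apply/funext => y; rewrite /= /entropy_fun wq_delay.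
have iEd : (mu (s + k)%R).-integrable setT (EFin \o entropy_fun (wq (delay k))).
  apply: integrable_push; last by rewrite entE.
  by apply/measurable_EFinP; exact: measurable_entropy_fun.
have G1 := gibbs1_free q s sq iV iE.
have G2 := gibbs1_free (delay k) (s + k)%R (star_delay k) iVd iEd.
have e1 : entropy (wq (delay k)) (s + k)%R = entropy (wq q) s.
  by rewrite /entropy int_over_push entE.
have fS := integrable_fin_num measurableT iS.
have fV := integrable_fin_num measurableT iV.
have mVw : measurable_fun setT (fun y => (V y * wq q y)%:E).
  by apply/measurable_EFinP; apply: measurable_funM => //; exact: measurable_wq.
have e2 : energy (wq (delay k)) (s + k)%R = (energy (wq q) s + k * fine (mean_slope k s))%R.
  rewrite /energy int_over_push int_overE//; last first.
    apply: (measurableT_comp _ (measurable_push k)); apply/measurable_EFinP.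
    exact: measurable_funM.
  rewrite (eq_integral _ _ (fun y _ => pushE y)).
  rewrite (integralD measurableT iV (integrableZl measurableT _ iS)) (integralZl measurableT iS).
  rewrite [fine (_ + _ * _)]fineD ?fin_numM// [fine (_ * _)]fineM//.
  by rewrite /mean_slope (int_overE _ _ _ mVw iV) (int_overE _ _ _ (measurable_slope_wq k) iS).
have -> : mean_slope k s = (fine (mean_slope k s))%:E.
  by rewrite fineK// /mean_slope (int_overE _ _ _ (measurable_slope_wq k) iS).
rewrite -EFinM lee_fin /neg_log.
have := hs; rewrite /= G2 e1 e2 => hs'.
have Epos : (0 < gibbs1 q (s + k)%R)%R by apply: lt_le_trans hs'; exact: expR_gt0.
have : (- (entropy (wq q) s + (energy (wq q) s + k * fine (mean_slope k s)) + ln Z) <=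
    ln (gibbs1 q (s + k)%R))%R.
  by rewrite -ler_expR lnK.
move=> h'; rewrite G1 expRK opprK lerBlDr lerNl; apply: le_trans h'.
by rewrite le_eqVlt; apply/orP; left; apply/eqP; ring.
Qed.

Let rest_sq_others s : rest_sq others (setc (0%R : T) i1 s) = (s ^+ 2)%R.
Proof.
rewrite /rest_sq (big_pred1 i1) ?zs// => j.
by rewrite in_others negbK.
Qed.

(** Lower bound for E on [- t, t]; absolute values appear because [K] carries no sign assumption
    here. *)
Let lower t : R := expR (- (`|K| * expR (t ^+ 2) + `|K|)).

Lemma good_lower s t : good s -> (`|s| <= t)%R -> (lower t <= gibbs1 q s)%R.
Proof.
move=> [h _] st; apply: le_trans h; rewrite ler_expR lerN2.
apply: lerD; last exact: ler_norm.
apply: le_trans (ler_wpM2r (expR_ge0 _) (ler_norm K)) _.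
rewrite ler_wpM2l// ler_expR -[leLHS]real_normK ?num_real//.
by rewrite lerXn2r ?nnegrE// (le_trans _ st).
Qed.

(** E lies between the cube bound and the mass of the slice, both locally uniform in s; the 1 in k +
    1 keeps the argument of the logarithm positive. *)
Lemma neg_log_bound t : {ae lam, forall s, good s} ->
  exists M : R, {ae lam, forall s, (`|s| <= t -> `|neg_log s| <= M)%R}.
Proof.
move=> aeg; have [k k0 hk] := int_b_le V a C0 mV a0 V_ge others (uniq_others i1).
exists ((`|K| * expR (t ^+ 2) + `|K|) + `|ln (k + 1)|)%R.
apply: ae_mono aeg => s gs st; have E0 := good_gt0 i1 V q K s gs.
have h1 := good_lower s t gs st.
have h2 : (gibbs1 q s <= k + 1)%R.
  apply: le_trans (gibbs1_le i1 V mb b0 bO q s sq) _.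
  apply: le_trans (hk _) _; rewrite mulNr -[leRHS]addr0.
  apply: le_trans (_ : k * 1 <= _)%R; last by rewrite mulr1 addr0 lerDl.
  by rewrite ler_wpM2l// -expR0 ler_expR oppr_le0 mulr_ge0 ?(ltW a0)// rest_sq_ge0.
have l1 : (- (`|K| * expR (t ^+ 2) + `|K|) <= ln (gibbs1 q s))%R by rewrite -ler_expR lnK.
have l2 : (ln (gibbs1 q s) <= ln (k + 1))%R by rewrite ler_ln ?posrE// ltr_wpDl.
have l3 := ler_norm (ln (k + 1))%R.
have l4 : (0 <= `|K| * expR (t ^+ 2) + `|K|)%R by rewrite addr_ge0// mulr_ge0 ?expR_ge0.
have l5 := normr_ge0 (ln (k + 1))%R.
by rewrite /neg_log normrN ler_norml; apply/andP; split; lra.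
Qed.

(** The slopes share one Gaussian majorant, and its moments under q (. | s) are at most Kc / E (s)
    per factor, with E (s) >= [lower t]. The bound holds for all k outside a single null set of
    s. *)
Lemma mean_slope_bound t : {ae lam, forall s, good s} ->
  exists M : R, {ae lam, forall s, (`|s| <= t)%R ->
    forall k, k != 0%R -> (`|k| <= 1)%R -> `|mean_slope k s| <= M%:E}.
Proof.
move=> aeg; have [c c0 hc] := slope_growth.
have [Kc Kc0 hK] := gmomE i1 V a C0 mV a0 V_ge p q pq K.
exists (c * (expR (a / 2 * t ^+ 2) * \prod_(j <- others) (Kc / lower t)))%R.
apply: ae_mono aeg => s gs st k _ k1.
have iS := integrable_slope k s gs k1.
rewrite /mean_slope (int_overE _ _ _ (measurable_slope_wq k) iS).
apply: le_trans (le_abse_integral _ measurableT (measurable_slope_wq k)) _.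
have mw : measurable_fun setT (wq q) by exact: measurable_wq.
have w0 y : (0 <= wq q y)%R by exact: wq_ge0.
have me : measurable_fun setT (fun y : T => (expR (a / 2 * sqnorm y) * wq q y)%:E).
  by apply/measurable_EFinP; apply: measurable_funM => //; exact: measurable_expR_sqnorm.
have e0 y : 0 <= (expR (a / 2 * sqnorm y) * wq q y)%:E by rewrite lee_fin mulr_ge0 ?expR_ge0.
apply: (@le_trans _ _ (\int[mu s]_y (c%:E * (expR (a / 2 * sqnorm y) * wq q y)%:E))).
  apply: ge0_le_integral => //.
  - by apply: measurableT_comp => //; exact: measurable_slope_wq.
  - exact: measurable_funeM.
  - move=> y _; rewrite abse_EFin -EFinM lee_fin normrM [X in (_ * X)%R]ger0_norm// mulrA.
    by rewrite ler_wpM2r//; have [_] := hc y; apply.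
have gs' : good (setc (0%R : T) i1 s 0%R i1) by rewrite zs.
rewrite ge0_integralZl// -ge0_int_over_integral//.
rewrite (weighted_moment i1 V a C0 mV a0 V_ge p q pq K (fun j => j != i1) _ Pi gs').
rewrite -EFinM lee_fin ler_wpM2l// rest_sq_others zs.
have l0 : (0 < lower t)%R by exact: expR_gt0.
apply: ler_pM.
- exact: expR_ge0.
- rewrite big_seq; apply: prodr_ge0 => j jo; have [_ /andP[]] := hK s gs j jo; by [].
- rewrite ler_expR ler_wpM2l ?divr_ge0 ?(ltW a0)// -[leLHS]real_normK ?num_real//.
  by rewrite lerXn2r ?nnegrE// (le_trans _ st).
- rewrite big_seq [leRHS]big_seq; apply: ler_prod => j jo.
  have [_ /andP[-> h]] := hK s gs j jo; apply: le_trans h _.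
  rewrite ler_wpM2l// lef_pV2 ?posrE//; last exact: good_gt0 gs.
  exact: good_lower.
Qed.

(** Dominated convergence at a fixed good s: the slopes tend pointwise to d_1 V, and the majorant of
    [slope_growth] is integrable against the kernel. *)
Lemma mean_slope_cvg (k : R^nat) s : good s -> (forall n, `|k n| <= 1)%R ->
  k @ \oo --> (0%R : R)^' -> mean_slope (k n) s @[n --> \oo] --> cond_dV1 i1 V q s.
Proof.
move=> gs k1 kc; have [c c0 hc] := slope_growth.
have mp : measurable_fun setT (partial i1 V).
  by apply: continuous_measurable_rowvec; exact: C2_partial_continuous.
have mw : measurable_fun setT (wq q) by exact: measurable_wq.
have mpw : measurable_fun setT (fun y => (partial i1 V y * wq q y)%:E).
  by apply/measurable_EFinP; exact: measurable_funM.
have w0 y : (0 <= wq q y)%R by exact: wq_ge0.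
have me : measurable_fun setT (fun y : T => c * expR (a / 2 * sqnorm y))%R.
  by apply: measurable_funM => //; exact: measurable_expR_sqnorm.
have [ip _ ci] : [/\ (mu s).-integrable setT (fun y => (partial i1 V y * wq q y)%:E),
   [sequence \int[mu s]_y `|(slope (k n) y * wq q y)%:E - (partial i1 V y * wq q y)%:E|]_n @ \oo --> 0 &
   [sequence \int[mu s]_y (slope (k n) y * wq q y)%:E]_n @ \oo -->
     \int[mu s]_y (partial i1 V y * wq q y)%:E].
  apply: (@dominated_convergence _ _ _ (mu s) setT measurableT
    (fun n y => (slope (k n) y * wq q y)%:E) _ (fun y => (c * expR (a / 2 * sqnorm y) * wq q y)%:E)) => //.
  - apply: aeW => y _; apply: cvg_EFin; first by apply: nearW.
    have dV : derivable V (setc y i1 (y 0%R i1)) (evec R i1) by exact: C2_derivable.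
    have dg := is_derive_setc V i1 y (y 0%R i1) dV.
    have [dg1 dg2] := (@ex_derive _ _ _ _ _ _ _ dg, @derive_val _ _ _ _ _ _ _ dg).
    have := cvg_difference_quotient _ _ k dg1 kc.
    rewrite dg2 setc_id => h.
    by apply: cvgMl.
  - apply: (weighted_integrable_others _ c s gs me c0) => y.
    by rewrite ger0_norm// mulr_ge0 ?expR_ge0.
  - apply: aeW => y n _; rewrite abse_EFin lee_fin normrM [X in (_ * X)%R]ger0_norm//.
    by rewrite ler_wpM2r//; have [_] := hc y; apply.
have -> : (fun n => mean_slope (k n) s) = [sequence \int[mu s]_y (slope (k n) y * wq q y)%:E]_n.
  apply/funext => n; have iS := integrable_slope (k n) s gs (k1 n).
  by rewrite /mean_slope (int_overE _ _ _ (measurable_slope_wq (k n)) iS).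
by rewrite /cond_dV1 (int_overE _ _ _ mpw ip).
Qed.

Lemma marginal_formula : {ae lam, forall s, good s} -> exists C : R, (0 < C)%R /\
  {ae lam, forall z1, exists r : R, oint 0 z1 (cond_dV1 i1 V q) = r%:E /\
    p z1 = (C * expR (- r))%R}.
Proof.
move=> aeg.
have mp : measurable_fun setT (partial i1 V).
  by apply: continuous_measurable_rowvec; exact: C2_partial_continuous.
have mw : measurable_fun setT (wq q) by exact: measurable_wq.
have mpw : measurable_fun setT (fun y => (partial i1 V y * wq q y)%:E).
  by apply/measurable_EFinP; exact: measurable_funM.
have mF : measurable_fun setT neg_log.
  apply: measurable_funN; apply: (measurableT_comp (@measurable_ln R)).
  exact: measurable_gibbs1.
have mD k : measurable_fun setT (mean_slope k) by exact: measurable_int_over_setc.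
have mG : measurable_fun setT (cond_dV1 i1 V q) by exact: measurable_int_over_setc.
have [c hc] := oint_increment neg_log mean_slope (cond_dV1 i1 V q) mF mD mG
  (fun t => neg_log_bound t aeg) (fun t => mean_slope_bound t aeg)
  (fun k k1 kc => ae_mono _ _ (fun s gs => mean_slope_cvg k s gs k1 kc) aeg)
  (fun k k0 k1 => neg_log_increment k k0 k1 aeg).
have [N0 pE] := optimal_marginal i1 V mb b0 bT bO p q pq hmin q0.
(* p = E / N and E = exp (- F), where F differs from the integral of d_1 V by c. *)
exists (expR (- c) / partition1 i1 V q)%R; split; first by rewrite divr_gt0 ?expR_gt0.
apply: ae_mono (ae_and _ _ aeg (ae_and _ _ hc pE)) => s [gs [-> ->]].
exists (neg_log s - c)%R; split => //.
rewrite mulrAC -expRD; congr (_ / _)%R.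
have -> : (- c - (neg_log s - c) = ln (gibbs1 q s))%R by rewrite /neg_log; ring.
by rewrite lnK// posrE; exact: good_gt0 gs.
Qed.

End marginal.

Theorem mainTheorem3 (R : realType) (d : nat) (hd : (2 <= d)%N)
  (i1 : 'I_d) (hi1 : nat_of_ord i1 = 0%N)
  (V : 'rV[R]_d -> R) (hgrowth : growth V)
  (hC2 : C2 V) (alpha : R) (halpha : 0 < alpha) (hconv : hess_ge V alpha)
  (p : R -> R) (q : 'I_d -> R -> R -> R)
  (hstar : is_star i1 p q)
  (hmin : forall (p' : R -> R) (q' : 'I_d -> R -> R -> R),
      is_star i1 p' q' -> (KL (star_dens i1 p q) V <= KL (star_dens i1 p' q') V)%E)
  (hdiff : exists g : 'rV[R]_d -> R, (forall z, differentiable g z) /\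
      intRd (fun z => (`|g z - star_dens i1 p q z|)%:E) = 0%E) :
  (exists C : R, 0 < C /\
     {ae @lebesgue_measure R, forall z1 : R, exists r : R,
        oint 0 z1 (cond_dV1 i1 V q) = r%:E /\ p z1 = C * expR (- r)}) /\
  (forall i : 'I_d, i != i1 ->
     {ae @lebesgue_measure R, forall z1 : R, exists c : R, 0 < c /\
        {ae @lebesgue_measure R, forall zi : R, exists r : R,
           cond_V i1 V q i z1 zi = r%:E /\ q i z1 zi = c * expR (- r)}}).

Proof.
have [C0 V_ge] := potential_quadratic V alpha hC2 halpha hconv.
(* alpha / 4 is the quadratic rate left by [potential_quadratic]; it is the parameter a of all
   Gaussian estimates. *)
have a0 : 0 < alpha / 4 by rewrite divr_gt0.
have mV : measurable_fun setT V.
  by apply: continuous_measurable_rowvec; exact: C2_continuous.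
have [K aeg] := ae_good i1 V (alpha / 4) C0 mV a0 V_ge hgrowth p q hstar hmin.
split.
  exact: (marginal_formula i1 V (alpha / 4) C0 hC2 a0 V_ge hgrowth alpha halpha hconv p q hstar hmin K aeg).
move=> i ii1; apply: ae_mono aeg => s gs.
exact: (conditional_formula i1 V (alpha / 4) C0 mV a0 V_ge hgrowth p q hstar K i s ii1 gs).
Qed.
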